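(* Let $k\ge1$, let $f$ be a bounded, piecewise continuous probability density on $\mathbb{R}^d$, let $\mathcal{P}_\nu$ be a Poisson process with rate $\nu$ and density $f$, and let $V_{\ell,\nu}$ be the number of vertices of degree $\ell$ in the $k$-nearest-neighbor graph $G_k(\mathcal{P}_\nu)$. There exists $K>k$ such that for all $k\le\ell\le K$, \[ \lim_{\nu\to\infty}\frac1\nu\mathbb{E}[V_{\ell,\nu}]=p_\ell^*,\qquad p_\ell^*=\mathbb{P}\big(\deg(\mathbf{0};\mathcal{H}_1\cup\{\mathbf{0}\})=\ell\big), \] where $\mathcal{H}_1$ is a homogeneous Poisson process on $\mathbb{R}^d$ of rate $1$ (so $p_\ell^*$ depends on $d,k,\ell$ but not on $f$), and $\sum_{\ell=k}^Kp_\ell^*=1$. Similarly, if $\mathcal{X}_n$ consists of $n$ i.i.d. points with density $f$ and $V_{\ell,n}$ is the number of degree-$\ell$ vertices of $G_k(\mathcal{X}_n)$, then almost surely, for all $k\le\ell\le K$, \[ \lim_{n\to\infty}\frac1nV_{\ell,n}=\lim_{n\to\infty}\frac1n\mathbb{E}[V_{\ell,n}]=p_\ell^*. \]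
   Context: The $k$-nearest-neighbor graph $G_k(\mathcal{X})$ of a locally finite $\mathcal{X}\subset\mathbb{R}^d$ connects $x_1,x_2\in\mathcal{X}$ by an edge if $x_2$ is one of the $k$ nearest neighbors of $x_1$ or $x_1$ is one of the $k$ nearest neighbors of $x_2$. $\deg(x;\mathcal{X})$ is the degree of $x$ in $G_k(\mathcal{X})$. A Poisson process of rate $\nu$ and density $f$ consists of $\mathrm{Poisson}(\nu)$ many i.i.d. points of density $f$. *)

(* Defs.v *)
From HB Require Import structures.
From mathcomp Require Import all_boot all_order all_algebra.
From mathcomp Require Import all_classical all_reals all_analysis.

Set Implicit Arguments.
Unset Strict Implicit.
Unset Printing Implicit Defensive.

Import Order.TTheory GRing.Theory Num.Theory.
Import numFieldNormedType.Exports.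

Local Open Scope classical_set_scope.
Local Open Scope ring_scope.

Section knn_defs.
Context {R : realType} (d : nat).

(* Points of R^d are d-tuples of reals (with the product = Borel sigma-algebra). *)
Local Notation pt := (d.-tuple R).

Definition origin : pt := [tuple (0 : R) | i < d].

Definition edist (x y : pt) : R :=
  Num.sqrt (\sum_(i < d) (tnth x i - tnth y i) ^+ 2).

Definition is_knn (k : nat) (S : set pt) (x y : pt) : Prop :=
  [/\ S x, S y, y <> x &
    ~ (exists s : seq pt, [/\ uniq s, size s = k &
         forall z, z \in s -> [/\ S z, z <> x & edist x z < edist x y]])].

Definition knn_edge (k : nat) (S : set pt) (x y : pt) : Prop :=
  is_knn k S x y \/ is_knn k S y x.

Definition knn_deg_is (k : nat) (S : set pt) (x : pt) (l : nat) : Prop :=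
  exists s : seq pt, [/\ uniq s, size s = l &
    forall y, y \in s <-> knn_edge k S x y].

Definition V_count (k l : nat) (pts : seq pt) : nat :=
  count (fun x => `[< knn_deg_is k [set y | y \in pts] x l >]) (undup pts).

Definition open_pt (U : set pt) : Prop :=
  forall x, U x -> exists2 e : R, 0 < e & forall y, edist x y < e -> U y.

Definition continuous_on_pt (f : pt -> R) (U : set pt) : Prop :=
  forall x, U x -> forall e : R, 0 < e -> exists2 del : R, 0 < del &
    forall y, U y -> edist x y < del -> `|f y - f x| < e.

Definition bounded_pt (B : set pt) : Prop :=
  exists M : R, forall x, B x -> forall i, `|tnth x i| <= M.

(* lam is Lebesgue measure on R^d: it gives every closed box its volume
   (this characterizes Lebesgue measure on the Borel sets uniquely). *)
Definition is_lebesgue_d (lam : {measure set pt -> \bar R}) : Prop :=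
  forall a b : pt, (forall i, tnth a i <= tnth b i) ->
    lam [set x | forall i, tnth a i <= tnth x i <= tnth b i] =
      (\prod_(i < d) (tnth b i - tnth a i))%:E.

Definition piecewise_continuous (lam : {measure set pt -> \bar R})
    (f : pt -> R) : Prop :=
  exists (r : nat) (U : nat -> set pt),
    [/\ forall i, (i < r)%N -> open_pt (U i),
        forall i j, (i < r)%N -> (j < r)%N -> i <> j -> U i `&` U j = set0,
        lam (~` \bigcup_(i in `I_r) U i) = 0%E &
        forall i, (i < r)%N -> continuous_on_pt f (U i)].

Definition good_density (lam : {measure set pt -> \bar R}) (f : pt -> R) : Prop :=
  [/\ measurable_fun setT f,
      forall x, 0 <= f x,
      exists M : R, forall x, f x <= M,
      (\int[lam]_x (f x)%:E = 1)%E &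
      piecewise_continuous lam f].

(* Poisson probability mass function (rate r >= 0; rate 0 gives Dirac at 0). *)
Definition pois_pmf (r : R) (m : nat) : R := r ^+ m / m`!%:R * expR (- r).

Section prob.
Context {dO : measure_display} {Omega : measurableType dO}
  (P : probability Omega R).

Definition mutually_independent {I : eqType} (E : I -> set (set Omega)) : Prop :=
  forall (J : seq I) (A : I -> set Omega), uniq J ->
    (forall j, j \in J -> E j (A j)) ->
    P (\bigcap_(j in [set j | j \in J]) A j) = (\prod_(j <- J) P (A j))%E.

Definition events_of_pt (X : Omega -> pt) : set (set Omega) :=
  [set E | exists2 A : set pt, measurable A & E = X @^-1` A].

Definition events_of_nat (N : Omega -> nat) : set (set Omega) :=
  [set E | exists A : set nat, E = N @^-1` A].

Definition has_density (lam : {measure set pt -> \bar R}) (f : pt -> R)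
    (X : Omega -> pt) : Prop :=
  measurable_fun setT X /\
  forall A : set pt, measurable A -> P (X @^-1` A) = (\int[lam]_(x in A) (f x)%:E)%E.

Definition iid_density (lam : {measure set pt -> \bar R}) (f : pt -> R)
    (X : nat -> Omega -> pt) : Prop :=
  (forall i, has_density lam f (X i)) /\
  mutually_independent (fun i => events_of_pt (X i)).

(* P_nu = {X_0, ..., X_(N-1)} is a Poisson process of rate nu and density f:
   N ~ Poisson(nu), independent of the i.i.d. points X_i with density f. *)
Definition poisson_process_model (lam : {measure set pt -> \bar R}) (f : pt -> R)
    (nu : R) (N : Omega -> nat) (X : nat -> Omega -> pt) : Prop :=
  [/\ measurable_fun setT N,
      forall m, P (N @^-1` [set m]) = (pois_pmf nu m)%:E,
      forall i, has_density lam f (X i) &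
      mutually_independent (fun o : option nat =>
        match o with None => events_of_nat N | Some i => events_of_pt (X i) end)].

Definition count_is (S : set pt) (B : set pt) (m : nat) : Prop :=
  exists s : seq pt, [/\ uniq s, size s = m & forall y, y \in s <-> (S y /\ B y)].

Definition homogeneous_PPP (lam : {measure set pt -> \bar R})
    (H : Omega -> set pt) : Prop :=
  [/\ forall w B, measurable B -> bounded_pt B -> exists m, count_is (H w) B m,
      forall B m, measurable B -> bounded_pt B ->
        measurable [set w | count_is (H w) B m] /\
        P [set w | count_is (H w) B m] = (pois_pmf (fine (lam B)) m)%:E &
      forall (r : nat) (B : nat -> set pt) (m : nat -> nat),
        (forall i, (i < r)%N -> measurable (B i) /\ bounded_pt (B i)) ->
        (forall i j, (i < r)%N -> (j < r)%N -> i <> j -> B i `&` B j = set0) ->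
        P (\bigcap_(i in `I_r) [set w | count_is (H w) (B i) (m i)]) =
          (\prod_(i < r) P [set w | count_is (H w) (B i) (m i)])%E].

End prob.
End knn_defs.

(* Main.v *)
(* The neighbourhood of a typical point [x] is exposed to a finite grid of small cells. If the
   set [A] of occupied cells is good (at most one point per cell, a point in every coarse
   block, no ambiguous distance comparison), it alone determines the degree of [x]. Rescaled
   by [(n f(x))^(-1/d)], the occupancy probabilities converge to the Poisson ones
   [v^#|A| exp(-v #|C|)], [v] being the cell volume, and good sets have mass close to 1 for a
   fine grid. Hence [pstar l], the supremum of the mass of the good sets of degree [l], is both
   the limit law of the degree of [x] and the law of the degree of the origin in a unit-rate
   Poisson process. Exchangeability turns this into the limit of the means, and conditioning
   on the number of points into the Poisson statement.
   In general position a cone of small angle at [x] contains at most [k] points having [x]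
   among their [k] nearest neighbours. So degrees are bounded by [K = k + k * ncones], and
   adding a point changes the number of vertices of degree [l] by a bounded amount; its
   variance is then [O(n)] by an Efron-Stein bound. Summing these along the squares, and
   interpolation between them, give the almost sure limit. *)

From HB Require Import structures.
From mathcomp Require Import all_fingroup.
From mathcomp Require Import all_boot all_order all_algebra.
From mathcomp Require Import all_classical all_reals all_analysis.
From mathcomp Require Import measurable_realfun.
From mathcomp Require Import ring lra zify.
Require Import Defs.
Import Order.TTheory GRing.Theory Num.Theory.
Import numFieldNormedType.Exports.
Local Open Scope classical_set_scope.
Local Open Scope ring_scope.

Set Implicit Arguments.
Unset Strict Implicit.
Unset Printing Implicit Defensive.

(** * Euclidean norm and distance *)

Section euclidean_norm.
Context {R : realType} {d : nat}.
Implicit Types (u v : 'I_d -> R) (x y z : d.-tuple R).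

(** A degree depends a priori on the whole configuration. Occupied blocks make it local: between [o]
    and a point [y] beyond a fixed number of blocks lie [k] points closer to [o] than [y] is and
    closer to [y] than [o] is, so [o] and [y] are not joined. Blocks of large volume are rarely
    empty; with [j ^ 2] cells per block side the ambiguous cells on a line number O(j) among order
    [j ^ 2], so the other defects are rare too. [pstar] is a supremum of finite sums because no
    Poisson process is at hand when the limit has to be given, and because different meshes then
    need not be compared. Measurability shapes the rest. Samples are carried to an iterated product
    on tuples, where a degree is a finite boolean combination of distance comparisons. For the
    Poisson process only counts in bounded Borel sets are known to be measurable, so the degree of
    the origin is rebuilt from them by countable operations. *)

Definition nrm v : R := Num.sqrt (\sum_i v i ^+ 2).

Lemma nrm_ge0 v : 0 <= nrm v.
Proof. exact: sqrtr_ge0. Qed.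

Lemma sqr_nrm v : nrm v ^+ 2 = \sum_i v i ^+ 2.
Proof. by rewrite sqr_sqrtr// sumr_ge0// => i _; rewrite sqr_ge0. Qed.

Lemma eq_nrm u v : u =1 v -> nrm u = nrm v.
Proof. by move=> uv; congr Num.sqrt; apply: eq_bigr => i _; rewrite uv. Qed.

Lemma cauchy_schwarz u v : \sum_i u i * v i <= nrm u * nrm v.
Proof.
have [|s0] := lerP (\sum_i u i * v i) 0.
  by move=> /le_trans; apply; rewrite mulr_ge0// nrm_ge0.
rewrite -ler_sqr ?nnegrE ?(ltW s0) ?mulr_ge0 ?nrm_ge0// exprMn !sqr_nrm.
have : 0 <= \sum_i \sum_j (u i * v j - u j * v i) ^+ 2.
  by rewrite sumr_ge0// => i _; rewrite sumr_ge0// => j _; rewrite sqr_ge0.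
have -> : \sum_i \sum_j (u i * v j - u j * v i) ^+ 2 =
    2 * ((\sum_i u i ^+ 2) * (\sum_i v i ^+ 2) - (\sum_i u i * v i) ^+ 2).
  rewrite mulrBr mulr_natl mulr2n expr2 [X in _ + X - _]mulrC !big_distrlr/=.
  rewrite mulr_sumr -sumrN -!big_split/=; apply: eq_bigr => i _.
  rewrite mulr_sumr -sumrN -!big_split/=; apply: eq_bigr => j _; ring.
by rewrite pmulr_rge0// subr_ge0.
Qed.

Lemma nrmD u v : nrm (fun i => u i + v i) <= nrm u + nrm v.
Proof.
rewrite -ler_sqr ?nnegrE ?addr_ge0 ?nrm_ge0// sqrrD !sqr_nrm.
rewrite (eq_bigr (fun i => u i ^+ 2 + v i ^+ 2 + 2 * (u i * v i))); last first.
  by move=> i _; ring.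
rewrite !big_split/= -mulr_sumr -mulr_natl.
by have := cauchy_schwarz u v; lra.
Qed.

Lemma nrmZ (c : R) v : nrm (fun i => c * v i) = `|c| * nrm v.
Proof.
rewrite /nrm -sqrtr_sqr -sqrtrM ?sqr_ge0// mulr_sumr.
by congr Num.sqrt; apply: eq_bigr => i _; rewrite exprMn.
Qed.

Lemma nrmB u v : nrm (fun i => u i - v i) = nrm (fun i => v i - u i).
Proof. by congr Num.sqrt; apply: eq_bigr => i _; ring. Qed.

Lemma nrm_dist u v : `|nrm u - nrm v| <= nrm (fun i => u i - v i).
Proof.
have h (a b : 'I_d -> R) : nrm a - nrm b <= nrm (fun i => a i - b i).
  rewrite lerBlDr; apply: le_trans (nrmD _ _).
  by rewrite (@eq_nrm a (fun i => a i - b i + b i))// => i; ring.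
by rewrite ler_norml h andbT lerNl opprB nrmB h.
Qed.

Lemma coord_le_nrm v i : `|v i| <= nrm v.
Proof.
rewrite -ler_sqr ?nnegrE ?normr_ge0 ?nrm_ge0// sqr_nrm real_normK ?num_real//.
rewrite (bigD1 i)//= lerDl sumr_ge0// => j _; exact: sqr_ge0.
Qed.

Lemma nrm_le v (e : R) : (forall i, `|v i| <= e) -> nrm v <= d%:R * e.
Proof.
move=> ve; have e0 : (0 < d)%N -> 0 <= e.
  by move=> d0; apply: le_trans (ve (Ordinal d0)).
have de0 : 0 <= d%:R * e by case: d e0 => [|d']/= e0; rewrite ?mul0r// mulr_ge0 ?e0.
rewrite -ler_sqr ?nnegrE ?nrm_ge0// sqr_nrm.
apply: (@le_trans _ _ (\sum_(i < d) e ^+ 2)).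
  by apply: ler_sum => i _; rewrite -real_normK ?num_real// ler_sqr ?nnegrE// (le_trans _ (ve i)).
rewrite sumr_const card_ord -[e ^+ 2 *+ d]mulr_natl exprMn ler_wpM2r ?sqr_ge0//.
by rewrite -natrX ler_nat; nia.
Qed.

Lemma edistE x y : edist x y = nrm (fun i => tnth x i - tnth y i).
Proof. by []. Qed.

Lemma edist_ge0 x y : 0 <= edist x y. Proof. exact: nrm_ge0. Qed.

Lemma edistC x y : edist x y = edist y x.
Proof. exact: nrmB. Qed.

Lemma edist_tri y x z : edist x z <= edist x y + edist y z.
Proof. by rewrite !edistE; apply: le_trans (nrmD _ _); rewrite (@eq_nrm _ (fun i => tnth x i - tnth y i + (tnth y i - tnth z i)))// => i; ring. Qed.

Lemma edistxx x : edist x x = 0.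
Proof.
by rewrite edistE /nrm big1 ?sqrtr0// => i _; rewrite subrr expr0n.
Qed.

Lemma edist_eq0 x y : edist x y = 0 -> x = y.
Proof.
move=> xy; apply: eq_from_tnth => i; apply/eqP; rewrite -subr_eq0 -normr_le0.
by rewrite -xy; exact: (coord_le_nrm (fun i => tnth x i - tnth y i)).
Qed.

Lemma edist_gt0 x y : x <> y -> 0 < edist x y.
Proof.
by move=> xy; rewrite lt_neqAle edist_ge0 andbT; apply/eqP => /esym/edist_eq0.
Qed.

End euclidean_norm.

(** * Directions sorted into cones of small angle *)

Section cones.
Context {R : realType} {d : nat}.
Implicit Types (x y z : d.-tuple R).

(* Directions are rounded at scale 1/(d+1), so that two unit vectors with the
   same code are at distance less than 1. *)
Definition cone_code x y : {ffun 'I_d -> 'I_(2 * d.+1).+1} :=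
  [ffun i => inord (Num.truncn (d.+1%:R * ((tnth y i - tnth x i) / edist y x + 1)))].

(** With [u], [v] the unit vectors from [x] to [y] and [z],
    [y - z = (|xy| - |xz|) u + |xz| (u - v)]. Equal codes give [|u - v| < 1], so the right side is
    shorter than [|xy|]. *)
Lemma same_cone_closer x y z : y <> x -> z <> x ->
  cone_code x y = cone_code x z -> edist z x <= edist y x -> edist y z < edist y x.
Proof.
move=> yx zx /ffunP cyz zy.
have y0 := edist_gt0 yx; have z0 := edist_gt0 zx.
pose u i := (tnth y i - tnth x i) / edist y x.
pose v i := (tnth z i - tnth x i) / edist z x.
have bnd w (w0 : 0 < edist w x) i : `|(tnth w i - tnth x i) / edist w x| <= 1.
  rewrite normrM normfV (ger0_norm (ltW w0)) ler_pdivrMr// mul1r.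
  exact: (coord_le_nrm (fun i => tnth w i - tnth x i)).
have uv i : `|u i - v i| <= d.+1%:R^-1.
  have := cyz i; rewrite !ffunE => /(congr1 val).
  have bu := bnd _ y0 i; have bv := bnd _ z0 i.
  rewrite -/(u i) -/(v i) in bu bv *.
  (* Coordinates of unit vectors lie in [-1, 1], so the rounded value is at most [2 * d.+1] and
     [inord] keeps it. *)
  have aux (a : R) : `|a| <= 1 -> 0 <= d.+1%:R * (a + 1) /\
      (Num.truncn (d.+1%:R * (a + 1)) < (2 * d.+1).+1)%N.
    rewrite ler_norml => /andP[a1 a2].
    have p : 0 <= d.+1%:R * (a + 1) by rewrite mulr_ge0//; lra.
    split=> //; rewrite ltnS -(ler_nat R).
    apply: (@le_trans _ _ (d.+1%:R * (a + 1))); first by rewrite truncn_le.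
    rewrite natrM mulrC ler_wpM2r//; lra.
  have [pu tu] := aux _ bu; have [pv tv] := aux _ bv.
  rewrite /= !inordK// => e.
  have /andP[u1 u2] := truncn_itv pu; have /andP[v1 v2] := truncn_itv pv.
  rewrite e in u1 u2.
  rewrite -(ler_pM2l (ltr0Sn R d)) -[X in X * `|_|]ger0_norm// -normrM mulfV//.
  rewrite ler_norml; move: u1 u2 v1 v2; rewrite -natr1; nra.
have nu : nrm u = 1.
  rewrite /u (@eq_nrm _ _ _ (fun i => (edist y x)^-1 * (tnth y i - tnth x i))).
    by rewrite nrmZ -edistE ger0_norm ?invr_ge0 ?edist_ge0// mulVf// gt_eqF.
  by move=> i; rewrite mulrC.
have nuv : nrm (fun i => u i - v i) < 1.
  apply: le_lt_trans (nrm_le uv) _.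
  by rewrite ltr_pdivrMr// mul1r ltr_nat.
rewrite {1}edistE (@eq_nrm _ _ _ (fun i => (edist y x - edist z x) * u i + edist z x * (u i - v i))).
  apply: le_lt_trans (nrmD _ _) _.
  rewrite !nrmZ nu (ger0_norm (ltW z0)) ger0_norm ?subr_ge0//.
  by rewrite mulr1; nra.
by move=> i; rewrite /u /v; field; rewrite !gt_eqF.
Qed.

End cones.

(** * Counting and ranking in finite sequences *)

Section seq_extra.
Context {R : realType} {T : eqType}.
Implicit Types (s t : seq T) (r : T -> R).

Lemma seq_argmax r s : (0 < size s)%N ->
  exists2 y, y \in s & forall z, z \in s -> r z <= r y.
Proof.
elim: s => // a [|b s] IH _; first by exists a; rewrite ?mem_head// => z; rewrite inE => /eqP ->.
have [//|y ys ymax] := IH; have [ay|ya] := lerP (r a) (r y).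
  exists y; first by rewrite in_cons ys orbT.
  by move=> z; rewrite in_cons => /predU1P[->//|/ymax].
exists a; first by rewrite mem_head.
by move=> z; rewrite in_cons => /predU1P[->//|/ymax/le_trans->//]; exact: ltW.
Qed.

(** Induction on the size, removing a point of largest [r]: it lies below no other point, so the
    remaining ranks are unchanged, and its own rank is the size of the rest. *)
Lemma rank_count r s k : uniq s -> {in s &, injective r} ->
  count (fun y => count (fun z => (r z < r y)%R) s < k)%N s = minn k (size s).
Proof.
move: {2}(size s) (leqnn (size s)) => n; elim: n s => [|n IH] s.
  by rewrite leqn0 size_eq0 => /eqP ->; rewrite /= minn0.
have [->|s0] := eqVneq s [::]; first by rewrite /= minn0.
have [y ys ymax] : exists2 y, y \in s & forall z, z \in s -> r z <= r y.
  by apply: seq_argmax; rewrite lt0n size_eq0.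
move=> sn us ri; have p := perm_to_rem ys.
have ur := rem_uniq y us.
have szr : size s = (size (rem y s)).+1 by rewrite (perm_size p).
have notin : y \notin rem y s by rewrite mem_rem_uniq// inE eqxx.
have sub z : z \in rem y s -> z \in s by exact: mem_rem.
have lty z : z \in rem y s -> r z < r y.
  move=> zr; rewrite lt_neqAle ymax ?sub// andbT; apply/eqP => /ri zy.
  by move: (zr); rewrite (zy (sub _ zr) ys) (negbTE notin).
have -> : count (fun y => count (fun z => (r z < r y)%R) s < k)%N s =
  ((size (rem y s) < k) + count (fun y0 => count (fun z => (r z < r y0)%R) (rem y s) < k)%N (rem y s))%N.
  rewrite (permP p)/=; congr addn.
    rewrite (permP p)/= ltxx add0n; congr (nat_of_bool (_ < k)%N).
    by apply/eqP; rewrite -all_count; apply/allP.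
  apply: eq_in_count => z zr; rewrite (permP p)/=; congr (_ < k)%N.
  by rewrite ltNge ymax ?sub.
rewrite IH//; first by rewrite szr; case: ltnP; lia.
  by move: sn; rewrite szr.
by move=> a b /sub ? /sub ?; exact: ri.
Qed.

Lemma count_fiber (I : finType) (g : T -> I) (a : pred T) s :
  count a s = (\sum_(i : I) count (fun x => a x && (g x == i)) s)%N.
Proof.
elim: s => [|x s IH] /=; first by rewrite big1.
rewrite IH big_split/=; congr addn.
rewrite (bigD1 (g x))//= eqxx andbT big1 ?addn0// => i /negbTE.
by rewrite eq_sym => ->; rewrite andbF.
Qed.

Lemma count_le_imp (a b : pred T) s : {in s, forall x, a x -> b x} ->
  (count a s <= count b s)%N.
Proof.
move=> ab; rewrite -(@eq_in_count _ (predI a b))//; last first.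
  by move=> x xs /=; case: (boolP (a x)) => //= /ab ->.
by apply: sub_count => x /andP[].
Qed.

Lemma count_orb_le (a b : pred T) s :
  (count (fun x => a x || b x) s <= count a s + count b s)%N.
Proof. by rewrite -count_predUI leq_addr. Qed.

Lemma count_has_le (P : T -> pred T) s t :
  (count (fun v => has (fun a => P a v) t) s <= \sum_(a <- t) count (P a) s)%N.
Proof.
elim: t => [|a t IH] /=; first by rewrite big_nil count_pred0.
rewrite big_cons; apply: leq_trans (leq_add (leqnn _) IH).
by rewrite -count_predUI leq_addr.
Qed.

Lemma count_le1 (a : pred T) s : uniq s -> {in s &, forall x y, a x -> a y -> x = y} ->
  (count a s <= 1)%N.
Proof.
move=> us h; rewrite -size_filter.
have := filter_uniq a us.
have : {in seq.filter a s &, forall x y, x = y}.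
  by move=> x y; rewrite !mem_filter => /andP[ax xs] /andP[ay ys]; exact: h.
case: (seq.filter a s) => [|x [|y f]]//= hh; rewrite inE negb_or.
by rewrite (hh x y) ?inE ?eqxx ?orbT.
Qed.

End seq_extra.

(** * Degrees in finite configurations, and the effect of adding a point *)

Section finite_configurations.
Context {R : realType} {d : nat} (k : nat).
Local Notation pt := (d.-tuple R).
Implicit Types (t : seq pt) (x y z : pt).

Definition closer t x y :=
  count (fun z => (z != x) && (edist x z < edist x y)) t.

Arguments closer : simpl never.

Definition knnb t x y := (y != x) && (closer t x y < k)%N.

Definition edgeb t x y := knnb t x y || knnb t y x.

Definition deg t x := count (edgeb t x) t.

(** Turns the lists of exactly [k] closer points in [is_knn] into a cardinality inequality. *)
Lemma exists_uniq_subseq (T : eqType) (B : set T) (t : seq T) m : uniq t ->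
  (forall z : T, z \in t <-> B z) ->
  (exists s : seq T, [/\ uniq s, size s = m & forall z : T, z \in s -> B z]) <-> (m <= size t)%N.
Proof.
move=> ut tB; split.
  by move=> [s [us <- sB]]; apply: uniq_leq_size => // z /sB /tB.
move=> mt; exists (take m t); split; first exact: take_uniq.
  by rewrite size_takel.
by move=> z /mem_take/tB.
Qed.

Lemma is_knnE t x y : uniq t -> x \in t -> y \in t ->
  is_knn k [set z | z \in t] x y <-> knnb t x y.
Proof.
move=> ut xt yt; rewrite /knnb /closer -size_filter ltnNge.
set f := seq.filter _ t.
have uf : uniq f by exact: filter_uniq.
have fB z : z \in f <-> [/\ z \in t, z <> x & edist x z < edist x y].
  rewrite mem_filter; split=> [/andP[/andP[/eqP ? ?] ?]//|[-> /eqP -> ->]//].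
have E := exists_uniq_subseq k uf fB.
split=> [[_ _ /eqP -> /= nE]|/andP[/eqP yx nE]].
  by apply/negP => /E.
by split => // /E; rewrite (negbTE nE).
Qed.

Lemma knn_edgeE t x y : uniq t -> x \in t -> y \in t ->
  knn_edge k [set z | z \in t] x y <-> edgeb t x y.
Proof.
move=> ut xt yt; split=> [[|]/is_knnE h|/orP[|]/is_knnE h].
- by apply/orP; left; exact: h.
- by apply/orP; right; exact: h.
- by left; exact: h.
- by right; exact: h.
Qed.

Lemma knn_deg_isE t x l : uniq t -> x \in t ->
  knn_deg_is k [set z | z \in t] x l <-> deg t x = l.
Proof.
move=> ut xt; rewrite /deg -size_filter.
have fE y : y \in seq.filter (edgeb t x) t <-> knn_edge k [set z | z \in t] x y.
  rewrite mem_filter; split=> [/andP[e yt]|e]; first by apply/knn_edgeE.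
  have yt : y \in t by case: e => -[].
  by rewrite yt andbT; apply/knn_edgeE.
split=> [[s [us <- sE]]|<-]; last first.
  by exists (seq.filter (edgeb t x) t); split => //; exact: filter_uniq.
apply/perm_size/uniq_perm => //; first exact: filter_uniq.
by move=> y; apply/idP/idP => [/fE/sE|/sE/fE].
Qed.

Lemma perm_deg t t' x : perm_eq t t' -> deg t x = deg t' x.
Proof.
move=> p; rewrite /deg (permP p); apply: eq_count => y.
by rewrite /edgeb /knnb /closer !(permP p).
Qed.

Arguments deg : simpl never.

Definition Vdeg l t := count (fun x => deg t x == l) t.

Lemma perm_Vdeg l t t' : perm_eq t t' -> Vdeg l t = Vdeg l t'.
Proof.
by move=> p; rewrite /Vdeg (permP p); apply: eq_count => y; rewrite (perm_deg _ p).
Qed.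

Lemma V_countE l t : V_count k l t = Vdeg l (undup t).
Proof.
apply: eq_in_count => x xt.
have -> : [set y | y \in t] = [set y | y \in undup t].
  by apply/seteqP; split => y /=; rewrite mem_undup.
apply/asboolP/eqP => /knn_deg_isE; apply => //; exact: undup_uniq.
Qed.

(** General position: no repetition and no isosceles triple, so that ranks seen from a point are
    pairwise distinct. *)
Definition gp t := uniq t /\
  forall a b c, a \in t -> b \in t -> c \in t -> edist a b = edist a c -> b = c.

Lemma gp_cons x t : gp (x :: t) -> gp t.
Proof.
move=> [/= /andP[_ ut] h]; split=> // a b c at_ bt ct; apply: h;
by rewrite in_cons ?at_ ?bt ?ct orbT.
Qed.

Lemma perm_gp t t' : perm_eq t t' -> gp t -> gp t'.
Proof.
move=> p [ut h]; split; first by rewrite -(perm_uniq p).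
by move=> a b c; rewrite -!(perm_mem p); exact: h.
Qed.

Definition ncones := #|{ffun 'I_d -> 'I_(2 * d.+1).+1}|.

(* Within a cone at [x], the farthest point sees the others before [x]. *)
Lemma indeg_le t x : uniq t -> (count (knnb t ^~ x) t <= k * ncones)%N.
Proof.
move=> ut; rewrite (count_fiber (cone_code x)).
rewrite [(k * _)%N]mulnC /ncones -sum_nat_const; apply: leq_sum => a _.
rewrite -size_filter leqNgt; apply/negP => big.
set f := seq.filter _ _ in big.
have [y yf ymax] := seq_argmax (fun y => edist y x) (leq_ltn_trans (leq0n _) big).
move: (yf); rewrite mem_filter => /andP[/andP[/andP[xy yk] /eqP ya] yt].
move: yk; apply/negP; rewrite -leqNgt.
have uf : uniq f by exact: filter_uniq.
have := size_rem yf; move: big; case: (size f) => // sz big /= szr.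
apply: (@leq_trans (size (rem y f))); first by rewrite szr.
rewrite /closer -size_filter; apply: uniq_leq_size; first exact: rem_uniq.
move=> z; rewrite mem_rem_uniq// inE/= => /andP[zy zf]; have := ymax _ zf.
move: zf; rewrite !mem_filter => /andP[/andP[/andP[xz _] /eqP za] zt] zmax.
rewrite zt zy/= andbT; apply: same_cone_closer zmax; last by rewrite ya za.
- by apply/eqP; rewrite eq_sym.
- by apply/eqP; rewrite eq_sym.
Qed.

Lemma outdegE t x : gp t -> x \in t ->
  count (knnb t x) t = minn k (size t).-1.
Proof.
move=> [ut h] xt.
have p := perm_to_rem xt.
have nx : x \notin rem x t by rewrite mem_rem_uniq// inE eqxx.
have sr : size (rem x t) = (size t).-1 by rewrite size_rem.
rewrite -sr -(@rank_count _ _ (edist x)) ?rem_uniq//; last first.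
  by move=> a b /mem_rem ? /mem_rem ?; exact: h.
rewrite (permP p)/= {1}/knnb eqxx/= add0n; apply: eq_in_count => y yr.
have -> : knnb t x y = (closer t x y < k)%N.
  by rewrite /knnb; have [yx|//] := eqVneq y x; rewrite yx (negbTE nx) in yr.
rewrite /closer (permP p)/= eqxx/= add0n; congr (_ < k)%N; apply: eq_in_count => z zr.
by have [zx|//] := eqVneq z x; rewrite zx (negbTE nx) in zr.
Qed.

(** The neighbours of [x] are its exactly [k] out-neighbours together with its in-neighbours, of
    which the cones allow at most [k * ncones]. *)
Lemma deg_bounds t x : gp t -> x \in t -> (k < size t)%N ->
  (k <= deg t x <= k + k * ncones)%N.
Proof.
move=> gt xt kt; have kk : minn k (size t).-1 = k by lia.
rewrite /deg; apply/andP; split.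
  rewrite -[X in (X <= _)%N]kk -(outdegE gt xt); apply: sub_count => y.
  by rewrite /edgeb => ->.
rewrite -[X in (_ <= X + _)%N]kk -(outdegE gt xt).
apply: leq_trans (leq_add (leqnn _) (indeg_le x gt.1)).
by rewrite -count_predUI leq_addr.
Qed.

(** Vertices whose degree an inserted point [x] can affect: at most [k * ncones] that have [x] as a
    neighbour, at most [k] neighbours of [x], one point displaced by [x] for each of the former, and
    [x] itself. *)
Definition bdiff := (2 * (k * ncones) + k).+1.

(** Outside [B] no edge at [v] changes: between old points [x] can only destroy an edge, by
    displacing the [k]-th neighbour of a point that gains [x] as neighbour, and both ends of such an
    edge lie in [B]. *)
Lemma Vdeg_cons l x t : gp (x :: t) ->
  (Vdeg l (x :: t) <= Vdeg l t + bdiff /\ Vdeg l t <= Vdeg l (x :: t) + bdiff)%N.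
Proof.
move=> gxt; have gt := gp_cons gxt; have [/= /andP[xt ut] inj] := gxt.
have uxt : uniq (x :: t) by rewrite /= xt.
pose I := seq.filter (knnb (x :: t) ^~ x) t.
pose B v := [|| knnb (x :: t) v x, knnb (x :: t) x v |
  has (fun a => (v != a) && (closer t a v == k.-1)) I].
have clE a y : closer (x :: t) a y = (((x != a) && (edist a x < edist a y)%R) + closer t a y)%N by [].
have sI : (size I <= k * ncones)%N.
  rewrite size_filter; apply: leq_trans (indeg_le x uxt).
  by rewrite /= leq_addl.
have cB : (count B t <= 2 * (k * ncones) + k)%N.
  have -> : (2 * (k * ncones) + k = k * ncones + (k + k * ncones))%N by lia.
  rewrite /B.
  apply: (@leq_trans (count (knnb (x :: t) ^~ x) t + (count (knnb (x :: t) x) t +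
     count (fun v => has (fun a => (v != a) && (closer t a v == k.-1)) I) t))%N).
    exact: leq_trans (count_orb_le _ _ _) (leq_add (leqnn _) (count_orb_le _ _ _)).
  apply: leq_add; first by rewrite -size_filter.
  apply: leq_add.
    apply: (@leq_trans (count (knnb (x :: t) x) (x :: t))); first by rewrite /= leq_addl.
    by rewrite outdegE ?mem_head// geq_minl.
  apply: leq_trans (count_has_le _ _ _) _; apply: leq_trans sI.
  rewrite -sum1_size big_seq [X in (_ <= X)%N]big_seq; apply: leq_sum => a.
  rewrite mem_filter => /andP[_ at_]; apply: count_le1 => //.
  have lt v w : v \in t -> v != a -> edist a v < edist a w -> (closer t a v < closer t a w)%N.
    move=> vt va vw; rewrite -addn1 -[X in (_ + X)%N]/(nat_of_bool true) -vt -(count_uniq_mem v ut) -count_predUI.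
    rewrite (@eq_count _ (predI _ _) pred0) ?count_pred0 ?addn0; last first.
      by move=> z /=; have [->|_] := eqVneq z v; rewrite ?ltxx ?andbF.
    apply: sub_count => z /= /orP[/andP[-> /lt_trans]|/eqP ->]; first exact.
    by rewrite va.
  move=> v w vt wt /andP[va /eqP vk] /andP[wa /eqP wk].
  have [vw|wv|e] := ltgtP (edist a v) (edist a w).
  - by have := lt _ _ vt va vw; rewrite vk wk ltnn.
  - by have := lt _ _ wt wa wv; rewrite vk wk ltnn.
  - by apply: gt.2 e.
have same v : v \in t -> ~~ B v -> deg (x :: t) v = deg t v.
  move=> vt; rewrite /B !negb_or => /and3P[vx xv nh].
  rewrite /deg/= {1}/edgeb (negbTE vx) (negbTE xv)/= add0n.
  apply: eq_in_count => y yt; rewrite /edgeb; congr orb; rewrite /knnb.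
    congr andb; rewrite clE.
    case: (boolP ((x != v) && _)) => //= /andP[xv' vxy].
    (* [x] is nearer to [v] than [y] but not a neighbour of [v], so [y] has rank at least [k]
       already without [x]. *)
    apply/idP/idP => [/ltnW//|yk]; exfalso.
    move: vx; rewrite /knnb xv'/= -leqNgt clE ltxx andbF add0n => kx.
    have : (closer t v x <= closer t v y)%N.
      by apply: sub_count => z /andP[-> /lt_trans]/=; exact.
    by rewrite leqNgt (leq_trans yk kx).
  case: (eqVneq v y) => // vy; congr andb; rewrite clE.
  case: (boolP ((x != y) && _)) => //= /andP[xy yxv].
  apply/idP/idP => [/ltnW//|vk]; rewrite add1n ltn_neqAle vk andbT.
  apply/eqP => vk1; move/hasPn: nh => /(_ y); rewrite vy -vk1 eqxx/= => nh.
  suff : y \in I by move/nh.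
  rewrite mem_filter yt andbT /knnb xy/= clE ltxx andbF add0n.
  apply: leq_ltn_trans vk; apply: sub_count => z /andP[-> /lt_trans]/=; exact.
rewrite /Vdeg /bdiff/=.
have h (p q : pred _) : {in t, forall v, ~~ B v -> p v = q v} ->
    (count p t <= count q t + count B t)%N.
  move=> pq; rewrite -count_predUI; apply: leq_trans (leq_addr _ _).
  apply: count_le_imp => v vt /= pv; case: (boolP (B v)); rewrite ?orbT// => nB.
  by rewrite -pq// pv.
have h1 := h (fun v => deg (x :: t) v == l) (fun v => deg t v == l).
have h2 := h (fun v => deg t v == l) (fun v => deg (x :: t) v == l).
have {}h1 : (count (fun v => deg (x :: t) v == l) t <= count (fun v => deg t v == l) t + count B t)%N.
  by apply: h1 => v vt nB; rewrite same.
have {}h2 : (count (fun v => deg t v == l) t <= count (fun v => deg (x :: t) v == l) t + count B t)%N.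
  by apply: h2 => v vt nB; rewrite same.
by split; move: h1 h2 cB; case: (_ == l) => /=; lia.
Qed.

End finite_configurations.

(** * The grid around a point, and the degree read off its occupied cells *)

Section grid.
Context {R : realType} {d : nat} (k : nat).
Local Notation pt := (d.-tuple R).
Implicit Types (x y z o : pt).

(** [beta] is the radius, in coarse blocks, beyond which the centre has no edge: room for [k] marks
    [2 * d + 1] blocks apart, each with a margin of [d] blocks. [kap] is the half-width of the grid;
    it exceeds [2 * beta] because ranks seen from a point at distance up to [beta] involve points up
    to twice as far. *)
Definition beta := ((2 * d).+1 * k.+1)%N.
Definition kap := (2 * beta).+1.
Definition cells (M : nat) := {ffun 'I_d -> 'I_(2 * kap * M)}.

Section fixed_mesh.
Variable M : nat.
Local Notation C := (cells M).
Implicit Types (c : C) (A : {set C}).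

Definition corner c (i : 'I_d) : R := (c i)%:R - (kap * M)%:R.

Definition cell o (h : R) c : set pt :=
  [set z | forall i, tnth o i + h * corner c i <= tnth z i < tnth o i + h * (corner c i + 1)].

Definition far_cell c := (4 * d)%:R < nrm (corner c).

(** Replacing points by the corners of their cells costs at most [3 * d] mesh units in either
    comparison of distances; a gap above [4 * d] decides both. *)
Definition unamb c c' :=
  ((4 * d)%:R < `|nrm (corner c) - nrm (corner c')|) &&
  ((4 * d)%:R < `|nrm (fun i => corner c' i - corner c i) - nrm (corner c)|).

Definition block (b : {ffun 'I_d -> 'I_(2 * kap)}) : {set C} :=
  [set c : C | [forall i, (c i %/ M)%N == b i]]%SET.

Definition good A := [&& [forall b, A :&: block b != finset.set0],
  [forall c in A, far_cell c] &
  [forall c in A, forall c' in A, (c != c') ==> unamb c c']].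

(** [outA] is the rank of the cell [c] seen from the centre, [inA] the rank of the centre seen from
    [c], both computed on corners. *)
Definition outA A c := #|[set c' in A | nrm (corner c') < nrm (corner c)]%SET|.

Definition inA A c := #|[set c' in A | (c' != c) &&
  (nrm (fun i => corner c' i - corner c i) < nrm (corner c))]%SET|.

Definition degA A := #|[set c in A | (outA A c < k)%N || (inA A c < k)%N]%SET|.

(** Nothing is said about points of [S] outside the grid. *)
Definition occ o h (S : set pt) A := forall c, if c \in A
  then exists z, [/\ cell o h c z, S z & forall z', cell o h c z' -> S z' -> z' = z]
  else forall z, cell o h c z -> ~ S z.

Lemma cell_inj o (h : R) c c' z : 0 < h -> cell o h c z -> cell o h c' z -> c = c'.
Proof.
move=> h0 cz c'z; apply/ffunP => i; apply/val_inj/eqP.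
have := cz i; have := c'z i; rewrite /corner.
set a := (c i : nat); set b := (c' i : nat) => /andP[b1 b2] /andP[a1 a2].
have ab : b%:R < a%:R + 1 :> R.
  have : h * (b%:R - (kap * M)%:R) < h * (a%:R - (kap * M)%:R + 1) by lra.
  rewrite ltr_pM2l//; lra.
have ba : a%:R < b%:R + 1 :> R.
  have : h * (a%:R - (kap * M)%:R) < h * (b%:R - (kap * M)%:R + 1) by lra.
  rewrite ltr_pM2l//; lra.
by move: ab ba; rewrite !natr1 !ltr_nat !ltnS => ab ba; rewrite eqn_leq ab ba.
Qed.

Lemma cell_nrm o (h : R) c z : 0 < h -> cell o h c z ->
  nrm (fun i => tnth z i - tnth o i - h * corner c i) <= d%:R * h.
Proof.
move=> h0 cz; apply: nrm_le => i; rewrite ler_norml.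
by have /andP[z1 z2] := cz i; rewrite mulrDr mulr1 in z2; apply/andP; split; lra.
Qed.

Lemma cell_cover o (h : R) z : 0 < h ->
  (forall i, `|tnth z i - tnth o i| < h * (kap * M)%:R) -> exists c, cell o h c z.
Proof.
move=> h0 hz.
pose w i := (tnth z i - tnth o i) / h + (kap * M)%:R.
have w0 i : 0 <= w i /\ w i < (2 * kap * M)%:R.
  have := hz i; rewrite ltr_norml => /andP[z1 z2].
  have e : w i * h = tnth z i - tnth o i + (kap * M)%:R * h.
    by rewrite /w mulrDl divfK// gt_eqF.
  split; first by rewrite -(pmulr_lge0 _ h0) e; lra.
  rewrite -(ltr_pM2r h0) e -mulnA natrM; lra.
have wN i : (Num.truncn (w i) < 2 * kap * M)%N.
  have [p q] := w0 i; rewrite -(ltr_nat R); apply: le_lt_trans q.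
  by rewrite truncn_le.
exists [ffun i => Ordinal (wN i)] => i; rewrite /corner ffunE/=.
have [p q] := w0 i.
have /andP[t1 t2] := truncn_itv p.
move: t1 t2; rewrite -natr1; set n := (Num.truncn _)%:R => t1 t2.
have e : w i * h = tnth z i - tnth o i + (kap * M)%:R * h.
  by rewrite /w mulrDl divfK// gt_eqF.
have {}t1 : n * h <= w i * h by rewrite ler_pM2r.
have {}t2 : w i * h < (n + 1) * h by rewrite ltr_pM2r.
by apply/andP; split; lra.
Qed.

Section geometry.
Variables (o : pt) (h : R) (A : {set C}) (x : C -> pt).
Hypotheses (h0 : 0 < h) (M0 : (0 < M)%N) (gA : good A)
  (xcell : forall c, c \in A -> cell o h c (x c)).
Let s : R := h * M%:R.
Let rho : R := beta%:R * s.

Let s0 : 0 < s. Proof. by rewrite mulr_gt0// ltr0n. Qed.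

Lemma edist_o_cell c : c \in A -> `|edist o (x c) - h * nrm (corner c)| <= d%:R * h.
Proof.
move=> cA; have cn := cell_nrm h0 (xcell cA).
have hn : h * nrm (corner c) = nrm (fun i => h * corner c i) by rewrite nrmZ gtr0_norm.
by rewrite edistC edistE hn; exact: le_trans (nrm_dist _ _) cn.
Qed.

Lemma edist_cell_cell c c' : c \in A -> c' \in A ->
  `|edist (x c) (x c') - h * nrm (fun i => corner c' i - corner c i)| <= 2 * (d%:R * h).
Proof.
move=> cA c'A; have cn := cell_nrm h0 (xcell cA); have c'n := cell_nrm h0 (xcell c'A).
have -> : h * nrm (fun i => corner c' i - corner c i) =
    nrm (fun i => h * (corner c' i - corner c i)) by rewrite nrmZ gtr0_norm.
rewrite edistC edistE; apply: le_trans (nrm_dist _ _) _.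
pose a i := tnth (x c') i - tnth o i - h * corner c' i.
pose b i := tnth (x c) i - tnth o i - h * corner c i.
rewrite (@eq_nrm _ _ _ (fun i => a i + -1 * b i)); last by move=> i; rewrite /a /b; ring.
apply: le_trans (nrmD _ _) _; rewrite nrmZ normrN1 mul1r mulr_natl mulr2n.
exact: lerD.
Qed.

Let gA2 c : c \in A -> far_cell c.
Proof. by move: gA => /and3P[_ /forall_inP + _]; exact. Qed.

Let gA3 c c' : c \in A -> c' \in A -> c != c' -> unamb c c'.
Proof. by move: gA => /and3P[_ _ /forall_inP g3] cA c'A; have /forall_inP/(_ _ c'A)/implyP := g3 _ cA. Qed.

Lemma cell_neq_center c : c \in A -> x c <> o.
Proof.
move=> cA e; have := edist_o_cell cA; rewrite e edistxx sub0r normrN ger0_norm; last first.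
  by rewrite mulr_ge0 ?nrm_ge0 ?(ltW h0).
have := gA2 cA; rewrite /far_cell natrM => f.
have : h * (4 * d%:R) < h * nrm (corner c) by rewrite ltr_pM2l.
have : 0 <= d%:R * h by rewrite mulr_ge0// ltW.
by clear e; move=> *; lra.
Qed.

Lemma lt_out c c' : c \in A -> c' \in A ->
  (edist o (x c') < edist o (x c)) = (nrm (corner c') < nrm (corner c)).
Proof.
move=> cA c'A; have [->|cc'] := eqVneq c c'; first by rewrite !ltxx.
have /andP[+ _] := gA3 cA c'A cc'; rewrite natrM => g.
have := edist_o_cell cA; have := edist_o_cell c'A; rewrite !ler_norml.
have dh : 0 <= d%:R * h by rewrite mulr_ge0// ltW.
move=> /andP[a1 a2] /andP[b1 b2].
have hg : h * (4 * d%:R) < h * `|nrm (corner c) - nrm (corner c')| by rewrite ltr_pM2l.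
move: hg; have [lt|ge] := ltrP (nrm (corner c')) (nrm (corner c)) => hg.
  by apply/idP; lra.
by apply/negbTE; rewrite -leNgt; lra.
Qed.

Lemma lt_in c c' : c \in A -> c' \in A -> c' != c ->
  (edist (x c) (x c') < edist (x c) o) =
  (nrm (fun i => corner c' i - corner c i) < nrm (corner c)).
Proof.
move=> cA c'A; rewrite eq_sym => cc'.
have /andP[_] := gA3 cA c'A cc'; rewrite natrM => g.
have := edist_o_cell cA; have := edist_cell_cell cA c'A; rewrite !ler_norml (edistC (x c) o).
have dh : 0 <= d%:R * h by rewrite mulr_ge0// ltW.
move=> /andP[a1 a2] /andP[b1 b2].
set e := nrm (fun i => _) in g a1 a2 *.
have hg : h * (4 * d%:R) < h * `|e - nrm (corner c)| by rewrite ltr_pM2l.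
move: hg; have [lt|ge] := ltrP e (nrm (corner c)) => hg.
  by apply/idP; lra.
by apply/negbTE; rewrite -leNgt; lra.
Qed.

(** The coarse block containing the mark [m * s * u] lies in the grid, since [m <= beta < kap], and
    a good set meets every block. *)
Lemma block_point (u : 'I_d -> R) (m : nat) : (m <= beta)%N -> (forall i, `|u i| <= 1) ->
  exists2 c, c \in A &
    nrm (fun i => tnth (x c) i - tnth o i - m%:R * s * u i) <= d%:R * s.
Proof.
move=> mb u1.
pose w i := m%:R * u i + kap%:R.
have w0 i : 0 <= w i /\ w i < (2 * kap)%:R.
  have : `|m%:R * u i| <= beta%:R.
    by rewrite normrM ger0_norm// -[leRHS]mulr1 ler_pM// ler_nat.
  rewrite ler_norml => /andP[a b].
  have bk : beta%:R < kap%:R :> R by rewrite ltr_nat /kap; lia.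
  by rewrite /w natrM; split; lra.
have wN i : (Num.truncn (w i) < 2 * kap)%N.
  have [p q] := w0 i; rewrite -(ltr_nat R); apply: le_lt_trans q.
  by rewrite truncn_le.
move: gA => /and3P[/forallP/(_ [ffun i => Ordinal (wN i)])/set0Pn[c] + _ _].
rewrite !inE => /andP[cA /forallP cb]; exists c => //.
apply: nrm_le => i; have /eqP := cb i; rewrite ffunE/= => cbi.
have [p q] := w0 i; have /andP[t1 t2] := truncn_itv p.
have /andP[x1 x2] := xcell cA i.
have ci : (c i : nat) = (Num.truncn (w i) * M + c i %% M)%N by rewrite -cbi -divn_eq.
have cm : (c i %% M < M)%N by rewrite ltn_mod.
move: x1 x2 t1 t2; rewrite /corner ci -cbi; set b := (c i %/ M)%N; set a := (c i %% M)%N.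
rewrite -natr1 natrD !natrM => x1 x2 t1 t2.
have a0 : 0 <= a%:R * h by rewrite mulr_ge0// ltW.
have a1 : (a%:R + 1) * h <= M%:R * h.
  by rewrite ler_pM2r// natr1 ler_nat.
have {}t1 : b%:R * s <= w i * s by rewrite ler_pM2r.
have {}t2 : w i * s < (b%:R + 1) * s by rewrite ltr_pM2r.
rewrite /w /s in t1 t2 *; rewrite ler_norml; apply/andP; split; nra.
Qed.

(** Place marks on the ray from [o] to [y], the first at [d + 1] blocks and then every [2 * d + 1],
    and take an occupied cell within [d] blocks of each. The spacing makes the points distinct, the
    first offset brings them closer to [y] than [o] is, and [beta] bounds the last mark. This
    excludes edges between [o] and far points. *)
Lemma far_points y : rho < edist o y -> exists cs : seq C, [/\ uniq cs, size cs = k &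
  forall c, c \in cs -> [/\ c \in A, edist o (x c) < edist o y & edist y (x c) < edist y o]].
Proof.
move=> far; set t := edist o y in far *.
have rho0 : 0 <= rho by rewrite mulr_ge0// ltW.
have t0 : 0 < t by exact: le_lt_trans far.
pose u i := (tnth y i - tnth o i) / t.
have nu : nrm u = 1.
  rewrite /u (@eq_nrm _ _ _ (fun i => t^-1 * (tnth y i - tnth o i))).
    by rewrite nrmZ -edistE edistC -/t ger0_norm ?invr_ge0 ?(ltW t0)// mulVf// gt_eqF.
  by move=> i; rewrite mulrC.
have u1 i : `|u i| <= 1 by rewrite -nu coord_le_nrm.
pose m j := (d.+1 + (2 * d).+1 * j)%N.
have mb j : (j < k)%N -> (m j + d <= (2 * d).+1 * k)%N.
  move=> jk; apply: leq_trans (leq_mul (leqnn _) jk).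
  by rewrite /m addnAC mulnS leq_add2r mul2n -addnn addSn.
have ms i j : (i < j)%N -> (m i + (2 * d).+1 <= m j)%N.
  by move=> ij; rewrite /m -addnA leq_add2l addnC -mulnS leq_mul2l.
have mk j : (j < k)%N -> (m j <= beta)%N.
  move=> /mb h1; apply: leq_trans (leq_trans h1 _); first exact: leq_addr.
  by rewrite leq_mul2l leqnSn orbT.
have /choice[f fP] : forall j : 'I_k, exists c, c \in A /\
    nrm (fun i => tnth (x c) i - tnth o i - (m j)%:R * s * u i) <= d%:R * s.
  by move=> j; have [c cA cn] := @block_point u (m j) (mk _ (ltn_ord j)) u1; exists c.
exists [seq f j | j <- enum 'I_k]; split.
- rewrite map_inj_uniq ?enum_uniq// => i j fij.
  have [_ ni] := fP i; have [_ nj] := fP j; rewrite -fij in nj.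
  apply/eqP/negPn/negP => ij.
  have : nrm (fun a => ((m i)%:R - (m j)%:R) * s * u a) <= 2 * (d%:R * s).
    rewrite (@eq_nrm _ _ _ (fun a => (tnth (x (f i)) a - tnth o a - (m j)%:R * s * u a)
      + -1 * (tnth (x (f i)) a - tnth o a - (m i)%:R * s * u a))); last by move=> a; ring.
    apply: le_trans (nrmD _ _) _; rewrite nrmZ normrN1 mul1r.
    lra.
  rewrite nrmZ nu mulr1 normrM (gtr0_norm s0) mulrA ler_pM2r// => le.
  have : ((2 * d).+1)%:R <= `|(m i)%:R - (m j)%:R| :> R.
    have : (i != j :> nat)%N by [].
    rewrite neq_ltn => /orP[]/ms lt.
      rewrite distrC; apply: le_trans (ler_norm _).
      by rewrite lerBrDr -natrD ler_nat addnC.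
    by apply: le_trans (ler_norm _); rewrite lerBrDr -natrD ler_nat addnC.
  by move=> /le_trans/(_ le); rewrite -natrM ler_nat ltnn.
- by rewrite size_map size_enum_ord.
- move=> c /mapP[j _ ->]; have [cA cn] := fP j.
  set mj := (m j)%:R in cn *.
  have d0 : 0 <= d%:R * s by rewrite mulr_ge0// ltW.
  have mds : mj * s + d%:R * s < rho.
    rewrite -mulrDl /rho ltr_pM2r// -natrD ltr_nat /beta.
    by apply: leq_ltn_trans (mb _ (ltn_ord j)) _; rewrite ltn_mul2l ltnSn.
  have md : d%:R * s < mj * s by rewrite ltr_pM2r// ltr_nat /m addSn ltnS leq_addr.
  have ms0 : 0 <= mj * s by lra.
  split=> //.
    apply: le_lt_trans far; apply: ltW; apply: le_lt_trans mds.
    rewrite edistC edistE (@eq_nrm _ _ _ (fun i => mj * s * u i + (tnth (x (f j)) i - tnth o i - mj * s * u i))).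
      by apply: le_trans (nrmD _ _) _; rewrite nrmZ nu mulr1 ger0_norm// lerD2l.
    by move=> i; ring.
  rewrite (edistC y o) -/t edistE (@eq_nrm _ _ _ (fun i => (t - mj * s) * u i +
      -1 * (tnth (x (f j)) i - tnth o i - mj * s * u i))).
    apply: le_lt_trans (nrmD _ _) _; rewrite !nrmZ nu mulr1 normrN1 mul1r ger0_norm; lra.
  by move=> i; rewrite mulrBl [t * _]mulrC /u divfK ?gt_eqF//; ring.
Qed.

End geometry.

(** Up to distance [rho] every relevant comparison involves points within [2 * rho], all seen by the
    grid and ordered as their corners; beyond [rho], [far_points] shows that neither end is a
    neighbour of the other. *)
Lemma occ_deg o (h : R) A (S : set pt) : 0 < h -> (0 < M)%N -> good A -> occ o h S A ->
  knn_deg_is k (S `|` [set o]) o (degA A).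
Proof.
move=> h0 M0 gA oA.
have /choice[x xP] : forall c, exists z, c \in A ->
    [/\ cell o h c z, S z & forall z', cell o h c z' -> S z' -> z' = z].
  move=> c; have := oA c; case: ifP => [_ [z zP]|]; first by exists z.
  by exists o.
have xc c : c \in A -> cell o h c (x c) by move=> /xP[].
have xS c : c \in A -> S (x c) by move=> /xP[].
have xinj : {in A &, injective x}.
  by move=> c c' cA c'A e; apply: (cell_inj h0 (xc _ cA)); rewrite e; exact: xc.
have xo c : c \in A -> x c <> o by exact: (cell_neq_center h0 gA xc).
pose rho : R := beta%:R * (h * M%:R).
have far := far_points h0 M0 gA xc.
(* [kap] exceeds [2 * beta], so the grid contains the ball of radius [2 * rho]. *)
have near z : S z -> edist o z <= 2 * rho -> exists2 c, c \in A & z = x c.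
  move=> Sz zr; have [|c cz] := @cell_cover o h z h0.
    move=> i; rewrite natrM; apply: (@le_lt_trans _ _ (edist o z)).
      rewrite edistC; exact: (coord_le_nrm (fun i => tnth z i - tnth o i)).
    apply: le_lt_trans zr _; rewrite /rho.
    have hM : 0 < h * M%:R by rewrite mulr_gt0// ltr0n.
    have -> : h * (kap%:R * M%:R) = kap%:R * (h * M%:R) by ring.
    by rewrite mulrA ltr_pM2r// -natrM ltr_nat /kap.
  have := oA c; case: ifP => [cA _|_ /(_ _ cz)//].
  by exists c => //; have [_ _] := xP _ cA; exact.
pose imx (B : {set C}) := [seq x c | c <- enum B].
have imx_uniq (B : {set C}) : B \subset A -> uniq (imx B).
  move=> /fintype.subsetP BA; rewrite map_inj_in_uniq ?enum_uniq// => c c'.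
  by rewrite !mem_enum => /BA cA /BA c'A; exact: xinj.
have lists (B : {set C}) (E : set pt) : B \subset A ->
    (forall z, E z -> exists2 c, c \in B & z = x c) -> (forall c, c \in B -> E (x c)) ->
    (~ exists s : seq pt, [/\ uniq s, size s = k & forall z, z \in s -> E z]) <-> (#|B| < k)%N.
  move=> BA EB BE.
  have imxE z : z \in imx B <-> E z.
    split=> [/mapP[c]|/EB[c cB ->]]; last by rewrite map_f// mem_enum.
    by rewrite mem_enum => cB ->; exact: BE.
  have [h1 h2] := exists_uniq_subseq k (imx_uniq _ BA) imxE.
  rewrite size_map -cardE in h1 h2.
  split=> [nE|lt /h1]; last by rewrite leqNgt lt.
  by rewrite ltnNge; apply/negP => /h2.
have out c : c \in A -> is_knn k (S `|` [set o]) o (x c) <-> (outA A c < k)%N.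
  move=> cA; have [nearc|farc] := lerP (edist o (x c)) rho.
    rewrite -(lists _ [set z | [/\ (S `|` [set o]) z, z <> o & edist o z < edist o (x c)]]).
    - by split=> [[]//|nE]; split => //; [right|left; exact: xS|exact: xo].
    - by apply/fintype.subsetP => c'; rewrite inE => /andP[].
    - move=> z [[Sz|//] zo lt]; have [|c' c'A zE] := near z Sz.
        apply: le_trans (ltW lt) (le_trans nearc _).
        rewrite ler_peMl ?ler1n// /rho !mulr_ge0// ltW//.
      by exists c' => //; rewrite inE c'A/= -(lt_out h0 gA xc cA c'A) -zE.
    - move=> c'; rewrite inE => /andP[c'A lt]; split; [left; exact: xS|exact: xo|].
      by rewrite (lt_out h0 gA xc cA c'A).
  (* For a far cell both sides fail, with the same [k] cells as witnesses. *)
  have [cs [ucs scs csP]] := far _ farc; split.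
    move=> [_ _ _ []]; exists [seq x c' | c' <- cs]; split.
    - by rewrite map_inj_in_uniq// => a b /csP[aA _ _] /csP[bA _ _]; exact: xinj.
    - by rewrite size_map.
    - move=> z /mapP[c' /csP[c'A lt _] ->]; split => //; [by left; exact: xS|exact: xo].
  rewrite ltnNge => /negP[]; rewrite -scs /outA cardE; apply: uniq_leq_size => // c' /csP[c'A lt _].
  by rewrite mem_enum inE c'A -(lt_out h0 gA xc cA c'A).
have inn c : c \in A -> is_knn k (S `|` [set o]) (x c) o <-> (inA A c < k)%N.
  move=> cA; have [nearc|farc] := lerP (edist o (x c)) rho.
    rewrite -(lists _ [set z | [/\ (S `|` [set o]) z, z <> x c & edist (x c) z < edist (x c) o]]).
    - by split=> [[]//|nE]; split => //; [left; exact: xS|right|move=> /esym; exact: xo].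
    - by apply/fintype.subsetP => c'; rewrite inE => /andP[].
    - move=> z [[Sz|->] zo lt]; last by rewrite ltxx in lt.
      have [|c' c'A zE] := near z Sz.
        apply: le_trans (edist_tri (x c) _ _) _; move: lt; rewrite (edistC (x c) o) => lt; lra.
      have c'c : c' != c by apply/eqP => e; apply: zo; rewrite zE e.
      by exists c' => //; rewrite inE c'A c'c/= -(lt_in h0 gA xc cA c'A)// -zE.
    - move=> c'; rewrite inE => /and3P[c'A c'c lt]; split; [by left; exact: xS| |].
        by move=> /(xinj _ _ c'A cA)/eqP; rewrite (negbTE c'c).
      by rewrite (lt_in h0 gA xc cA c'A c'c).
  have [cs [ucs scs csP]] := far _ farc.
  have csc c' : c' \in cs -> c' != c.
    by move=> /csP[_ lt _]; apply/eqP => e; rewrite e ltxx in lt.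
  split.
    move=> [_ _ _ []]; exists [seq x c' | c' <- cs]; split.
    - by rewrite map_inj_in_uniq// => a b /csP[aA _ _] /csP[bA _ _]; exact: xinj.
    - by rewrite size_map.
    - move=> z /mapP[c' c's ->]; have [c'A _ lt] := csP _ c's; split => //; [by left; exact: xS|].
      by move=> /(xinj _ _ c'A cA)/eqP; rewrite (negbTE (csc _ c's)).
  rewrite ltnNge => /negP[]; rewrite -scs /inA cardE; apply: uniq_leq_size => // c' c's.
  have [c'A _ lt] := csP _ c's.
  by rewrite mem_enum inE c'A (csc _ c's) -(lt_in h0 gA xc cA c'A (csc _ c's)).
exists (imx [set c in A | (outA A c < k)%N || (inA A c < k)%N]%SET); split.
- by apply: imx_uniq; apply/fintype.subsetP => c; rewrite inE => /andP[].
- by rewrite size_map -cardE.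
- move=> y; split.
    move=> /mapP[c]; rewrite mem_enum inE => /andP[cA /orP[/(out _ cA)|/(inn _ cA)]] hh ->.
      by left.
    by right.
  move=> e; have [Sy yo] : S y /\ y <> o.
    case: e => -[].
      by move=> _ [Sy|->].
    by move=> [Sy|e] _ yo; [split=> // /esym|rewrite e in yo].
  have [c cA yE] : exists2 c, c \in A & y = x c.
    have [yr|yr] := lerP (edist o y) rho.
      apply: near => //; apply: le_trans yr _.
      rewrite ler_peMl ?ler1n// /rho !mulr_ge0// ltW//.
    exfalso; have [cs [ucs scs csP]] := far _ yr.
    case: e => -[_ _ _ []]; exists [seq x c' | c' <- cs]; split.
    - by rewrite map_inj_in_uniq// => a b /csP[aA _ _] /csP[bA _ _]; exact: xinj.
    - by rewrite size_map.
    - move=> z /mapP[c' /csP[c'A lt _] ->]; split => //; [by left; exact: xS|exact: xo].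
    - by rewrite map_inj_in_uniq// => a b /csP[aA _ _] /csP[bA _ _]; exact: xinj.
    - by rewrite size_map.
    - move=> z /mapP[c' /csP[c'A lt lt'] ->]; split => //; [by left; exact: xS|].
      by move=> e; rewrite e ltxx in lt.
  rewrite yE map_f// mem_enum inE cA/=; rewrite yE in e.
  by case: e => [/(out _ cA) ->|/(inn _ cA) ->]; rewrite ?orbT.
Qed.

End fixed_mesh.

End grid.

(** * Counting cells line by line *)

Section counting.
Context {d N : nat}.

Lemma card_diam (P : {set 'I_N}) (D : nat) :
  {in P &, forall i j : 'I_N, (i <= j + D)%N} -> (#|P| <= D.+1)%N.
Proof.
move=> h; have [->|[i0 i0P]] := set_0Vmem P; first by rewrite cards0.
have [i iP imin] := @arg_minnP _ i0 [pred i in P] (@nat_of_ord N) i0P.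
rewrite -[leqRHS]card_ord -(@card_in_imset _ _ (fun j : 'I_N => inord (j - i) : 'I_D.+1)).
  exact: max_card.
move=> a b aP bP /(congr1 val) /=.
have bnd j : j \in P -> (j - i < D.+1)%N by move=> jP; have := h _ _ jP iP; lia.
rewrite !inordK ?bnd// => e; apply: val_inj => /=.
by have := imin _ aP; have := imin _ bP; lia.
Qed.

Let C := {ffun 'I_d -> 'I_N}.

Definition upd (i0 : 'I_d) (c : C) (a : 'I_N) : C := [ffun i => if i == i0 then a else c i].

(* Swapping [a] with the coordinate it replaces is an involution on pairs. *)
Lemma card_fiber (i0 : 'I_d) (P : {set C}) (m : nat) :
  (forall c, #|[set a | upd i0 c a \in P]%SET| <= m)%N -> (N * #|P| <= #|C| * m)%N.
Proof.
move=> hm.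
have -> : (N * #|P| = \sum_(c : C) \sum_(a < N) (upd i0 c a \in P))%N.
  rewrite pair_big/=.
  rewrite (reindex_inj (h := fun p : C * 'I_N => (upd i0 p.1 p.2, p.1 i0)))/=; last first.
    move=> [c a] [c' a'] /= [/ffunP e1 e2]; congr pair.
      apply/ffunP => i; have := e1 i; rewrite !ffunE.
      by have [->|] := eqVneq i i0.
    by have := e1 i0; rewrite !ffunE eqxx.
  under eq_bigr => p _.
    have -> : upd i0 (upd i0 p.1 p.2) (p.1 i0) = p.1.
      by apply/ffunP => i; rewrite !ffunE; have [->|] := eqVneq i i0.
    over.
  rewrite -(pair_big xpredT xpredT (fun c (_ : 'I_N) => nat_of_bool (c \in P)))/=.
  under eq_bigr do rewrite sum_nat_const card_ord mulnC.
  by rewrite -big_distrl/= mulnC -big_mkcond/= sum1_card.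
rewrite -sum_nat_const; apply: leq_sum => c _; apply: leq_trans (hm c).
by rewrite -sum1_card [leqRHS]big_mkcond/=; apply: leq_sum => a _; rewrite inE.
Qed.

End counting.

(** For two points on the same side of [th], [(a - b) ^ 2] is at most the difference of the squared
    distances to [th], hence at most [D ^ 2]; so each side has diameter at most [D]. *)
Lemma card_sqr_window {R : realType} (N D : nat) (th al del : R) (P : {set 'I_N}) :
  del <= D%:R ^+ 2 ->
  (forall i, i \in P -> al <= (i%:R - th) ^+ 2 <= al + del) -> (#|P| <= 2 * D.+1)%N.
Proof.
move=> dD hP.
rewrite -(cardsID [set i : 'I_N | th <= i%:R]%SET P) mul2n -addnn.
have diff (i j : 'I_N) : i \in P -> j \in P -> (j <= i)%N ->
    0 <= (i%:R - th) * (j%:R - th) -> (i <= j + D)%N.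
  move=> /hP/andP[i1 i2] /hP/andP[j1 j2] ji sg.
  rewrite -(ler_nat R) natrD; move: sg i1 i2 j1 j2; move: ji; rewrite -(ler_nat R).
  set a := (i%:R : R); set b := (j%:R : R) => ba sg i1 i2 j1 j2.
  have : (a - b) ^+ 2 <= D%:R ^+ 2.
    apply: le_trans dD.
    have [le|ge] := lerP th b.
      nra.
    have : a <= th by nra.
    nra.
  rewrite ler_sqr ?nnegrE ?subr_ge0//; lra.
by apply: leq_add; apply: card_diam => i j; rewrite !inE => /andP[p1 p2] /andP[p3 p4];
  (have [|ij] := leqP j i; [move=> ji; apply: diff => //|lia]); nra.
Qed.

Lemma disjoints0r (T : finType) (A : {set T}) : [disjoint A & finset.set0]%B.
Proof. by rewrite -finset.setI_eq0 finset.setI0. Qed.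

Lemma disjoints0l (T : finType) (A : {set T}) : [disjoint finset.set0 & A]%B.
Proof. by rewrite -finset.setI_eq0 finset.set0I. Qed.

(** * Poisson weights of occupancy patterns *)

Section weights.
Context {R : realType} {C : finType}.
Implicit Types (v : R) (A B D : {set C}).

(** Probability that independent Poisson counts of mean [v] equal 1 on the cells of [A] and 0 on the
    others. *)
Definition weight v A : R := v ^+ #|A| * expR (- (v * #|C|%:R)).

Lemma weightE v A : weight v A = \prod_c (if c \in A then v * expR (- v) else expR (- v)).
Proof.
rewrite /weight.
have -> : expR (- (v * #|C|%:R)) = \prod_(c : C) expR (- v).
  by rewrite prodr_const -expRM_natr mulNr.
rewrite -prodr_const [X in X * _]big_mkcond/= -big_split/=.
by apply: eq_bigr => c _; case: ifP; rewrite ?mul1r.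
Qed.

Lemma weight_ge0 v A : 0 <= v -> 0 <= weight v A.
Proof. by move=> v0; rewrite mulr_ge0 ?exprn_ge0 ?expR_ge0. Qed.

(** The sum over subsets factorizes over cells: a cell of [B] contributes at most [v], one of [D] a
    factor [exp(-v)], any other [(1 + v) exp(-v) <= 1]. *)
Lemma sum_weight_sub v B D : 0 <= v -> [disjoint B & D]%B ->
  \sum_(A : {set C} | (B \subset A) && [disjoint A & D]%B) weight v A
    <= v ^+ #|B| * expR (- (v * #|D|%:R)).
Proof.
move=> v0 BD.
rewrite (@le_trans _ _ (\sum_(A : {set C}) \prod_c
   (if c \in A then (c \notin D)%:R * (v * expR (- v)) else (c \notin B)%:R * expR (- v))))//.
  rewrite big_mkcond/=; apply: ler_sum => A _; case: ifP => [/andP[BA AD]|_].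
    rewrite weightE; apply: ler_prod => c _.
    case: ifP => cA; rewrite ?mulr_ge0 ?expR_ge0//=.
      by rewrite (disjointFr AD cA) mul1r.
    by rewrite (contraFN (fintype.subsetP BA c) cA) mul1r.
  by apply: prodr_ge0 => c _; case: ifP => _; rewrite !mulr_ge0 ?expR_ge0.
rewrite -bigA_distr.
have -> : v ^+ #|B| * expR (- (v * #|D|%:R)) =
   \prod_(c : C) ((if c \in B then v else 1) * (if c \in D then expR (- v) else 1)).
  rewrite big_split/= -!big_mkcond/= !prodr_const -expRM_natr mulNr//.
apply: ler_prod => c _.
have e1 : expR (- v) <= 1 by rewrite -expR0 ler_expR oppr_le0.
have e0 := expR_ge0 (- v).
have ev : (v + 1) * expR (- v) <= 1.
  rewrite expRN ler_pdivrMr ?expR_gt0// mul1r addrC; exact: expR_ge1Dx.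
case: (boolP (c \in B)) => [cB|_]; case: (boolP (c \in D)) => [cD|_] /=;
  rewrite ?mul1r ?mul0r ?addr0 ?add0r ?mulr1.
- by rewrite (disjointFr BD cB) in cD.
- by rewrite mulr_ge0//= ler_piMr.
- by rewrite e0 lexx.
- by rewrite addr_ge0 ?mulr_ge0//= -[X in _ + X]mul1r -mulrDl.
Qed.

(** The sum is [((1 + v) exp(-v)) ^ #|C|], the probability of at most one point per cell;
    [(1 + v) exp(-v) >= 1 - v ^ 2] and Bernoulli's inequality conclude. *)
Lemma sum_weight_ge v : 0 <= v <= 1 -> 1 - #|C|%:R * v ^+ 2 <= \sum_(A : {set C}) weight v A.
Proof.
move=> /andP[v0 v1]; under eq_bigr do rewrite weightE.
rewrite -bigA_distr prodr_const.
have ev : 1 - v ^+ 2 <= v * expR (- v) + expR (- v).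
  have := expR_ge1Dx (- v); nra.
have v2 : 0 <= 1 - v ^+ 2 by nra.
apply: (@le_trans _ _ ((1 - v ^+ 2) ^+ #|C|)); last first.
  by apply: lerXn2r => //; rewrite nnegrE// (le_trans v2).
elim: #|C| => [|n IH]; first by rewrite mul0r subr0 expr0.
rewrite [leRHS]exprS -natr1; have : 0 <= n%:R * (v ^+ 2) by rewrite mulr_ge0 ?sqr_ge0.
move=> n0; apply: le_trans (ler_wpM2l v2 IH); nra.
Qed.

End weights.

(** * Good patterns carry almost all the weight *)

Section good_occupancy.
Context {R : realType} {d k : nat} (d0 : (0 < d)%N).
Let i0 := Ordinal d0.
Local Notation C M := (@cells d k M).
Local Notation corner := (@corner R d k _).
Local Notation kap := (@kap d k).

Lemma corner_upd M (c : C M) a i : corner (upd i0 c a) i =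
  if i == i0 then a%:R - (kap * M)%:R else corner c i.
Proof. by rewrite /corner ffunE; case: ifP. Qed.

(** On each line in direction [i0] the near cells have indices within [8 * d] of one another. *)
Lemma card_near_cells M :
  (2 * kap * M * #|[set c : C M | ~~ @far_cell R d k M c]%SET| <= #|C M| * (8 * d).+1)%N.
Proof.
apply: (card_fiber (i0 := i0)) => c; apply: card_diam => a b; rewrite !inE /far_cell -!leNgt => na nb.
have {na} := le_trans (coord_le_nrm _ i0) na; rewrite corner_upd eqxx ler_norml => /andP[a1 a2].
have {nb} := le_trans (coord_le_nrm _ i0) nb; rewrite corner_upd eqxx ler_norml => /andP[b1 b2].
rewrite -(ler_nat R) natrD; have -> : (8 * d)%:R = 2 * (4 * d)%:R :> R by rewrite -natrM; congr _%:R; lia.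
lra.
Qed.

(** Along the axis [i0] the squared distance to [tau] is the square of a shifted index plus a
    constant, and a shell of half-width [4 * d] around radius [r] confines it to a window of length
    [16 d r + 32 d ^ 2]. *)
Lemma card_shell_fiber M (c : C M) (tau : 'I_d -> R) (r : R) (D : nat) : 0 <= r ->
  16 * d%:R * r + 32 * d%:R ^+ 2 <= D%:R ^+ 2 ->
  (#|[set a | (`|nrm (fun i => corner (upd i0 c a) i - tau i) - r| <= (4 * d)%:R)%R]%SET|
     <= 2 * D.+1)%N.
Proof.
move=> r0 hD.
pose rest := \sum_(i | i != i0) (corner c i - tau i) ^+ 2.
pose e : R := (4 * d)%:R.
have e0 : 0 <= e by rewrite ler0n.
apply: (@card_sqr_window R _ D ((kap * M)%:R + tau i0) (r ^+ 2 - (2 * e * r + e ^+ 2) - rest)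
  (2 * (2 * e * r + e ^+ 2))).
  by apply: le_trans hD; rewrite /e natrM; nra.
move=> a; rewrite inE; set q := nrm _; rewrite -/e ler_norml => /andP[q1 q2].
have q0 : 0 <= q by exact: nrm_ge0.
have : q ^+ 2 = (a%:R - ((kap * M)%:R + tau i0)) ^+ 2 + rest.
  rewrite sqr_nrm (bigD1 i0)//= corner_upd eqxx; congr (_ + _); first by ring.
  by apply: eq_bigr => i /negbTE ii; rewrite corner_upd ii.
set t := (_ - _) ^+ 2 => qE.
have -> : t = q ^+ 2 - rest by rewrite qE addrK.
by apply/andP; split; nra.
Qed.

(** Makes the window [16 d r + 32 d ^ 2] at most [(cshell * j) ^ 2] for every radius [r] up to
    [d * kap * j ^ 2]. *)
Definition cshell := (16 * d ^ 2 * kap + 32 * d ^ 2)%N.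

(** With [j ^ 2] cells per block side radii are of order at most [j ^ 2], so a shell meets a line in
    O(j) cells, a share O(1/j). A cell ambiguous with [c] lies in one of two such shells, both of
    radius the norm of the corner of [c], centred at the origin and at that corner. *)
Lemma card_amb j (c : C (j ^ 2)) : (0 < j)%N ->
  (2 * kap * j ^ 2 * #|[set c' : C (j ^ 2) | ~~ @unamb R d k _ c c']%SET|
    <= #|C (j ^ 2)| * (4 * (cshell * j).+1))%N.
Proof.
move=> j0; apply: (card_fiber (i0 := i0)) => c'.
pose r := nrm (corner c).
have r0 : 0 <= r by exact: nrm_ge0.
have hD : 16 * d%:R * r + 32 * d%:R ^+ 2 <= (cshell * j)%:R ^+ 2.
  have rb : r <= d%:R * (kap * j ^ 2)%:R.
    apply: nrm_le => i; rewrite /corner ler_norml.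
    have : (c i)%:R <= (2 * kap * j ^ 2)%:R :> R by rewrite ler_nat ltnW.
    have : 0 <= (c i)%:R :> R by [].
    have -> : (2 * kap * j ^ 2)%:R = 2 * (kap * j ^ 2)%:R :> R by rewrite -natrM mulnA.
    by move=> *; apply/andP; split; lra.
  apply: (@le_trans _ _ (cshell * j ^ 2)%:R).
    have : 16 * d%:R * r <= 16 * d%:R * (d%:R * (kap * j ^ 2)%:R) by rewrite ler_wpM2l.
    move=> h; apply: le_trans (lerD h (lexx _)) _.
    have -> : 16 * d%:R * (d%:R * (kap * j ^ 2)%:R) + 32 * d%:R ^+ 2 =
       (16 * d ^ 2 * kap * j ^ 2 + 32 * d ^ 2)%:R :> R.
      by rewrite natrD !natrM ?natrX; ring.
    rewrite ler_nat /cshell mulnDl leq_add2l leq_pmulr// expn_gt0 j0//.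
  rewrite -natrX ler_nat expnMn leq_mul2r; apply/orP; right.
  by rewrite -mulnn; case: cshell => // n; exact: leq_pmulr.
have -> : (4 * (cshell * j).+1 = 2 * (cshell * j).+1 + 2 * (cshell * j).+1)%N by lia.
apply: leq_trans (leq_add (card_shell_fiber c' (fun=> 0) r0 hD) (card_shell_fiber c' (corner c) r0 hD)).
apply: leq_trans (leq_card_setU _ _); apply: subset_leq_card; apply/fintype.subsetP => a.
rewrite !inE /unamb negb_and -!leNgt => /orP[h|->]; rewrite ?orbT//.
apply/orP; left; rewrite distrC (@eq_nrm _ _ _ (corner (upd i0 c' a)))// => i; by rewrite subr0.
Qed.

Lemma card_block M (b : {ffun 'I_d -> 'I_(2 * kap)}) : (0 < M)%N ->
  (M ^ d <= #|@block d k M b|)%N.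
Proof.
move=> M0; have lt (g : {ffun 'I_d -> 'I_M}) i : (b i * M + g i < 2 * kap * M)%N.
  have := ltn_ord (b i); have := ltn_ord (g i) => gi bi.
  apply: (@leq_trans ((b i).+1 * M)); first by rewrite [ltnRHS]mulSn addnC ltn_add2r.
  by rewrite leq_mul2r bi orbT.
pose F (g : {ffun 'I_d -> 'I_M}) : C M := [ffun i => Ordinal (lt g i)].
have Finj : injective F.
  move=> g g' /ffunP e; apply/ffunP => i; have := e i; rewrite !ffunE => /(congr1 val)/= /addnI.
  exact: val_inj.
rewrite -[X in (X ^ _)%N]card_ord -[X in (_ ^ X)%N]card_ord -card_ffun -(card_imset _ Finj).
apply: subset_leq_card; apply/fintype.subsetP => c /imsetP[g _ ->].
rewrite inE; apply/forallP => i; rewrite ffunE/=.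
by rewrite divnMDl// divn_small ?addn0.
Qed.

(** Union bound: the subtracted terms account, in this order, for a cell with two points, an empty
    block, an occupied cell near the centre and an ambiguous pair. *)
Lemma sum_good_ge M (v : R) : (0 < M)%N -> 0 <= v <= 1 ->
  1 - #|C M|%:R * v ^+ 2 - (2 * kap)%:R ^+ d * expR (- (v * (M ^ d)%:R))
   - v * #|[set c : C M | ~~ @far_cell R d k M c]%SET|%:R
   - v ^+ 2 * (\sum_(c : C M) #|[set c' : C M | ~~ @unamb R d k M c c']%SET|)%N%:R
  <= \sum_(A : {set C M} | @good R d k M A) weight v A.
Proof.
move=> M0 v01; have /andP[v0 v1] := v01.
have w0 (A : {set C M}) : 0 <= weight v A by exact: weight_ge0.
pose near := [set c : C M | ~~ @far_cell R d k M c]%SET.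
pose amb c := [set c' : C M | ~~ @unamb R d k M c c']%SET.
have key (A : {set C M}) : weight v A <= (if @good R d k M A then weight v A else 0)
   + \sum_b (if [disjoint A & @block d k M b]%B then weight v A else 0)
   + \sum_(c in near) (if c \in A then weight v A else 0)
   + \sum_c \sum_(c' in amb c) (if (c != c') && (c \in A) && (c' \in A) then weight v A else 0).
  have ge0 (I : finType) (P Q : pred I) : 0 <= \sum_(i | P i) (if Q i then weight v A else 0).
    by apply: sumr_ge0 => i _; case: ifP.
  have ge1 (I : finType) (P Q : pred I) i : P i -> Q i ->
      weight v A <= \sum_(i | P i) (if Q i then weight v A else 0).
    move=> Pi Qi; rewrite (bigD1 i)//= Qi lerDl.
    by apply: sumr_ge0 => a _; case: ifP.
  have ge02 : 0 <= \sum_c \sum_(c' in amb c) (if (c != c') && (c \in A) && (c' \in A) then weight v A else 0).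
    by apply: sumr_ge0 => c _; exact: ge0.
  case: (boolP (good A)) => [gA|]; first by rewrite -!addrA lerDl !addr_ge0 ?ge0.
  rewrite /good !negb_and => /or3P[/forallPn[b]|/forall_inPn[c cA]|/forall_inPn[c cA /forall_inPn[c' c'A]]].
  - rewrite negbK => /eqP bA; rewrite add0r -!addrA.
    apply: le_trans (ge1 _ xpredT (fun b => [disjoint A & @block d k M b]%B) b isT _) _; first by rewrite -finset.setI_eq0 bA.
    by rewrite lerDl addr_ge0 ?ge0.
  - move=> nf; rewrite add0r; apply: (le_trans (ge1 _ (fun c => c \in near) (fun c => c \in A) c _ cA)); first by rewrite inE.
    by rewrite addrAC lerDr addr_ge0 ?ge0.
  - rewrite negb_imply => /andP[cc' na]; rewrite add0r.
    apply: (@le_trans _ _ (\sum_c \sum_(c' in amb c) (if (c != c') && (c \in A) && (c' \in A) then weight v A else 0))).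
      rewrite (bigD1 c)//= -[leLHS]addr0 lerD//; last first.
        by apply: sumr_ge0 => a _; exact: ge0.
      apply: (ge1 _ (fun c' => c' \in amb c) (fun c' => (c != c') && (c \in A) && (c' \in A)) c').
        by rewrite inE.
      by rewrite cc' cA c'A.
    by rewrite lerDr addr_ge0 ?ge0.
have := @ler_sum R _ (index_enum _) xpredT _ _ (fun A _ => key A).
rewrite !big_split/= -big_mkcond/= => {}key.
have := le_trans (sum_weight_ge (C := C M) v01) key.
have E1 : \sum_(A : {set C M}) \sum_b (if [disjoint A & @block d k M b]%B then weight v A else 0)
   <= (2 * kap)%:R ^+ d * expR (- (v * (M ^ d)%:R)).
  rewrite exchange_big/=.
  have -> : (2 * kap)%:R ^+ d * expR (- (v * (M ^ d)%:R)) =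
    \sum_(b : {ffun 'I_d -> 'I_(2 * kap)}) expR (- (v * (M ^ d)%:R)).
    by rewrite sumr_const card_ffun !card_ord -natrX mulr_natl.
  apply: ler_sum => b _; rewrite -big_mkcond/=.
  apply: (@le_trans _ _ (expR (- (v * #|@block d k M b|%:R)))); last first.
    by rewrite ler_expR lerN2 ler_wpM2l// ler_nat card_block.
  have := @sum_weight_sub R (C M) v finset.set0 (@block d k M b) v0 (disjoints0l _).
  rewrite cards0 expr0 mul1r; move=> /(le_trans _); apply.
  by rewrite le_eqVlt; apply/orP; left; apply/eqP; apply: eq_bigl => A; rewrite finset.sub0set.
have E2 : \sum_(A : {set C M}) \sum_(c in near) (if c \in A then weight v A else 0) <= v * #|near|%:R.
  rewrite exchange_big/= mulr_natr -sumr_const; apply: ler_sum => c _; rewrite -big_mkcond/=.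
  have := @sum_weight_sub R (C M) v [set c]%SET finset.set0 v0 (disjoints0r _).
  rewrite cards1 expr1 cards0 mulr0 oppr0 expR0 mulr1; move=> /(le_trans _); apply.
  rewrite le_eqVlt; apply/orP; left; apply/eqP; apply: eq_bigl => A.
  by rewrite finset.sub1set disjoints0r andbT.
have E3 : \sum_(A : {set C M}) \sum_c \sum_(c' in amb c)
    (if (c != c') && (c \in A) && (c' \in A) then weight v A else 0) <= v ^+ 2 * (\sum_(c : C M) #|amb c|)%N%:R.
  rewrite exchange_big/= natr_sum mulr_sumr; apply: ler_sum => c _.
  rewrite exchange_big/= mulr_natr -sumr_const; apply: ler_sum => c' _.
  have [->|cc'] := eqVneq c c'; first by rewrite big1 ?sqr_ge0// => A _; rewrite eqxx.
  rewrite -big_mkcond/=.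
  have := @sum_weight_sub R (C M) v [set c; c']%SET finset.set0 v0 (disjoints0r _).
  rewrite cards2 cc' cards0 mulr0 oppr0 expR0 mulr1; move=> /(le_trans _); apply.
  rewrite le_eqVlt; apply/orP; left; apply/eqP; apply: eq_bigl => A.
  by rewrite finset.subUset !finset.sub1set disjoints0r andbT.
rewrite -/near; move: E1 E2 E3.
set a1 := \sum_(A : {set C M}) \sum_b _; set a2 := \sum_(A : {set C M}) \sum_(c in near) _.
set a3 := \sum_(A : {set C M}) \sum_c _ => E1 E2 E3.
by rewrite -/(amb _); lra.
Qed.

(** The side [S] of a block is fixed first, large enough to make an empty block unlikely. The total
    volume [V] of the grid is then fixed too, and the mesh [h = S / j ^ 2] makes the three other
    losses O(1/j). *)
Lemma good_weight (eps : R) : 0 < eps -> exists M (h : R), [/\ (0 < M)%N, 0 < h &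
  1 - eps <= \sum_(A : {set C M} | @good R d k M A) weight (h ^+ d) A].
Proof.
move=> e0; pose B : R := (2 * kap)%:R ^+ d.
pose S := (Num.truncn (2 * B / eps)).+1.
have B0 : 0 <= B by rewrite exprn_ge0.
have S0 : 0 < S%:R :> R by rewrite ltr0n.
have S1 : 1 <= S%:R :> R by rewrite ler1n.
have BS : B * expR (- (S%:R ^+ d)) <= eps / 2.
  have SS : S%:R <= S%:R ^+ d :> R by rewrite -[leLHS]expr1 ler_weXn2l.
  apply: (@le_trans _ _ (B * (S%:R)^-1)).
    rewrite ler_wpM2l// expRN lef_pV2 ?posrE ?expR_gt0//.
    by apply: le_trans SS (le_trans _ (expR_ge1Dx _)); rewrite lerDr.
  rewrite ler_pdivrMr// mulrAC ler_pdivlMr//.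
  have : 2 * B / eps < S%:R by rewrite /S truncnS_gt.
  by rewrite ltr_pdivrMr// => h1; lra.
pose V : R := (2 * kap * S)%:R ^+ d.
have V0 : 0 <= V by rewrite exprn_ge0.
(* Bounds [j] times the losses from doubly occupied cells, near cells and ambiguous pairs. *)
pose K := V * S%:R + V * (8 * d).+1%:R + V ^+ 2 * (4 * (cshell.+1))%:R.
have K0 : 0 <= K by rewrite !addr_ge0 ?mulr_ge0 ?exprn_ge0.
pose j := (Num.truncn (2 * K / eps) + S)%N.+1.
have j0 : 0 < j%:R :> R by rewrite ltr0n.
have Kj : K / j%:R <= eps / 2.
  rewrite ler_pdivrMr// mulrAC ler_pdivlMr//.
  have : 2 * K / eps < (Num.truncn (2 * K / eps)).+1%:R by rewrite truncnS_gt.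
  have : (Num.truncn (2 * K / eps)).+1%:R <= j%:R :> R by rewrite ler_nat ltnS leq_addr.
  by move=> h1 h2; have := lt_le_trans h2 h1; rewrite ltr_pdivrMr// => h3; lra.
pose M := (j ^ 2)%N.
have M0 : (0 < M)%N by rewrite expn_gt0.
have jM : (j <= M)%N by rewrite /M -[X in (X <= _)%N]expn1 leq_pexp2l.
have SM : (S <= M)%N by apply: leq_trans jM; rewrite /j; lia.
have M0R : 0 < M%:R :> R by rewrite ltr0n.
exists M, (S%:R / M%:R); split; rewrite ?divr_gt0//.
set v := (_ / _) ^+ d.
have h1 : S%:R / M%:R <= 1 :> R by rewrite ler_pdivrMr// mul1r ler_nat.
have h0 : 0 <= S%:R / M%:R :> R by rewrite divr_ge0.
have v01 : 0 <= v <= 1 by rewrite exprn_ge0//= exprn_ile1.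
have /andP[v0 v1] := v01.
have vj : v * j%:R <= S%:R.
  apply: (@le_trans _ _ (S%:R / M%:R * j%:R)).
    rewrite ler_wpM2r// ?ler0n// /v -[leRHS]expr1; apply: ler_wiXn2l => //.
  by rewrite mulrAC ler_pdivrMr// ler_wpM2l// ler_nat.
have CV : #|C M|%:R * v = V.
  rewrite /cells card_ffun !card_ord natrX -exprMn /V; congr (_ ^+ _).
  by rewrite (natrM _ (2 * kap) M) (natrM _ (2 * kap) S); field; rewrite gt_eqF.
apply: le_trans (sum_good_ge M0 v01).
have -> : v * (M ^ d)%:R = S%:R ^+ d by rewrite natrX -exprMn divfK// gt_eqF.
have near : v * #|[set c : C M | ~~ @far_cell R d k M c]%SET|%:R * j%:R <= V * (8 * d).+1%:R.
  rewrite -CV -!mulrA [leRHS]mulrCA ler_wpM2l// -!natrM ler_nat.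
  apply: leq_trans (card_near_cells M); rewrite mulnC leq_mul2r; apply/orP; right.
  by apply: leq_trans jM _; rewrite leq_pmull// muln_gt0.
set am := (\sum_(c : C M) _)%N.
have amb : v ^+ 2 * am%:R * j%:R <= V ^+ 2 * (4 * cshell.+1)%:R.
  have -> : V ^+ 2 * (4 * cshell.+1)%:R = v ^+ 2 * (#|C M| * #|C M| * (4 * cshell.+1))%N%:R.
    by rewrite -CV !natrM; ring.
  rewrite -mulrA ler_wpM2l ?sqr_ge0// -natrM ler_nat.
  rewrite -(leq_pmul2r (m := j))//.
  apply: (@leq_trans (2 * kap * M * am)).
    by rewrite -mulnA mulnn mulnC leq_mul2r leq_pmull ?orbT// muln_gt0.
  apply: (@leq_trans (#|C M| * (#|C M| * (4 * (cshell * j).+1)))).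
    rewrite /am big_distrr/= -[X in (_ <= X * _)%N]sum1_card big_distrl/=.
    by apply: leq_sum => c _; rewrite mul1n; exact: card_amb.
  move: #|C M| => n; rewrite -!mulnA !leq_mul2l; do ! (apply/orP; right).
  by rewrite mulSn [(j + _)%N]addnC -addn1 leq_add2l.
have T1 : #|C M|%:R * v ^+ 2 * j%:R <= V * S%:R.
  by rewrite expr2 mulrA CV -mulrA ler_wpM2l.
have tot : #|C M|%:R * v ^+ 2 + v * #|[set c : C M | ~~ @far_cell R d k M c]%SET|%:R + v ^+ 2 * am%:R <= K / j%:R.
  by rewrite ler_pdivlMr// /K !mulrDl; apply: lerD => //; apply: lerD.
rewrite -/B; lra.
Qed.

End good_occupancy.

(** * The limit law of the degree as a supremum over meshes *)

Lemma cvg_sumr {R : realType} {T : Type} {F : set_system T} {FF : Filter F} {I : Type}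
  (r : seq I) (P : pred I) (f : T -> I -> R) (l : I -> R) :
  (forall i, f ^~ i @ F --> l i) ->
  (fun t => \sum_(i <- r | P i) f t i) @ F --> \sum_(i <- r | P i) l i.
Proof.
move=> fl; elim: r => [|i r IH].
  by rewrite big_nil; under eq_fun do rewrite big_nil; exact: cvg_cst.
rewrite big_cons; under eq_fun do rewrite big_cons.
by case: (P i) => //; apply: cvgD.
Qed.

Section limit_degree_distribution.
Context {R : realType} {d : nat} (k : nat) (d0 : (0 < d)%N).
Local Notation C M := (@cells d k M).

Definition pset l : set R := [set s | exists M (h : R), [/\ (0 < M)%N, 0 < h &
  s = \sum_(A : {set C M} | @good R d k M A && (@degA R d k M A == l)) weight (h ^+ d) A]].

Definition pstar l : R := sup (pset l).

Lemma sum_weight_le1 (T : finType) (v : R) (P : pred {set T}) : 0 <= v ->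
  \sum_(A : {set T} | P A) weight v A <= 1.
Proof.
move=> v0; have := @sum_weight_sub R T v finset.set0 finset.set0 v0 (disjoints0r _).
rewrite cards0 expr0 mul1r mulr0 oppr0 expR0; move=> /(le_trans _); apply.
rewrite [leLHS]big_mkcond [leRHS]big_mkcond/=; apply: ler_sum => A _.
rewrite finset.sub0set disjoints0r/=; case: ifP => // _; exact: weight_ge0.
Qed.

Lemma pset_has_sup l : has_sup (pset l).
Proof.
split.
  by exists (\sum_(A : {set C 1} | @good R d k 1 A && (@degA R d k 1 A == l)) weight (1 ^+ d) A), 1%N, 1.
by exists 1 => s [M [h [_ h0 ->]]]; apply: sum_weight_le1; rewrite exprn_ge0// ltW.
Qed.

(** A mesh almost attaining the supremum bounds [q] from below. A mesh whose good sets weigh at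
    least [1 - e / 4] bounds it from above, since its good sets of degree [l] weigh at most
    [pstar l]. [q] may be a sequence of probabilities for growing samples or a single fixed
    probability. *)
Lemma cvg_pstar (T : Type) (F : set_system T) (FF : ProperFilter F) (q : T -> R) l :
  (forall M (h : R), (0 < M)%N -> 0 < h -> exists w : T -> {set C M} -> R,
    [/\ forall A, w ^~ A @ F --> (weight (h ^+ d) A : R),
        \forall t \near F, \sum_(A | @good R d k M A && (@degA R d k M A == l)) w t A <= q t &
        \forall t \near F, q t <= 1 - \sum_(A | @good R d k M A && (@degA R d k M A != l)) w t A]) ->
  q @ F --> pstar l.
Proof.
move=> H; apply/cvgrPdist_le => e e0.
have e2 : 0 < e / 4 by rewrite divr_gt0.
have wcvg M (h : R) (w : T -> {set C M} -> R) (P : pred {set C M}) :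
    (forall A, w ^~ A @ F --> (weight (h ^+ d) A : R)) ->
    \forall t \near F, `|\sum_(A | P A) weight (h ^+ d) A - \sum_(A | P A) w t A| <= e / 4.
  move=> wc; have : (fun t => \sum_(A | P A) w t A) @ F --> (\sum_(A | P A) weight (h ^+ d) A : R).
    by apply: cvg_sumr => A; exact: wc.
  by move=> /cvgrPdist_le/(_ _ e2).
have [s [M1 [h1 [M10 h10 sE]]] ss] := sup_adherent e2 (pset_has_sup l).
rewrite -/(pstar l) in ss.
have [w1 [w1c lo1 _]] := H _ _ M10 h10.
have [M2 [h2 [M20 h20 g2]]] := good_weight (k := k) d0 e2.
have [w2 [w2c _ hi2]] := H _ _ M20 h20.
have up2 : \sum_(A : {set C M2} | @good R d k M2 A && (@degA R d k M2 A == l)) weight (h2 ^+ d) A <= pstar l.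
  by apply: ub_le_sup; [exact: (pset_has_sup l).2|exists M2, h2].
rewrite (bigID (fun A => @degA R d k M2 A == l))/= in g2.
have n1 := wcvg _ _ _ (fun A => @good R d k M1 A && (@degA R d k M1 A == l)) w1c.
have n2 := wcvg _ _ _ (fun A => @good R d k M2 A && (@degA R d k M2 A != l)) w2c.
near=> t.
have a1 : `|\sum_(A | @good R d k M1 A && (@degA R d k M1 A == l)) weight (h1 ^+ d) A -
   \sum_(A | @good R d k M1 A && (@degA R d k M1 A == l)) w1 t A| <= e / 4 by near: t.
have a2 : `|\sum_(A | @good R d k M2 A && (@degA R d k M2 A != l)) weight (h2 ^+ d) A -
   \sum_(A | @good R d k M2 A && (@degA R d k M2 A != l)) w2 t A| <= e / 4 by near: t.
have b1 : \sum_(A | @good R d k M1 A && (@degA R d k M1 A == l)) w1 t A <= q t by near: t.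
have b2 : q t <= 1 - \sum_(A | @good R d k M2 A && (@degA R d k M2 A != l)) w2 t A by near: t.
move: a1 a2; rewrite !ler_norml -sE => /andP[a1 a1'] /andP[a2 a2'].
by apply/andP; split; lra.
Unshelve. all: by end_near. Qed.

End limit_degree_distribution.

(** * Push-forwards and product measures on tuples *)

Section push_forward.
Local Open Scope ereal_scope.
Context d1 d2 (T1 : measurableType d1) (T2 : measurableType d2) (R : realType).

Section measure.
Variables (m : {measure set T1 -> \bar R}) (f : T1 -> T2).
Hypothesis mf : measurable_fun [set: T1] f.

(** The measurability proof is an argument so that the measure structure can be inferred. *)
Definition mpush of measurable_fun [set: T1] f : set T2 -> \bar R := pushforward m f.

Let mpush0 : mpush mf set0 = 0.
Proof. by rewrite /mpush /pushforward preimage_set0 measure0. Qed.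

Let mpush_ge0 A : 0 <= mpush mf A.
Proof. exact: measure_ge0. Qed.

Let mpush_sigma_additive : semi_sigma_additive (mpush mf).
Proof.
move=> F mF tF mUF; rewrite /mpush /pushforward preimage_bigcup.
apply: measure_semi_sigma_additive.
- by move=> n; rewrite -[X in measurable X]setTI; exact: mf.
- apply/trivIsetP => /= i j _ _ ij; rewrite -preimage_setI.
  by move/trivIsetP : tF => /(_ _ _ _ _ ij) ->//; rewrite preimage_set0.
- by rewrite -preimage_bigcup -[X in measurable X]setTI; exact: mf.
Qed.

HB.instance Definition _ := isMeasure.Build _ _ _ (mpush mf)
  mpush0 mpush_ge0 mpush_sigma_additive.

Lemma ge0_integral_mpush (g : T2 -> \bar R) : measurable_fun setT g ->
  (forall y, 0 <= g y) -> \int[mpush mf]_y g y = \int[m]_x g (f x).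
Proof.
by move=> mg g0; rewrite (ge0_integral_pushforward mf).
Qed.

End measure.

Section probability.
Variables (P : probability T1 R) (f : T1 -> T2) (mf : measurable_fun [set: T1] f).

Let mpushT : mpush P mf setT = 1.
Proof. by rewrite /mpush /pushforward preimage_setT; exact: probability_setT. Qed.

HB.instance Definition _ := Measure_isProbability.Build _ _ _ (mpush P mf) mpushT.

End probability.

End push_forward.

Section tuple_product.
Local Open Scope ereal_scope.
Context {dT} {T : measurableType dT} {R : realType} (mu : probability T R).

Definition tcons n (z : T * n.-tuple T) : n.+1.-tuple T := [the n.+1.-tuple T of z.1 :: z.2].

Lemma measurable_tcons n : measurable_fun [set: T * n.-tuple T] (@tcons n).
Proof. exact: measurable_cons. Qed.

(** Built one coordinate at a time, so that Fubini's theorem gives induction on the size of the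
    sample. *)
Fixpoint tprod n : probability (n.-tuple T) R :=
  match n with
  | 0%N => [the probability _ _ of dirac [tuple]]
  | n'.+1 => [the probability _ _ of mpush (mu \x tprod n') (@measurable_tcons n')]
  end.

Lemma ge0_integral_tprodS_swap n (g : n.+1.-tuple T -> \bar R) : measurable_fun setT g ->
  (forall u, 0 <= g u) ->
  \int[tprod n.+1]_u g u = \int[tprod n]_y \int[mu]_x g (tcons (x, y)).
Proof.
move=> mg g0 /=; rewrite ge0_integral_mpush// fubini_tonelli2//.
exact: measurableT_comp mg (@measurable_tcons n).
Qed.

Lemma measurable_tcons2 n x : measurable_fun setT (fun y : n.-tuple T => tcons (x, y)).
Proof. exact: measurableT_comp (@measurable_tcons n) (@pair1_measurable _ _ _ _ x). Qed.

Lemma measurable_tcons1 n (y : n.-tuple T) : measurable_fun setT (fun x => tcons (x, y)).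
Proof. exact: measurableT_comp (@measurable_tcons n) (@pair2_measurable _ _ _ _ y). Qed.

Lemma tprodS n (B : set (n.+1.-tuple T)) : measurable B ->
  tprod n.+1 B = \int[mu]_x tprod n [set y | B (tcons (x, y))].
Proof.
move=> mB; rewrite /= /mpush /pushforward /= /product_measure1.
by apply: eq_integral => x _ /=; congr (tprod n _); apply/seteqP; split => y /=;
   rewrite /xsection/= inE.
Qed.

Lemma tprodS_swap n (B : set (n.+1.-tuple T)) : measurable B ->
  tprod n.+1 B = \int[tprod n]_y mu [set x | B (tcons (x, y))].
Proof.
move=> mB.
have -> : tprod n.+1 B = \int[tprod n.+1]_u (\1_B u)%:E by rewrite integral_indic// setIT.
rewrite ge0_integral_tprodS_swap//; last first.
  by apply/measurable_EFinP; exact: measurable_indic.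
apply: eq_integral => y _.
have mBy : measurable [set x | B (tcons (x, y))].
  by rewrite -[X in measurable X]setTI; exact: measurable_tcons1.
by have -> : mu [set x | B (tcons (x, y))] = \int[mu]_x (\1_[set x | B (tcons (x, y))] x)%:E
  by rewrite integral_indic// setIT.
Qed.

Definition tbox n (A : 'I_n -> set T) : set (n.-tuple T) := [set u | forall i, A i (tnth u i)].

Lemma measurable_tbox n (A : 'I_n -> set T) : (forall i, measurable (A i)) ->
  measurable (tbox A).
Proof.
move=> mA; have -> : tbox A = \big[setI/setT]_(i < n) [set u | A i (tnth u i)].
  rewrite -bigcap_seq; apply/seteqP; split=> [u uA i _|u uA i]; first exact: uA.
  by apply: uA; rewrite /= mem_index_enum.
apply: bigsetI_measurable => i _; rewrite -[X in measurable X]setTI.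
exact: measurable_tnth.
Qed.

Lemma tprod_tbox n (A : 'I_n -> set T) : (forall i, measurable (A i)) ->
  tprod n (tbox A) = \prod_(i < n) mu (A i).
Proof.
elim: n A => [|n IH] A mA.
  rewrite big_ord0 /= diracE mem_set// => -[] //.
rewrite big_ord_recl -IH//= -product_measure1E//; last by apply: measurable_tbox => i.
rewrite /mpush /pushforward; congr (_ _); apply/seteqP; split=> [[x y] /= h|[x y] [/= h1 h2] i].
  split; first by have := h ord0.
  by move=> i; have := h (lift ord0 i); rewrite tnthS.
by case: (unliftP ord0 i) => [j ->|->] //=; rewrite tnthS; exact: h2.
Qed.

Lemma measurable_tuple_tbox n : @measurable _ (n.-tuple T) =
  <<s [set B | exists2 A : 'I_n -> set T, forall i, measurable (A i) & B = tbox A] >>.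
Proof.
apply/seteqP; split.
  apply: smallest_sub; first exact: smallest_sigma_algebra.
  move=> B; rewrite -bigcup_seq => -[i _ [A mA <-]].
  apply: sub_sigma_algebra; exists (fun j => if j == i then A else setT).
    by move=> j; case: ifP.
  apply/seteqP; split=> [u [_ /= uA] j|u uA].
    by case: eqP => // ->.
  by split => //=; have := uA i; rewrite eqxx.
apply: smallest_sub; first exact: sigma_algebra_measurable.
by move=> B [A mA ->]; exact: measurable_tbox.
Qed.

(** Boxes are stable under intersection and generate the sigma-algebra. The factor [c] serves laws
    restricted to an event of probability [c]. *)
Lemma tprod_unique n (m : {measure set (n.-tuple T) -> \bar R}) (c : R) : (0 <= c)%R ->
  (forall A, (forall i, measurable (A i)) -> m (tbox A) = c%:E * \prod_(i < n) mu (A i)) ->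
  forall B, measurable B -> m B = c%:E * tprod n B.
Proof.
move=> c0 mE B mB.
pose c' := NngNum c0.
have -> : c%:E * tprod n B = mscale c' (tprod n) B by [].
apply: (measure_unique [set B | exists2 A : 'I_n -> set T, forall i, measurable (A i) & B = tbox A]
   (fun=> setT)) => //.
- exact: measurable_tuple_tbox.
- move=> _ _ [A1 mA1 ->] [A2 mA2 ->]; exists (fun i => A1 i `&` A2 i).
    by move=> i; exact: measurableI.
  apply/seteqP; split=> [u [h1 h2] i|u h]; first by split.
  by split=> i; have [] := h i.
- by move=> _; exists (fun=> setT) => //; apply/seteqP; split.
- by apply/seteqP; split => // u _; exists 0%N.
- move=> _ [A mA ->]; transitivity (c%:E * tprod n (tbox A)); last by [].
  by rewrite tprod_tbox// mE.
- move=> _; have -> : setT = tbox (fun _ : 'I_n => [set: T]) by apply/seteqP; split.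
  rewrite mE// big1 ?mule1 ?ltry// => i _; exact: probability_setT.
Qed.

End tuple_product.

(** * Measurability of distances; Lebesgue measure of cubes, spheres and bisectors *)

Section measurability.
Context {R : realType} {d : nat} {dO : measure_display} {Om : measurableType dO}.
Local Notation pt := (d.-tuple R).

Lemma measurable_tnth_comp (X : Om -> pt) i : measurable_fun setT X ->
  measurable_fun setT (fun w => tnth (X w) i).
Proof. by move=> mX; apply: (measurableT_comp (measurable_tnth i)). Qed.

Lemma measurable_edist (X Y : Om -> pt) : measurable_fun setT X -> measurable_fun setT Y ->
  measurable_fun setT (fun w => edist (X w) (Y w)).
Proof.
move=> mX mY; rewrite /edist.
apply: (@measurableT_comp _ _ _ _ _ _ (@Num.sqrt R)).
  exact: continuous_measurable_fun (@sqrt_continuous R).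
apply: measurable_sum => i; apply: measurable_funX; apply: measurable_funB;
exact: measurable_tnth_comp.
Qed.

End measurability.

Section boxes.
Context {R : realType} {d : nat}.
Local Notation pt := (d.-tuple R).

Definition cbox (a b : pt) : set pt := [set x | forall i, tnth a i <= tnth x i <= tnth b i].

Definition cube (a : 'I_d -> R) (h : R) : set pt :=
  [set x | forall i, a i <= tnth x i < a i + h].

Lemma measurable_cbox a b : measurable (cbox a b).
Proof.
have -> : cbox a b = tbox (fun i => `[tnth a i, tnth b i]%classic).
  by apply/seteqP; split=> x h i; have := h i; rewrite /= in_itv.
by apply: measurable_tbox => i.
Qed.

Lemma measurable_cube a h : measurable (cube a h).
Proof.
have -> : cube a h = tbox (fun i => `[a i, a i + h[%classic).
  by apply/seteqP; split=> x h' i; have := h' i; rewrite /= in_itv.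
by apply: measurable_tbox => i.
Qed.

Definition cboxes : set (set pt) := [set B | exists a b, B = cbox a b].

Lemma coord_bound (z : pt) : exists N : nat, forall n i, (N <= n)%N -> `|tnth z i| <= n%:R.
Proof.
exists (Num.truncn (nrm (tnth z))).+1 => n i Nn.
apply: le_trans (coord_le_nrm (tnth z) i) _; apply: le_trans (ltW (truncnS_gt _)) _.
by rewrite ler_nat.
Qed.

Lemma measurable_cboxes : @measurable _ pt = <<s cboxes >>.
Proof.
apply/seteqP; split; last first.
  apply: smallest_sub; first exact: sigma_algebra_measurable.
  by move=> _ [a [b ->]]; exact: measurable_cbox.
apply: smallest_sub; first exact: smallest_sigma_algebra.
move=> B; rewrite -bigcup_seq => -[i _ [A mA <-]].
suff : measurable_fun [set: g_sigma_algebraType cboxes]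
    ((fun x : pt => tnth x i) : g_sigma_algebraType cboxes -> R).
  by move=> /(_ measurableT _ mA).
apply: (measurability _ (RGenCInfty.measurableE R)) => _ [_ [x ->] <-]; rewrite setTI.
pose a n : pt := [tuple if j == i then x else - n%:R | j < d].
pose b n : pt := [tuple n%:R | j < d].
have -> : (fun z : pt => tnth z i) @^-1` `[x, +oo[%classic = \bigcup_n cbox (a n) (b n).
  apply/seteqP; split=> [z /=|z [n _ /(_ i)]]; last first.
    by rewrite /= !tnth_mktuple eqxx in_itv/= andbT => /andP[].
  rewrite in_itv/= andbT => xz; have [N NP] := coord_bound z.
  exists N => // j; rewrite !tnth_mktuple.
  have := NP N j (leqnn _); rewrite ler_norml => /andP[n1 n2].
  by case: eqP => [->|_]; rewrite ?xz ?n1 ?n2//; have := NP N i (leqnn _); rewrite ler_norml => /andP[].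
apply: bigcupT_measurable => n; apply: sub_sigma_algebra; by exists (a n), (b n).
Qed.

Definition shift (t : 'I_d -> R) (x : pt) : pt := [tuple tnth x i + t i | i < d].

Lemma measurable_shift t : measurable_fun setT (shift t).
Proof.
apply/measurable_fun_tnthP => i.
rewrite (_ : _ \o _ = fun x => tnth x i + t i); last first.
  by apply/funext => x /=; rewrite tnth_mktuple.
by apply: measurable_funD => //; exact: measurable_tnth.
Qed.

Variables (lam : {measure set pt -> \bar R}) (hlam : is_lebesgue_d lam).

Lemma lam_cbox_neg a b i : tnth b i < tnth a i -> lam (cbox a b) = 0%E.
Proof.
move=> ba; rewrite (_ : cbox a b = set0) ?measure0//; apply/seteqP; split=> // x /(_ i).
by move=> /andP[h1 h2]; have := le_trans h1 h2; rewrite leNgt ba.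
Qed.

(** The hypothesis gives [lam] on closed boxes only. The translated measure agrees with it there,
    and these boxes form a generating family stable under intersection. *)
Lemma lam_shift t A : measurable A -> lam (shift t @^-1` A) = lam A.
Proof.
move=> mA.
have -> : lam (shift t @^-1` A) = mpush lam (measurable_shift t) A by [].
apply/esym.
pose bb n : pt := [tuple n%:R | j < d]; pose aa n : pt := [tuple - n%:R | j < d].
apply: (measure_unique cboxes (fun n => cbox (aa n) (bb n))) => //.
- exact: measurable_cboxes.
- move=> _ _ [a [b ->]] [a' [b' ->]].
  exists [tuple Num.max (tnth a i) (tnth a' i) | i < d], [tuple Num.min (tnth b i) (tnth b' i) | i < d].
  apply/seteqP; split=> [x [h1 h2] i|x h]; last split => i; rewrite ?tnth_mktuple.
  - by have /andP[? ?] := h1 i; have /andP[? ?] := h2 i; rewrite ge_max le_min; apply/andP; split; apply/andP.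
  - by have := h i; rewrite !tnth_mktuple ge_max le_min => /andP[/andP[-> _] /andP[-> _]].
  - by have := h i; rewrite !tnth_mktuple ge_max le_min => /andP[/andP[_ ->] /andP[_ ->]].
- by move=> n; exists (aa n), (bb n).
- apply/seteqP; split=> // z _; have [N NP] := coord_bound z; exists N => // i.
  by rewrite !tnth_mktuple -ler_norml NP.
- move=> _ [a [b ->]]; rewrite /= /mpush /pushforward.
  have -> : shift t @^-1` cbox a b = cbox (shift (fun i => - t i) a) (shift (fun i => - t i) b).
    apply/seteqP; split=> x h i; have := h i; rewrite !tnth_mktuple => /andP[? ?];
    by apply/andP; split; lra.
  have [ab|/existsNP[i /negP]] := pselect (forall i, tnth a i <= tnth b i).
    rewrite !hlam//; last by move=> i; rewrite !tnth_mktuple lerD2r.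
    by congr (_ %:E); apply: eq_bigr => i _; rewrite !tnth_mktuple; ring.
  rewrite -ltNge => ba; rewrite (lam_cbox_neg ba) (lam_cbox_neg (i := i))//.
  by rewrite !tnth_mktuple ltrD2r.
- move=> n; rewrite hlam ?ltry// => i; rewrite !tnth_mktuple.
  by apply: (@le_trans _ _ 0); rewrite ?oppr_le0.
Qed.

Lemma lam_cube a (h : R) : 0 < h -> lam (cube a h) = (h ^+ d)%:E.
Proof.
move=> h0.
pose F n := cbox [tuple a i | i < d] [tuple a i + h * (1 - n.+1%:R^-1) | i < d].
have n1 n : 0 <= 1 - n.+1%:R^-1 :> R by rewrite subr_ge0 invf_le1// ler1n.
have UF : \bigcup_n F n = cube a h.
  apply/seteqP; split=> [x [n _ xF] i|x xc].
    have := xF i; rewrite !tnth_mktuple => /andP[-> /= /le_lt_trans]; apply.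
    by rewrite ltrD2l gtr_pMr// gtrDl oppr_lt0 invr_gt0.
  have /choice[m mP] : forall i, exists m : nat, h < (a i + h - tnth x i) * m%:R.
    move=> i; have /andP[_ hi] := xc i.
    have p : 0 < a i + h - tnth x i by rewrite subr_gt0.
    exists (Num.truncn (h / (a i + h - tnth x i))).+1.
    by rewrite mulrC -ltr_pdivrMr//; exact: truncnS_gt.
  exists (\max_i m i)%N => // i; rewrite !tnth_mktuple.
  have /andP[xi hi] := xc i; rewrite xi/=.
  set N := (\max_i m i)%N; have mN : (m i <= N.+1)%N by apply: leqW; exact: leq_bigmax.
  have p : 0 < a i + h - tnth x i by rewrite subr_gt0.
  have h1 : h / N.+1%:R < a i + h - tnth x i.
    rewrite ltr_pdivrMr//.
    by apply: lt_le_trans (mP i) _; rewrite ler_pM2l// ler_nat.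
  have -> : h * (1 - N.+1%:R^-1) = h - h / N.+1%:R by rewrite mulrBr mulr1.
  by move: (h / N.+1%:R) h1 => q h1; lra.
have cv : lam (F n) @[n --> \oo] --> lam (cube a h).
  rewrite -UF; apply: (nondecreasing_cvg_mu (mu := lam)).
  - by move=> n; exact: measurable_cbox.
  - by apply: bigcupT_measurable => n; exact: measurable_cbox.
  - move=> m n mn; apply/subsetPset => x xF i; have := xF i; rewrite !tnth_mktuple.
    move=> /andP[-> /le_trans]/=; apply; rewrite lerD2l ler_pM2l// lerD2l lerN2.
    by rewrite lef_pV2 ?posrE// ler_nat.
have lF n : lam (F n) = ((h * (1 - n.+1%:R^-1)) ^+ d)%:E.
  rewrite hlam; last by move=> i; rewrite !tnth_mktuple lerDl mulr_ge0// ltW.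
  congr (_ %:E); rewrite -[X in _ ^+ X]card_ord -prodr_const.
  by apply: eq_bigr => i _; rewrite !tnth_mktuple addrC addKr.
have cv2 : lam (F n) @[n --> \oo] --> (h ^+ d)%:E.
  under eq_fun do rewrite lF; apply: cvg_EFin; first by near=> n.
  rewrite [X in _ --> X](_ : _ = (h * (1 - 0)) ^+ d); last by rewrite subr0 mulr1.
  have c1 : (fun n => h * (1 - n.+1%:R^-1)) @ \oo --> h * (1 - 0).
    apply: cvgM; first exact: cvg_cst.
    by apply: cvgB; [exact: cvg_cst|exact: cvg_harmonic].
  exact: (cvg_comp _ _ c1 (@exprn_continuous R d (h * (1 - 0)))).
exact: (cvg_unique _ cv cv2).
Unshelve. all: by end_near. Qed.

Definition axis (i0 : 'I_d) (t : R) : 'I_d -> R := fun i => if i == i0 then t else 0.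

Let W (n : nat) := cube (fun=> - n%:R) (2 * n.+1%:R).

Let W_cover : \bigcup_n W n = setT.
Proof.
apply/seteqP; split=> // z _; have [N NP] := coord_bound z; exists N => // i.
by have := NP N i (leqnn _); rewrite ler_norml -natr1 => /andP[? ?]; apply/andP; split; lra.
Qed.

(* The translates of [Z] along the axis overlap at most twice, so that [N] of
   them with the same measure fit in a fixed cube, for every [N]. *)
Lemma lam_null_lines i0 (Z : set pt) : measurable Z ->
  (forall x (ts : seq R), uniq ts ->
    (forall t, t \in ts -> Z (shift (axis i0 t) x)) -> (size ts <= 2)%N) ->
  lam Z = 0%E.
Proof.
move=> mZ hZ.
suff Zn n : lam (Z `&` W n) = 0%E.
  apply/negligibleP => //; rewrite -(setIT Z) -W_cover setI_bigcupr.
  apply: negligible_bigcup => n; apply/negligibleP; last exact: Zn.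
  by apply: measurableI => //; exact: measurable_cube.
have mZn : measurable (Z `&` W n) by apply: measurableI => //; exact: measurable_cube.
pose BW := cube (fun=> - n.+1%:R) (2 * n.+2%:R).
have mBW : measurable BW by exact: measurable_cube.
have lBW : lam BW = ((2 * n.+2%:R) ^+ d)%:E by rewrite lam_cube.
have key (N : nat) : (N.+1%:R%:E * lam (Z `&` W n) <= (2 * (2 * n.+2%:R) ^+ d)%:E)%E.
  pose tj (j : 'I_N.+1) : R := j%:R / N.+1%:R.
  have tjinj : injective tj.
    move=> i j /(mulIf _); rewrite invr_eq0 pnatr_eq0 => /(_ isT)/eqP.
    by rewrite eqr_nat => /eqP; exact: val_inj.
  pose T j := shift (axis i0 (tj j)) @^-1` (Z `&` W n).
  have mT j : measurable (T j).
    by rewrite -[X in measurable X]setTI; exact: measurable_shift.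
  have -> : (N.+1%:R%:E * lam (Z `&` W n) = \sum_(j < N.+1) lam (T j))%E.
    under eq_bigr do rewrite lam_shift//.
    by rewrite sumr_const card_ord -[RHS]mule_natl.
  have -> : (\sum_(j < N.+1) lam (T j) = \int[lam]_x (\sum_(j < N.+1) (\1_(T j) x)%:E))%E.
    rewrite ge0_integral_sum//; last first.
      by move=> j; apply/measurable_EFinP; exact: measurable_indic.
    by apply: eq_bigr => j _; rewrite integral_indic// setIT.
  rewrite EFinM -lBW -(setIT BW) -integral_indic// -ge0_integralZl//; last first.
    by apply/measurable_EFinP; exact: measurable_indic.
  apply: ge0_le_integral => //.
  - by move=> x _; rewrite sume_ge0// => j _; rewrite lee_fin.
  - by apply: emeasurable_sum => j; apply/measurable_EFinP; exact: measurable_indic.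
  - by apply/measurable_EFinP; apply: measurable_funM => //; exact: measurable_indic.
  move=> x _; rewrite sumEFin -EFinM lee_fin.
  have [xBW|xBW] := pselect (BW x); last first.
    rewrite indicE memNset// mulr0 big1// => j _; rewrite indicE memNset// => -[_ xW].
    apply: xBW => i; have := xW i; rewrite /= tnth_mktuple /axis.
    have t0 : 0 <= tj j by rewrite divr_ge0.
    have t1 : tj j <= 1 by rewrite ler_pdivrMr// mul1r ler_nat ltnW.
    by case: eqP => _; rewrite -!natr1 => /andP[? ?]; apply/andP; split; lra.
  rewrite indicE mem_set// mulr1.
  have := hZ x [seq tj j | j <- enum [set j | `[< T j x >]]%SET].
  rewrite map_inj_uniq// enum_uniq => /(_ isT).
  rewrite size_map -cardE => h2.
  have {}h2 : (#|[set j | `[< T j x >]]%SET| <= 2)%N.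
    by apply: h2 => t /mapP[j]; rewrite mem_enum inE => /asboolP[Tj _] ->.
  rewrite (eq_bigr (fun j => if j \in [set j | `[< T j x >]]%SET then 1 else 0)); last first.
    move=> j _; rewrite inE indicE.
    have [h|h] := pselect (T j x); first by rewrite mem_set// asboolT.
    by rewrite memNset// asboolF.
  by rewrite -big_mkcond/= sumr_const ler_nat.
have fin : lam (Z `&` W n) \is a fin_num.
  rewrite ge0_fin_numE//; have := key 0%N; rewrite mul1e => /le_lt_trans; apply; exact: ltry.
rewrite -(fineK fin) in key *; set r := fine _ in key *.
have r0 : 0 <= r by exact: fine_ge0.
suff -> : r = 0 by [].
 apply/eqP; rewrite eq_le r0 andbT leNgt; apply/negP => rpos.
have := key (Num.truncn (2 * (2 * n.+2%:R) ^+ d / r)).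
rewrite -EFinM lee_fin leNgt -ltr_pdivrMr//; by rewrite truncnS_gt.
Qed.

Lemma measurable_sphere (p : pt) (r : R) : measurable [set x | edist x p = r].
Proof.
have := measurable_edist (Om := pt) (@measurable_id _ _ _) (measurable_cst p).
move=> /(_ measurableT _ (measurable_set1 r)); rewrite setTI; congr (measurable _).
Qed.

Lemma measurable_bisector (p q : pt) : measurable [set x | edist x p = edist x q].
Proof.
have m1 := measurable_edist (Om := pt) (@measurable_id _ _ _) (measurable_cst p).
have m2 := measurable_edist (Om := pt) (@measurable_id _ _ _) (measurable_cst q).
have := measurable_funB m1 m2.
move=> /(_ measurableT _ (measurable_set1 0)); rewrite setTI; congr (measurable _).
by apply/seteqP; split=> x /= => [/eqP|->]; rewrite ?subrr// subr_eq0 => /eqP.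
Qed.

Lemma sqr_edist_axis i0 t x p : edist (shift (axis i0 t) x) p ^+ 2 =
  (tnth x i0 + t - tnth p i0) ^+ 2 + \sum_(i | i != i0) (tnth x i - tnth p i) ^+ 2.
Proof.
rewrite edistE sqr_nrm (bigD1 i0)//= tnth_mktuple /axis eqxx; congr (_ + _).
by apply: eq_bigr => i /negbTE ii; rewrite tnth_mktuple /axis ii addr0.
Qed.

(** A line meets a sphere at most twice: the condition is quadratic in the parameter. *)
Lemma lam_sphere (p : pt) (r : R) : (0 < d)%N -> lam [set x | edist x p = r] = 0%E.
Proof.
move=> d0; apply: (@lam_null_lines (Ordinal d0)); first exact: measurable_sphere.
move=> x ts uts hts.
pose c := r ^+ 2 - \sum_(i | i != Ordinal d0) (tnth x i - tnth p i) ^+ 2.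
pose u := tnth x (Ordinal d0) - tnth p (Ordinal d0).
have {}hts t : t \in ts -> (t + u) ^+ 2 = c.
  move=> /hts/= /(congr1 (fun a => a ^+ 2)); rewrite sqr_edist_axis /c => <-.
  by rewrite addrK /u; congr (_ ^+ 2); ring.
case: ts uts hts => [|a [|b [|e ts]]]//= /andP[+ /andP[+ _]] hts.
rewrite !inE !negb_or => /and3P[ab ae _] /andP[be _].
have ha := hts a; have hb := hts b; have he := hts e.
move: ha hb he; rewrite !inE !eqxx !orbT => /(_ isT) ha /(_ isT) hb /(_ isT) he.
have f y z : y != z -> (y + u) ^+ 2 = c -> (z + u) ^+ 2 = c -> y + z + 2 * u = 0.
  move=> yz hy hz; apply/eqP; have : (y - z) * (y + z + 2 * u) = 0.
    have : (y + u) ^+ 2 - (z + u) ^+ 2 = 0 by rewrite hy hz subrr.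
    by move=> <-; ring.
  by move=> /eqP; rewrite mulf_eq0 subr_eq0 (negbTE yz).
have h1 := f _ _ ab ha hb; have h2 := f _ _ ae ha he.
by exfalso; move: be => /eqP; apply; lra.
Qed.

(** Along an axis where [p] and [q] differ the quadratic terms cancel, leaving a linear condition of
    nonzero slope: at most one solution per line. *)
Lemma lam_bisector (p q : pt) : p <> q -> lam [set x | edist x p = edist x q] = 0%E.
Proof.
move=> pq; have [i pqi] : exists i, tnth p i != tnth q i.
  apply/not_existsP => h; apply: pq; apply: eq_from_tnth => i.
  by apply/eqP/negPn/negP; exact: h.
apply: (@lam_null_lines i); first exact: measurable_bisector.
move=> x ts uts hts.
have f y z : y \in ts -> z \in ts -> y = z.
  move=> /hts/= /(congr1 (fun a => a ^+ 2)) hy /hts/= /(congr1 (fun a => a ^+ 2)).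
  move: hy; rewrite !sqr_edist_axis => hy hz.
  set A := \sum_(j | _) (tnth x j - tnth p j) ^+ 2 in hy hz; set B := \sum_(j | _) _ in hy hz.
  apply/eqP; rewrite -subr_eq0; have : 2 * (tnth q i - tnth p i) * (y - z) = 0.
    move: hy hz; set X := tnth x i; set P := tnth p i; set Q := tnth q i => hy hz; lra.
  by move=> /eqP; rewrite !mulf_eq0 pnatr_eq0/= (subr_eq0 (tnth q i)) eq_sym (negbTE pqi) => /= ->.
case: ts uts f {hts} => [|a [|b ts]]//= /andP[+ _] f.
by rewrite (f a b) ?inE ?eqxx ?orbT.
Qed.

End boxes.

(** * The probability with density [f] *)

Section density_measure.
Local Open Scope ereal_scope.
Context {R : realType} {d : nat}.
Local Notation pt := (d.-tuple R).
Variables (lam : {measure set pt -> \bar R}) (f : pt -> R) (hf : good_density lam f).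

Definition dens of good_density lam f : set pt -> \bar R :=
  fun A => \int[lam]_(x in A) (f x)%:E.

Let mf : measurable_fun [set: pt] (EFin \o f).
Proof. by apply/measurable_EFinP; case: hf. Qed.

Let f0 x : 0 <= (f x)%:E.
Proof. by rewrite lee_fin; case: hf. Qed.

Let dens0 : dens hf set0 = 0. Proof. exact: integral_set0. Qed.

Let dens_ge0 A : 0 <= dens hf A. Proof. by apply: integral_ge0 => x _; exact: f0. Qed.

Let dens_sigma_additive : semi_sigma_additive (dens hf).
Proof. exact: semi_sigma_additive_nng_induced mf f0. Qed.

HB.instance Definition _ := isMeasure.Build _ _ _ (dens hf)
  dens0 dens_ge0 dens_sigma_additive.

Let densT : dens hf setT = 1. Proof. by case: hf. Qed.

HB.instance Definition _ := Measure_isProbability.Build _ _ _ (dens hf) densT.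

Lemma dens_null A : measurable A -> lam A = 0 -> dens hf A = 0.
Proof. by move=> mA A0; apply: null_set_integral => //; exact: measurable_funTS. Qed.

End density_measure.

(** * Measurability of degrees and vertex counts on tuples *)

Section measurable_bool.
Context {dO : measure_display} {Om : measurableType dO}.
Implicit Types p q : Om -> bool.

Definition mbool p := measurable [set w | p w].

Lemma eq_mbool p q : p =1 q -> mbool p -> mbool q.
Proof. by move=> pq; rewrite (funext pq). Qed.

Lemma mboolN p : mbool p -> mbool (fun w => ~~ p w).
Proof.
move=> mp; rewrite /mbool (_ : [set w | _] = ~` [set w | p w]); first exact: measurableC.
by apply/seteqP; split=> w /= /negP.
Qed.

Lemma mboolA p q : mbool p -> mbool q -> mbool (fun w => p w && q w).
Proof.
move=> mp mq; rewrite /mbool (_ : [set w | _] = [set w | p w] `&` [set w | q w]); first exact: measurableI.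
by apply/seteqP; split=> w /= /andP.
Qed.

Lemma mboolU p q : mbool p -> mbool q -> mbool (fun w => p w || q w).
Proof.
move=> mp mq; apply: (@eq_mbool (fun w => ~~ (~~ p w && ~~ q w))).
  by move=> w; rewrite negb_and !negbK.
by apply: mboolN; apply: mboolA; exact: mboolN.
Qed.

Lemma mbool_forall (I : finType) (p : I -> Om -> bool) : (forall i, mbool (p i)) ->
  mbool (fun w => [forall i, p i w]).
Proof.
move=> mp; rewrite /mbool (_ : [set w | _] = \big[setI/setT]_i [set w | p i w]).
  by apply: bigsetI_measurable => i _; exact: mp.
rewrite -bigcap_seq; apply/seteqP; split=> [w /= /forallP h i _|w h /=]; first exact: h.
by apply/forallP => i; apply: h; rewrite /= mem_index_enum.
Qed.

(** The set of true indices has finitely many possible values [S], and its being a given [S] is a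
    finite conjunction. *)
Lemma mbool_card (I : finType) (p : I -> Om -> bool) (Q : nat -> bool) :
  (forall i, mbool (p i)) -> mbool (fun w => Q #|[set i | p i w]%SET|).
Proof.
move=> mp.
apply: (@eq_mbool (fun w => ~~ [forall S : {set I}, (Q #|S|) ==> ~~ [forall i, p i w == (i \in S)]])).
  move=> w; rewrite negb_forall; apply/existsP/idP => [[S]|h].
    rewrite negb_imply negbK => /andP[QS /forallP hS].
    by rewrite (_ : [set i | p i w]%SET = S)//; apply/setP => i; rewrite inE (eqP (hS i)).
  exists [set i | p i w]%SET; rewrite negb_imply h negbK/=.
  by apply/forallP => i; rewrite inE.
apply: mboolN; apply: mbool_forall => S; case: (Q #|S|) => /=; last first.
  by rewrite /mbool (_ : [set w | _] = setT)//; apply/seteqP; split.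
apply: mboolN; apply: mbool_forall => i; case: (i \in S).
  by apply: eq_mbool (mp i) => w; rewrite eqb_id.
by apply: eq_mbool (mboolN (mp i)) => w; rewrite eqbF_neg.
Qed.

Lemma mbool_fun {R : realType} p : mbool p -> measurable_fun setT (fun w => (p w)%:R : R).
Proof.
move=> mp; rewrite (_ : (fun w => _) = \1_[set w | p w]); first exact: measurable_indic.
by apply/funext => w; rewrite indicE; case: (boolP (p w)) => pw; [rewrite mem_set|rewrite memNset//; exact/negP].
Qed.

End measurable_bool.

Section measurable_degree.
Context {R : realType} {d : nat} (k : nat).
Local Notation pt := (d.-tuple R).

Section tuples.
Variable n : nat.
Implicit Types (u : n.-tuple pt) (a b c : 'I_n).

(** Selects the last index of each value: counts over [undup u], whose length varies, become counts
    over fixed indices. *)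
Definition kept u a := [forall b, (tnth u b == tnth u a) ==> (b <= a)%N].

Lemma count_undup_tuple (P : pred pt) u :
  count P (undup u) = #|[set a | kept u a && P (tnth u a)]%SET|.
Proof.
rewrite -size_filter cardE -(size_map (tnth u)); apply/perm_size/uniq_perm.
- by apply: filter_uniq; exact: undup_uniq.
- rewrite map_inj_in_uniq ?enum_uniq// => a b.
  rewrite !mem_enum !inE => /andP[/forallP ka _] /andP[/forallP kb _] e.
  apply: val_inj; apply/eqP; rewrite eqn_leq.
  by have := ka b; have := kb a; rewrite e eqxx/= => -> ->.
- move=> z; rewrite mem_filter mem_undup; apply/andP/mapP => [[Pz /tnthP[a0 za0]]|[a]].
    have [a /eqP aP amax] := @arg_maxnP _ a0 (fun a => tnth u a == z) (@nat_of_ord n) (introT eqP (esym za0)).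
    exists a => //; rewrite mem_enum inE aP Pz andbT; apply/forallP => b.
    by apply/implyP; rewrite aP; exact: amax.
  by rewrite mem_enum inE => /andP[_ Pa] ->; split => //; exact: mem_tnth.
Qed.

Lemma mbool_edist_lt (X Y X' Y' : n.-tuple pt -> pt) :
  measurable_fun setT X -> measurable_fun setT Y ->
  measurable_fun setT X' -> measurable_fun setT Y' ->
  mbool (fun u => edist (X u) (Y u) < edist (X' u) (Y' u)).
Proof.
move=> mX mY mX' mY'.
have := measurable_fun_ltr (measurable_edist mX mY) (measurable_edist mX' mY').
move=> /(_ measurableT [set true]); rewrite setTI; apply.
exact: I.
Qed.

Lemma mbool_eq_tnth a b : mbool (fun u => tnth u a == tnth u b).
Proof.
apply: (@eq_mbool _ _ (fun u => ~~ (edist (tnth u a) (tnth u a) < edist (tnth u a) (tnth u b)))).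
  move=> u; rewrite edistxx -leNgt; apply/idP/eqP => [h|->]; last by rewrite edistxx.
  by apply: edist_eq0; apply/eqP; rewrite eq_le h edist_ge0.
by apply: mboolN; apply: mbool_edist_lt; exact: measurable_tnth.
Qed.

Lemma mbool_kept a : mbool (fun u => kept u a).
Proof.
apply: mbool_forall => b; case: (b <= a)%N.
  by rewrite /mbool (_ : [set w | _] = setT)//; apply/seteqP; split => // u _ /=; rewrite implybT.
by apply: eq_mbool (mboolN (mbool_eq_tnth b a)) => u; rewrite implybF.
Qed.

Lemma mbool_edgeb a b : mbool (fun u => edgeb k (undup u) (tnth u a) (tnth u b)).
Proof.
have h a' b' : mbool (fun u => knnb k (undup u) (tnth u a') (tnth u b')).
  apply: mboolA; first by apply: mboolN; exact: mbool_eq_tnth.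
  apply: (@eq_mbool _ _ (fun u => (#|[set c | kept u c && ((tnth u c != tnth u a') &&
     (edist (tnth u a') (tnth u c) < edist (tnth u a') (tnth u b'))%R)]%SET| < k)%N)).
    by move=> u; rewrite /closer count_undup_tuple.
  apply: (@mbool_card _ _ _ (fun c u => kept u c && ((tnth u c != tnth u a') &&
     (edist (tnth u a') (tnth u c) < edist (tnth u a') (tnth u b'))%R)) (fun m => m < k)%N) => c.
  apply: mboolA; first exact: mbool_kept.
  apply: mboolA; first by apply: mboolN; exact: mbool_eq_tnth.
  by apply: mbool_edist_lt; exact: measurable_tnth.
by apply: mboolU.
Qed.

Lemma mbool_deg a l : mbool (fun u => deg k (undup u) (tnth u a) == l).
Proof.
apply: (@eq_mbool _ _ (fun u => #|[set b | kept u b && edgeb k (undup u) (tnth u a) (tnth u b)]%SET| == l)).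
  by move=> u; rewrite /deg count_undup_tuple.
apply: (@mbool_card _ _ _ (fun b u => kept u b && edgeb k (undup u) (tnth u a) (tnth u b)) (eq_op^~ l)) => b.
by apply: mboolA; [exact: mbool_kept|exact: mbool_edgeb].
Qed.

Lemma knn_deg_is_undup u a l :
  knn_deg_is k [set z | z \in tval u] (tnth u a) l <-> deg k (undup u) (tnth u a) = l.
Proof.
have -> : [set z | z \in tval u] = [set z | z \in undup u].
  by apply/seteqP; split => z /=; rewrite mem_undup.
by apply: knn_deg_isE; [exact: undup_uniq|rewrite mem_undup mem_tnth].
Qed.

Lemma measurable_knn_deg a l :
  measurable [set u : n.-tuple pt | knn_deg_is k [set z | z \in tval u] (tnth u a) l].
Proof.
rewrite (_ : [set u | _] = [set u : n.-tuple pt | deg k (undup u) (tnth u a) == l]); first exact: mbool_deg.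
by apply/seteqP; split=> u /= => [/knn_deg_is_undup/eqP|/eqP/knn_deg_is_undup].
Qed.

Lemma measurable_V_count l : measurable_fun setT (fun u : n.-tuple pt => (V_count k l u)%:R : R).
Proof.
rewrite (_ : (fun u => _) = (fun u => \sum_(a < n) (kept u a && (deg k (undup u) (tnth u a) == l))%:R)).
  by apply: measurable_sum => a; apply: mbool_fun; apply: mboolA; [exact: mbool_kept|exact: mbool_deg].
apply/funext => u; rewrite V_countE /Vdeg count_undup_tuple -sum1_card natr_sum big_mkcond/=.
by apply: eq_bigr => a _; rewrite inE; case: ifP.
Qed.

Definition gpb u := [forall a, [forall b, (a != b) ==> (tnth u a != tnth u b)]] &&
   [forall a, forall b, forall c, (tnth u b != tnth u c) ==>
     (edist (tnth u a) (tnth u b) < edist (tnth u a) (tnth u c)) ||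
     (edist (tnth u a) (tnth u c) < edist (tnth u a) (tnth u b))].

Lemma gp_tnth u : gp u <-> gpb u.
Proof.
split=> [[/tuple_uniqP ui h]|/andP[/forallP h1 /forallP h2]].
  apply/andP; split; apply/forallP => a; apply/forallP => b.
    by apply/implyP; apply: contraNN => /eqP/ui ->.
  apply/forallP => c; apply/implyP => bc; rewrite -neq_lt; apply: contraNneq bc => e.
  by apply/eqP; apply: h e; exact: mem_tnth.
split.
  apply/tuple_uniqP => a b e; apply/eqP/negPn/negP => ab.
  by have /forallP/(_ b) := h1 a; rewrite ab e eqxx.
move=> x y z /tnthP[a ->] /tnthP[b ->] /tnthP[c ->] e; apply/eqP/negPn/negP => bc.
by have /forallP/(_ b)/forallP/(_ c) := h2 a; rewrite bc/= e ltxx.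
Qed.

Lemma measurable_gp : measurable [set u : n.-tuple pt | gp u].
Proof.
rewrite (_ : [set u | _] = [set u : n.-tuple pt | gpb u]); last first.
  by apply/seteqP; split=> u /= /gp_tnth.
have : mbool gpb; last by [].
apply: mboolA; apply: mbool_forall => a; apply: mbool_forall => b.
  case: (a != b) => /=; first by apply: mboolN; exact: mbool_eq_tnth.
  by rewrite /mbool (_ : [set w | _] = setT)//; apply/seteqP; split.
apply: mbool_forall => c; apply: (@eq_mbool _ _ (fun u => ~~ (tnth u b != tnth u c) ||
     ((edist (tnth u a) (tnth u b) < edist (tnth u a) (tnth u c)) ||
     (edist (tnth u a) (tnth u c) < edist (tnth u a) (tnth u b))))).
  by move=> u; rewrite implybE.
apply: mboolU; first by do 2 apply: mboolN; exact: mbool_eq_tnth.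
by apply: mboolU; apply: mbool_edist_lt; exact: measurable_tnth.
Qed.

End tuples.

End measurable_degree.

(** * Samples are almost surely in general position *)

Lemma ae_all_seq {dO} {Om : measurableType dO} {R : realType} (mu : {measure set Om -> \bar R})
  (I : eqType) (s : seq I) (P : I -> Om -> Prop) :
  (forall i, i \in s -> {ae mu, forall x, P i x}) -> {ae mu, forall x, forall i, i \in s -> P i x}.
Proof.
elim: s => [|i s IH] h; first exact: aeW.
have h1 := h i (mem_head _ _).
have h2 : {ae mu, forall x, forall j, j \in s -> P j x}.
  by apply: IH => j js; apply: h; rewrite inE js orbT.
by apply: filterS2 h1 h2 => x Px Ps j; rewrite inE => /predU1P[->|/Ps].
Qed.

Lemma measurable_tprod_section {dT} {T : measurableType dT} {R : realType} (mu : probability T R)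
  n (B : set (n.+1.-tuple T)) : measurable B ->
  measurable_fun setT (fun y : n.-tuple T => mu [set x | B (tcons (x, y))]).
Proof.
move=> mB; have mA : measurable (@tcons _ T n @^-1` B).
  by rewrite -[X in measurable X]setTI; exact: measurable_tcons.
have := measurable_fun_ysection mu mA; congr (measurable_fun _ _).
apply/funext => y /=; congr (mu _).
by apply/seteqP; split=> x /=; rewrite /ysection/= inE.
Qed.

Section general_position.
Context {R : realType} {d : nat} (d0 : (0 < d)%N).
Local Notation pt := (d.-tuple R).
Variables (lam : {measure set pt -> \bar R}) (hlam : is_lebesgue_d lam)
  (f : pt -> R) (hf : good_density lam f).
Let mu : probability pt R := [the probability _ _ of dens hf].

(** The new point has to avoid the spheres about [p] through [q] and the bisectors of distinct [p]
    and [q], for [p], [q] in the finite list; all are null. The spheres with [p = q] exclude [p]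
    itself. *)
Lemma ae_gp_cons n (y : n.-tuple pt) : gp y -> {ae mu, forall x, gp (x :: y)}.
Proof.
move=> [uy hy].
have sph (p : pt) r : {ae mu, forall x, edist x p <> r}.
  exists [set x | edist x p = r]; split; first exact: measurable_sphere.
    by apply: dens_null; [exact: measurable_sphere|exact: lam_sphere].
  by move=> x /= /contrapT.
have bis (p q : pt) : p <> q -> {ae mu, forall x, edist x p <> edist x q}.
  move=> pq; exists [set x | edist x p = edist x q]; split; first exact: measurable_bisector.
    by apply: dens_null; [exact: measurable_bisector|exact: lam_bisector].
  by move=> x /= /contrapT.
have A1 : {ae mu, forall x, forall pq : pt * pt, pq \in [seq (p, q) | p <- y, q <- y] ->
    edist x pq.1 <> edist pq.1 pq.2}.
  by apply: ae_all_seq => pq _; exact: sph.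
have A2 : {ae mu, forall x, forall pq : pt * pt, pq \in [seq (p, q) | p <- y, q <- y] ->
    pq.1 <> pq.2 -> edist x pq.1 <> edist x pq.2}.
  apply: ae_all_seq => -[p q] _ /=; have [->|/eqP pq] := eqVneq p q; first exact: aeW.
  by apply: filterS (bis _ _ pq) => x h _.
apply: filterS2 A1 A2 => x A1 A2.
have B1 p q : p \in tval y -> q \in tval y -> edist x p <> edist p q.
  by move=> py qy; have := A1 (p, q); apply; exact: allpairs_f.
have B2 p q : p \in tval y -> q \in tval y -> edist x p = edist x q -> p = q.
  move=> py qy e; apply: contrapT => pq.
  by have := A2 (p, q); apply => //; exact: allpairs_f.
have xy : x \notin tval y.
  by apply/negP => xy; apply: (B1 x x); rewrite ?edistxx.
split; first by rewrite /= xy.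
move=> a b c; rewrite !inE.
case/predU1P => [->|ay]; case/predU1P => [->|by_]; case/predU1P => [->|cy] //.
- by rewrite edistxx => /esym/edist_eq0.
- by rewrite edistxx => /edist_eq0 ->.
- exact: B2.
- by rewrite edistC => /(B1 _ _ ay cy).
- by move=> /esym; rewrite edistC => /(B1 _ _ ay by_).
- exact: hy.
Qed.

Lemma tprod_not_gp n : tprod mu n (~` [set u : n.-tuple pt | gp u]) = 0%E.
Proof.
elim: n => [|n IH].
  by rewrite (_ : ~` _ = set0) ?measure0//; apply/seteqP; split=> // u /= []; rewrite (tuple0 u); split.
have mg m : measurable (~` [set u : m.-tuple pt | gp u]) by apply: measurableC; exact: measurable_gp.
rewrite tprodS_swap// (ge0_negligible_integral (mg n) measurableT)//; last first.
  exact: measurable_tprod_section.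
apply: integral0_eq => y; rewrite setTD setCK => gy.
have mx : measurable [set x | (~` [set u : n.+1.-tuple pt | gp u]) (tcons (x, y))].
  rewrite -[X in measurable X]setTI.
  exact: (@measurable_tcons1 _ _ n y measurableT _ (mg n.+1)).
by apply/negligibleP => //; have := ae_gp_cons gy; apply: negligibleS => x /=.
Qed.

End general_position.

(** * Occupancy probabilities for [n] independent points *)

Section occupancy.
Context {dT} {T : measurableType dT} {R : realType} (mu : probability T R) {C : finType}.
Variables (D : C -> set T) (mD : forall c, measurable (D c)).
Hypothesis dD : forall c c' x, D c x -> D c' x -> c = c'.

Definition occI n (A : {set C}) : set (n.-tuple T) :=
  [set y | forall c, count (fun z => `[< D c z >]) y = (c \in A) :> nat].

Let m c : R := fine (mu (D c)).
Let q : R := 1 - \sum_c m c.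
Let E0 := ~` \bigcup_c D c.

Let mE c : mu (D c) = (m c)%:E.
Proof. by rewrite fineK// fin_num_measure. Qed.

Let mE0 : measurable E0.
Proof. by apply: measurableC; apply: fin_bigcup_measurable => // c _; exact: mD. Qed.

Lemma measurable_occI n A : measurable (@occI n A).
Proof.
rewrite (_ : occI A = [set y : n.-tuple T | [forall c, #|[set i | `[< D c (tnth y i) >]]%SET| == (c \in A)]]).
  have : mbool (fun y : n.-tuple T => [forall c, #|[set i | `[< D c (tnth y i) >]]%SET| == (c \in A)]); last by [].
  apply: mbool_forall => c.
  apply: (@mbool_card _ _ _ (fun i (y : n.-tuple T) => `[< D c (tnth y i) >]) (fun j => j == (c \in A))) => i.
  rewrite /mbool (_ : [set y | _] = (fun y : n.-tuple T => tnth y i) @^-1` D c).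
    by rewrite -[X in measurable X]setTI; exact: measurable_tnth.
  by apply/seteqP; split=> y /= /asboolP.
have cE c (y : n.-tuple T) : count (fun z => `[< D c z >]) y = #|[set i | `[< D c (tnth y i) >]]%SET|.
  by rewrite -sum1_count big_tuple -sum1_card; apply: eq_bigl => i; rewrite inE.
apply/seteqP; split=> y /= => [h|/forallP h c]; last by rewrite cE (eqP (h c)).
by apply/forallP => c; rewrite -cE h.
Qed.

Let integral_cells (k0 : R) (kc : C -> R) : 0 <= k0 -> (forall c, 0 <= kc c) ->
  (\int[mu]_x (k0 * \1_E0 x + \sum_c kc c * \1_(D c) x)%:E =
   k0%:E * mu E0 + (\sum_c kc c * m c)%:E)%E.
Proof.
move=> k00 kc0.
under eq_integral do rewrite EFinD -sumEFin.
rewrite ge0_integralD//; last 4 first.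
- by move=> x _; rewrite lee_fin mulr_ge0.
- by apply/measurable_EFinP; apply: measurable_funM => //; exact: measurable_indic.
- by move=> x _; apply: sume_ge0 => c _; rewrite lee_fin mulr_ge0.
- by apply: emeasurable_sum => c; apply/measurable_EFinP; apply: measurable_funM => //; exact: measurable_indic.
congr (_ + _)%E.
  under eq_integral do rewrite EFinM.
  rewrite ge0_integralZl_EFin//; last by apply/measurable_EFinP; exact: measurable_indic.
  by rewrite integral_indic// setIT.
rewrite ge0_integral_sum//; last 2 first.
- by move=> c; apply/measurable_EFinP; apply: measurable_funM => //; exact: measurable_indic.
- by move=> c x _; rewrite lee_fin mulr_ge0.
rewrite -sumEFin; apply: eq_bigr => c _.
under eq_integral do rewrite EFinM.
rewrite ge0_integralZl_EFin//; last by apply/measurable_EFinP; exact: measurable_indic.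
by rewrite integral_indic// setIT EFinM; congr (_ * _)%E; exact: mE.
Qed.

Let cells_case (k0 : R) (kc : C -> R) x : (E0 x /\ k0 * \1_E0 x + \sum_c kc c * \1_(D c) x = k0) \/
  exists c, D c x /\ k0 * \1_E0 x + \sum_c kc c * \1_(D c) x = kc c.
Proof.
have [[c _ Dc]|nD] := pselect ((\bigcup_c D c) x); [right|left].
  exists c; split => //; rewrite indicE memNset ?mulr0 ?add0r; last by case; exists c.
  rewrite (bigD1 c)//= indicE mem_set// mulr1 big1 ?addr0// => c' c'c.
  rewrite indicE memNset ?mulr0// => /dD/(_ Dc) e.
  by rewrite e eqxx in c'c.
split=> //; rewrite indicE mem_set// mulr1 big1 ?addr0// => c _.
by rewrite indicE memNset ?mulr0// => Dc; apply: nD; exists c.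
Qed.

Let muE0 : mu E0 = q%:E.
Proof.
have h := @integral_cells 1 (fun=> 1) ler01 (fun=> ler01).
have : (\int[mu]_x (1%:E : \bar R) = mu E0 + (\sum_c m c)%:E)%E.
  rewrite -[X in (X + _)%E]mul1e -[X in (_ = _ + X)%E](_ : (\sum_c 1 * m c)%:E = _)%E; last first.
    by congr (_ %:E); apply: eq_bigr => c _; rewrite mul1r.
  rewrite -h; apply: eq_integral => x _; congr (_ %:E).
  by have [[_ ->]|[c [_ ->]]] := @cells_case 1 (fun=> 1) x.
have -> : (\int[mu]_x (1%:E : \bar R) = 1)%E.
  by rewrite integral_cst// mul1e; exact: probability_setT.
by rewrite /q EFinB => ->; rewrite addeK.
Qed.

(** [n ^_ #|A|] ways of assigning sample points to the cells of [A], the masses of these cells, and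
    all other points outside every cell. *)
Definition occp n (A : {set C}) : R :=
  (n ^_ #|A|)%:R * (\prod_(c in A) m c) * q ^+ (n - #|A|).

(** Conditioning on the first point: it falls outside all cells, or into a cell [c] of [A], which
    leaves [A :\ c] for the others. *)
Lemma occpS n A : occp n.+1 A = q * occp n A + \sum_(c in A) m c * occp n (A :\ c).
Proof.
have [->|[c0 c0A]] := set_0Vmem A.
  by rewrite big_set0 addr0 /occp cards0 !big_set0 !ffactn0 !mul1r !subn0 exprS.
have cA c : c \in A -> #|A :\ c| = #|A|.-1 by move=> h; rewrite (cardsD1 c A) h.
rewrite (eq_bigr (fun c => (n ^_ #|A|.-1)%:R * (\prod_(c in A) m c) * q ^+ (n - #|A|.-1))); last first.
  move=> c h; rewrite /occp (cA _ h) (big_setD1 c h)/=; ring.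
rewrite sumr_const /occp; have := cA _ c0A; set a := #|A|.
have : (0 < a)%N by rewrite card_gt0; apply/set0Pn; exists c0.
case: a => // a _ _ /=; set P := \prod_(_ in _) _.
have [an|na] := leqP a n; last first.
  by rewrite !ffact_small ?mul0r ?mulr0 ?mul0rn ?addr0//; lia.
rewrite subSS ffactSS ffactnSr !natrM natrB//.
(* At [a = n] the subtraction [n - a.+1] is truncated, so the exponents do not follow the general
   pattern. *)
have [e|lt] := eqVneq a n.
  by rewrite e subrr mulr0 !mul0r mulr0 add0r subnn expr0 !mulr1 -mulr_natl; ring.
have ltn : (a < n)%N by rewrite ltn_neqAle lt an.
have -> : (n - a = (n - a.+1).+1)%N by lia.
by rewrite exprS -mulr_natl -!natr1; ring.
Qed.

Lemma tprod_occI n A : tprod mu n (@occI n A) = (occp n A)%:E.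
Proof.
elim: n A => [|n IH] A.
  rewrite /= diracE /occp; have [->|[c cA]] := set_0Vmem A.
    rewrite cards0 ffactn0 big_set0 mul1r expr0 mulr1 mem_set// => c.
    by rewrite inE.
  rewrite memNset; last by move=> /(_ c); rewrite cA.
  rewrite ffact_small ?mul0r//; rewrite card_gt0; apply/set0Pn; by exists c.
have occp0 B : 0 <= occp n B by rewrite -lee_fin -IH.
rewrite tprodS; last exact: measurable_occI.
(* As a function of the first point, the conditional probability is constant on each cell and
   outside all of them. *)
transitivity (\int[mu]_x (occp n A * \1_E0 x + \sum_c (if c \in A then occp n (A :\ c) else 0) * \1_(D c) x)%:E)%E.
  apply: eq_integral => x _.
  have [[E0x ->]|[c [Dc ->]]] := @cells_case (occp n A) (fun c => if c \in A then occp n (A :\ c) else 0) x.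
    rewrite -IH; congr (tprod mu n _); apply/seteqP; split=> y /= h c; have := h c => /=.
      by rewrite asboolF// => Dc; apply: E0x; exists c.
    by rewrite /= asboolF// => Dc; apply: E0x; exists c.
  have hE c' (y : n.-tuple T) : (`[< D c' x >] + count (fun z => `[< D c' z >]) y =
      (c' == c) + count (fun z => `[< D c' z >]) y)%N.
    congr addn; have [->|c'c] := eqVneq c' c; first by rewrite asboolT.
    by rewrite asboolF// => /dD/(_ Dc) e; rewrite e eqxx in c'c.
  case: ifP => cA.
    rewrite -IH; congr (tprod mu n _); apply/seteqP; split=> y /= h c'; have := h c';
      rewrite /= hE !inE; have [->|c'c] := eqVneq c' c; rewrite ?cA/=; lia.
  rewrite (_ : [set y | _] = set0) ?measure0//; apply/seteqP; split=> // y /= /(_ c).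
  by rewrite /= hE eqxx cA.
rewrite integral_cells//; last by move=> c; case: ifP.
rewrite muE0 -EFinM -EFinD occpS; congr (_ %:E); congr (_ + _); first by rewrite mulrC.
rewrite [RHS]big_mkcond/=; apply: eq_bigr => c _; case: ifP => _; by rewrite ?mul0r// mulrC.
Qed.

End occupancy.

(** * Binomial occupancy probabilities tend to Poisson weights *)

Section poisson_limit.
Context {R : realType}.

Lemma cvg_invn : (fun n : nat => n%:R^-1 : R) @ \oo --> (0 : R).
Proof. by rewrite -cvg_shiftS; exact: cvg_harmonic. Qed.

Lemma cvg_ffact_ratio j : (fun n => (n ^_ j)%:R / n%:R ^+ j : R) @ \oo --> (1 : R).
Proof.
elim: j => [|j IH].
  by under eq_fun do rewrite ffactn0 expr0 divr1; exact: cvg_cst.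
have h : (fun n => (n ^_ j)%:R / n%:R ^+ j * (1 - j%:R * n%:R^-1) : R) @ \oo --> (1 * (1 - j%:R * 0) : R).
  apply: cvgM => //; apply: cvgB; first exact: cvg_cst.
  apply: cvgM; first exact: cvg_cst.
  exact: cvg_invn.
rewrite mulr0 subr0 mulr1 in h; apply: cvg_trans h; apply: near_eq_cvg; near=> n.
have jn : (j < n)%N by near: n; exact: nbhs_infty_gt.
have n0 : n%:R != 0 :> R by rewrite pnatr_eq0; lia.
rewrite ffactnSr natrM natrB 1?ltnW// exprS; field; rewrite n0 expf_neq0//.
Unshelve. all: by end_near. Qed.

(** Squeezed by [1 - s <= exp(-s)] above and [1 - s >= exp(-s / (1 - s))] below; the shift [j] of
    the exponent disappears because [s n] tends to 0. *)
Lemma cvg_pow_exp (s : nat -> R) (a : R) j : (forall n, 0 <= s n) ->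
  (fun n => n%:R * s n) @ \oo --> a ->
  (fun n => (1 - s n) ^+ (n - j)) @ \oo --> expR (- a).
Proof.
move=> s0 sa.
have sc : s @ \oo --> (0 : R).
  have : (fun n => (n%:R * s n) * n%:R^-1) @ \oo --> a * 0.
    apply: cvgM => //; exact: cvg_invn.
  rewrite mulr0; apply: cvg_trans; apply: near_eq_cvg; near=> n.
  have n0 : n%:R != 0 :> R by rewrite pnatr_eq0 -lt0n; near: n; exact: nbhs_infty_gt.
  by rewrite mulrAC mulfV// mul1r.
have lo : (fun n => expR (- (n%:R * s n * (1 - s n)^-1))) @ \oo --> expR (- a).
  have h : (fun n => - (n%:R * s n * (1 - s n)^-1)) @ \oo --> - (a * (1 - 0)^-1).
    apply: cvgN; apply: cvgM => //; apply: cvgV; first by rewrite subr0 oner_eq0.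
    by apply: cvgB => //; exact: cvg_cst.
  rewrite subr0 invr1 mulr1 in h; exact: (cvg_comp _ _ h (@continuous_expR R (- a))).
have hi : (fun n => expR (- (n%:R * s n - j%:R * s n))) @ \oo --> expR (- a).
  have h : (fun n => - (n%:R * s n - j%:R * s n)) @ \oo --> - (a - j%:R * 0).
    by apply: cvgN; apply: cvgB => //; apply: cvgM => //; exact: cvg_cst.
  rewrite mulr0 subr0 in h; exact: (cvg_comp _ _ h (@continuous_expR R (- a))).
apply: squeeze_cvgr lo hi; near=> n.
have s1 : s n < 1 / 2.
  near: n; move/cvgrPdist_lt : sc => /(_ (1 / 2)) h; have := h ltac:(lra); apply: filterS => n.
  by rewrite sub0r normrN ger0_norm.
have jn : (j <= n)%N by near: n; exact: nbhs_infty_ge.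
have p : 0 < 1 - s n by lra.
apply/andP; split.
  apply: (@le_trans _ _ ((1 - s n) ^+ n)).
    have -> : n%:R * s n * (1 - s n)^-1 = (s n * (1 - s n)^-1) * n%:R by ring.
    rewrite -mulNr expRM_natr; apply: lerXn2r; rewrite ?nnegrE ?expR_ge0 ?(ltW p)//.
    rewrite expRN invf_ple ?posrE ?expR_gt0//.
    apply: le_trans (expR_ge1Dx _); rewrite le_eqVlt; apply/orP; left; apply/eqP.
    by field; rewrite gt_eqF.
  by apply: ler_wiXn2l; rewrite ?leq_subr ?(ltW p)//; have := s0 n; lra.
rewrite -mulrBl -natrB// mulrC -mulNr expRM_natr; apply: lerXn2r; rewrite ?nnegrE ?expR_ge0 ?(ltW p)//.
exact: expR_ge1Dx.
Unshelve. all: by end_near. Qed.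

(** Each of the [#|A|] cell masses takes one factor [n] from the falling factorial. *)
Lemma cvg_occ_weight (C : finType) (m : nat -> C -> R) (v : R) (A : {set C}) :
  (forall n c, 0 <= m n c) -> (forall c, (fun n => n%:R * m n c) @ \oo --> v) ->
  (fun n => (n ^_ #|A|)%:R * (\prod_(c in A) m n c) * (1 - \sum_c m n c) ^+ (n - #|A|)) @ \oo
    --> (weight v A : R).
Proof.
move=> m0 mv.
have c1 : (fun n => \prod_(c in A) (n%:R * m n c)) @ \oo --> (v ^+ #|A| : R).
  rewrite -prodr_const.
  have h (r : seq C) (P : pred C) : (fun n => \prod_(c <- r | P c) (n%:R * m n c)) @ \oo --> \prod_(c <- r | P c) v.
    elim: r => [|c r IH]; first by rewrite big_nil; under eq_fun do rewrite big_nil; exact: cvg_cst.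
    by rewrite big_cons; under eq_fun do rewrite big_cons; case: (P c) => //; exact: cvgM.
  exact: h.
have c2 : (fun n => (1 - \sum_c m n c) ^+ (n - #|A|)) @ \oo --> expR (- (v * #|C|%:R)).
  apply: (@cvg_pow_exp (fun n => \sum_c m n c)); first by move=> n; exact: sumr_ge0.
  under eq_fun do rewrite mulr_sumr.
  rewrite mulr_natr -sumr_const; exact: (cvg_sumr (f := fun n c => n%:R * m n c)).
have h : (fun n => (n ^_ #|A|)%:R / n%:R ^+ #|A| * (\prod_(c in A) (n%:R * m n c)) *
    (1 - \sum_c m n c) ^+ (n - #|A|)) @ \oo --> 1 * v ^+ #|A| * expR (- (v * #|C|%:R)).
  by apply: cvgM => //; apply: cvgM => //; exact: cvg_ffact_ratio.
rewrite mul1r in h; apply: cvg_trans h; apply: near_eq_cvg; near=> n.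
have n0 : n%:R != 0 :> R by rewrite pnatr_eq0 -lt0n; near: n; exact: nbhs_infty_gt.
congr (_ * _); rewrite big_split/= prodr_const.
by rewrite mulrA divfK// expf_neq0.
Unshelve. all: by end_near. Qed.

End poisson_limit.

(** * Probability bounds from disjoint events *)

Lemma integral_cst_probability {dO} {Om : measurableType dO} {R : realType}
  (P : probability Om R) (r : R) : (\int[P]_w r%:E = r%:E)%E.
Proof. by rewrite integral_cst// -[RHS]mule1; congr (_ * _)%E; exact: probability_setT. Qed.

Section sums_of_measures.
Context {dO} {Om : measurableType dO} {R : realType} (P : probability Om R).
Context {I : finType} (p : pred I) (B : I -> set Om) (E : set Om).
Hypotheses (mB : forall i, measurable (B i)) (mE : measurable E).

Let sumE : (\sum_(i | p i) P (B i) = \int[P]_w (\sum_(i | p i) \1_(B i) w)%:E)%E.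
Proof.
under eq_integral do rewrite -sumEFin big_mkcond/=.
rewrite ge0_integral_sum//; last 2 first.
- by move=> i; case: (p i) => //; apply/measurable_EFinP; exact: measurable_indic.
- by move=> i w _; case: (p i) => //; rewrite lee_fin.
rewrite big_mkcond/=; apply: eq_bigr => i _; case: (p i).
  by rewrite integral_indic// setIT.
by rewrite integral0.
Qed.

Let PE : (P E = \int[P]_w (\1_E w)%:E)%E.
Proof. by rewrite integral_indic// setIT. Qed.

Let mS : measurable_fun [set: Om] (fun w => (\sum_(i | p i) \1_(B i) w)%:E : \bar R).
Proof.
apply/measurable_EFinP; under eq_fun do rewrite big_mkcond/=.
by apply: measurable_sum => i; case: (p i) => //; exact: measurable_indic.
Qed.

Lemma sum_measure_le : (forall i j w, B i w -> B j w -> i = j) ->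
  (forall i, p i -> B i `<=` E) -> (\sum_(i | p i) P (B i) <= P E)%E.
Proof.
move=> dB BE; rewrite sumE PE; apply: ge0_le_integral => //.
- by move=> w _; rewrite lee_fin sumr_ge0.
- by apply/measurable_EFinP; exact: measurable_indic.
move=> w _; rewrite lee_fin.
have [[i [pi Bi]]|nB] := pselect (exists i, p i /\ B i w).
  rewrite (bigD1 i)//= big1 ?addr0; last first.
    move=> j /andP[_ ji]; rewrite indicE memNset// => /dB/(_ Bi) e; by rewrite e eqxx in ji.
  by rewrite !indicE !mem_set//; exact: (BE i).
rewrite big1// => i pi; rewrite indicE memNset// => Bi; by apply: nB; exists i.
Qed.

Lemma sum_measure_ge : (forall w, E w -> exists2 i, p i & B i w) ->
  (P E <= \sum_(i | p i) P (B i))%E.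
Proof.
move=> EB; rewrite sumE PE; apply: ge0_le_integral => //.
- by apply/measurable_EFinP; exact: measurable_indic.
move=> w _; rewrite lee_fin [leLHS]indicE.
have [Ew|nE] := pselect (E w); last by rewrite memNset// sumr_ge0.
have [i pi Bi] := EB w Ew; rewrite (mem_set Ew) (bigD1 i)//= indicE mem_set// lerDl.
exact: sumr_ge0.
Qed.

End sums_of_measures.

Lemma knn_deg_is_inj {R : realType} {d : nat} k (S : set (d.-tuple R)) x l l' :
  knn_deg_is k S x l -> knn_deg_is k S x l' -> l = l'.
Proof.
move=> [s [us <- hs]] [s' [us' <- hs']]; apply/perm_size/uniq_perm => // y.
by apply/idP/idP => [/hs/hs'|/hs'/hs].
Qed.

(** Good patterns of degree [l] are disjoint subevents of [E l], those of another degree disjoint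
    subevents of its complement. Stated for abstract [P], [B] and [E] to serve samples and the
    Poisson process alike. *)
Lemma degree_mass {dO} {Om : measurableType dO} {R : realType} {d : nat} (P : probability Om R)
    k M (B : {set cells (d := d) k M} -> set Om) (E : nat -> set Om) l :
  (forall A, measurable (B A)) -> (forall l', measurable (E l')) ->
  (forall A A' w, B A w -> B A' w -> A = A') -> (forall l1 l2 w, E l1 w -> E l2 w -> l1 = l2) ->
  (forall A, @good R d k M A -> B A `<=` E (@degA R d k M A)) ->
  \sum_(A | @good R d k M A && (@degA R d k M A == l)) fine (P (B A)) <= fine (P (E l)) <=
  1 - \sum_(A | @good R d k M A && (@degA R d k M A != l)) fine (P (B A)).
Proof.
move=> mB mE dB dE BE.
have fE : P (E l) \is a fin_num by apply: fin_num_measure; exact: mE.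
have sE (p : pred {set cells (d := d) k M}) :
    (\sum_(A | p A) fine (P (B A)))%:E = (\sum_(A | p A) P (B A))%E.
  rewrite -sumEFin; apply: eq_bigr => A _; rewrite fineK//; apply: fin_num_measure; exact: mB.
apply/andP; split.
  rewrite -lee_fin sE fineK//.
  by apply: sum_measure_le => // A /andP[gA /eqP <-]; exact: BE.
rewrite lerBrDl -lerBrDr -lee_fin EFinB sE fineK// -probability_setC//.
apply: sum_measure_le => //; first exact: measurableC.
by move=> A /andP[gA /eqP dA] w /(BE _ gA) h1 h2; apply: dA; exact: dE h1 h2.
Qed.

(** * Grids of integer cells and open sets *)

Section open_sets.
Context {R : realType} {d : nat}.
Local Notation pt := (d.-tuple R).

Definition gcell (j : nat) (z : {ffun 'I_d -> int}) : set pt :=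
  cube (fun i => (z i)%:~R / j.+1%:R) j.+1%:R^-1.

Lemma gcell_cover j (x : pt) : exists z, gcell j z x.
Proof.
have j0 : 0 < j.+1%:R :> R by [].
exists [ffun i => Num.floor (tnth x i * j.+1%:R)] => i; rewrite ffunE.
have := floor_itv (tnth x i * j.+1%:R); rewrite intrD => /andP[h1 h2].
rewrite ler_pdivrMr// h1/= -[X in _ + X]mul1r -mulrDl ltr_pdivlMr//.
Qed.

Lemma gcell_diam j z (x y : pt) : gcell j z x -> gcell j z y -> edist x y <= d%:R / j.+1%:R.
Proof.
move=> zx zy; apply: nrm_le => i; have /andP[] := zx i; have /andP[] := zy i.
move: (((z i)%:~R : R) / j.+1%:R) (j.+1%:R^-1 : R) => a b *.
by rewrite ler_norml; apply/andP; split; lra.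
Qed.

Lemma gcell_diam_small (e : R) : 0 < e -> exists j0, forall j, (j0 <= j)%N -> d%:R / j.+1%:R < e.
Proof.
move=> e0; exists (Num.truncn (d%:R / e)) => j jj.
rewrite ltr_pdivrMr// mulrC -ltr_pdivrMr//; apply: lt_le_trans (truncnS_gt _) _.
by rewrite ler_nat.
Qed.

Lemma measurable_gcell j z : measurable (gcell j z).
Proof. exact: measurable_cube. Qed.

Lemma measurable_count_bigcup {dO} {Om : measurableType dO} (I : countType) (F : I -> set Om) :
  (forall i, measurable (F i)) -> measurable (\bigcup_i F i).
Proof.
move=> mF.
rewrite (_ : \bigcup_i F i = \bigcup_n (if unpickle n is Some i then F i else set0)).
  by apply: bigcupT_measurable => n; case: unpickle.
apply/seteqP; split=> [w [i _ Fi]|w [n _]]; first by exists (pickle i) => //; rewrite pickleK.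
by case: unpickle => // i Fi; exists i.
Qed.

(** An open set is the countable union of the grid cells it contains, which are boxes of the product
    sigma-algebra. *)
Lemma open_pt_measurable (U : set pt) : open_pt U -> measurable U.
Proof.
move=> oU; rewrite (_ : U = \bigcup_(jz : nat * {ffun 'I_d -> int})
   (if `[< gcell jz.1 jz.2 `<=` U >] then gcell jz.1 jz.2 else set0)).
  apply: measurable_count_bigcup => jz; case: ifP => _ //; exact: measurable_gcell.
apply/seteqP; split=> [x Ux|x [jz _]]; last by case: ifPn => // /asboolP; exact.
have [e e0 eU] := oU x Ux; have [j0 jP] := gcell_diam_small e0.
have [z zx] := gcell_cover j0 x; exists (j0, z) => //=.
rewrite asboolT// => y zy; apply: eU; exact: le_lt_trans (gcell_diam zx zy) (jP _ (leqnn _)).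
Qed.

End open_sets.

(** * Limit law of the degree of a typical sample point *)

Section iid_limit.
Context {R : realType} {d : nat} (k : nat) (d0 : (0 < d)%N).
Local Notation pt := (d.-tuple R).
Variables (lam : {measure set pt -> \bar R}) (hlam : is_lebesgue_d lam)
  (f : pt -> R) (hf : good_density lam f).
Let mu : probability pt R := [the probability _ _ of dens hf].

Lemma cell_cube M (o : pt) h c : @cell R d k M o h c = cube (fun i => tnth o i + h * corner c i) h.
Proof.
by apply/seteqP; split=> z hz i; have /andP[a b] := hz i; apply/andP; split=> //; lra.
Qed.

Lemma measurable_cell M (o : pt) h c : measurable (@cell R d k M o h c).
Proof. by rewrite cell_cube; exact: measurable_cube. Qed.

Definition regular x := 0 < f x /\
  forall e : R, 0 < e -> exists2 del : R, 0 < del & forall y, edist x y < del -> `|f y - f x| < e.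

Let mf : measurable_fun setT f. Proof. by case: hf. Qed.
Let f0 x : 0 <= f x. Proof. by case: hf. Qed.

(** Around a point of an open piece, continuity on the piece is continuity on the whole space; the
    pieces miss only a null set, and [f = 0] has no mass. *)
Lemma ae_regular : {ae mu, forall x, regular x}.
Proof.
have [_ _ _ _ [r [U [oU _ lU cU]]]] := hf.
have mU : measurable (\bigcup_(i in `I_r) U i).
  by apply: fin_bigcup_measurable => // i ir; apply: open_pt_measurable; exact: oU.
have h1 : {ae mu, forall x, (\bigcup_(i in `I_r) U i) x}.
  exists (~` \bigcup_(i in `I_r) U i); split => //; first exact: measurableC.
  by apply: dens_null => //; exact: measurableC.
have h2 : {ae mu, forall x, f x <> 0}.
  have mZ : measurable [set x | f x = 0].
    by have := mf measurableT (measurable_set1 0); rewrite setTI.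
  exists [set x | f x = 0]; split => //; last by move=> x /= /contrapT.
  by apply: integral0_eq => x /= ->.
apply: filterS2 h1 h2 => x [i ir Ui] fx; split.
  by rewrite lt_neqAle f0 andbT eq_sym; apply/eqP.
move=> e e0; have [e1 e10 h1] := oU i ir x Ui; have [e2 e20 h2] := cU i ir x Ui e e0.
exists (Num.min e1 e2); first by rewrite lt_min e10.
by move=> y; rewrite lt_min => /andP[y1 y2]; apply: h2 => //; exact: h1.
Qed.

Section at_point.
Variables (x : pt) (rx : regular x).
Let fx : 0 < f x. Proof. by case: rx. Qed.

(** Normalized so that [n * f x * scale n ^ d = 1] for positive [n]. *)
Definition scale n : R := (n%:R * f x) `^ (- d%:R^-1).

Lemma scale_gt0 n : (0 < n)%N -> 0 < scale n.
Proof. by move=> n0; rewrite powR_gt0// mulr_gt0// ltr0n. Qed.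

Lemma scaleX n : (0 < n)%N -> scale n ^+ d = (n%:R * f x)^-1.
Proof.
move=> n0; have p : 0 < n%:R * f x by rewrite mulr_gt0// ltr0n.
rewrite -powR_mulrn ?ltW ?scale_gt0// /scale -powRrM mulNr mulVf ?pnatr_eq0 -?lt0n//.
by rewrite powR_inv1// ltW.
Qed.

(** The cell shrinks to [x], where [f] is continuous, so its mass is asymptotically [f x] times its
    volume. *)
Lemma cvg_cell_mass M (h : R) c : (0 < h) ->
  (fun n => n%:R * fine (mu (@cell R d k M x (h * scale n) c))) @ \oo --> h ^+ d.
Proof.
move=> h0; apply/cvgrPdist_le => e e0.
have hd0 : 0 < h ^+ d by rewrite exprn_gt0.
pose ep := e * f x / h ^+ d.
have ep0 : 0 < ep by rewrite divr_gt0// mulr_gt0.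
have [del del0 delP] := rx.2 _ ep0.
(* In units of [scale n], a bound on the distance from [x] to the points of the cell; the summand 1
   keeps it positive. *)
pose rad := h * nrm (corner c) + d%:R * h + 1.
have rad0 : 0 < rad by rewrite ltr_wpDl// addr_ge0// mulr_ge0 ?nrm_ge0// ltW.
near=> n.
have n0 : (0 < n)%N by near: n; exact: nbhs_infty_gt.
have s0 := scale_gt0 n0; have sX := scaleX n0.
have hs0 : 0 < h * scale n by rewrite mulr_gt0.
have sm : scale n * rad < del.
  rewrite -ltr_pdivlMr// -(ltr_pXn2r d0) ?nnegrE ?divr_ge0 ?(ltW s0) ?(ltW del0) ?(ltW rad0)// sX.
  rewrite -[ltRHS]invrK ltf_pV2 ?posrE ?mulr_gt0 ?ltr0n// ?invr_gt0 ?exprn_gt0 ?divr_gt0//.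
  rewrite -ltr_pdivrMr//; near: n; exact: nbhs_infty_gtr.
set B := cell _ _ _.
have mB : measurable B by exact: measurable_cell.
have lB : lam B = ((h * scale n) ^+ d)%:E by rewrite /B cell_cube lam_cube.
set L := (h * scale n) ^+ d in lB.
have L0 : 0 <= L by rewrite exprn_ge0// ltW.
have near_x y : B y -> `|f y - f x| < ep.
  move=> By; apply: delP; apply: le_lt_trans sm.
  have := cell_nrm hs0 By => hy.
  rewrite edistC edistE (@eq_nrm _ _ _ (fun i => (h * scale n) * corner c i +
     (tnth y i - tnth x i - h * scale n * corner c i))); last by move=> i; ring.
  apply: le_trans (nrmD _ _) _; rewrite nrmZ (gtr0_norm hs0).
  apply: le_trans (lerD (lexx _) hy) _; rewrite /rad.
  by have := s0; nra.
have muB : mu B = (\int[lam]_(y in B) (f y)%:E)%E by [].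
have fin : mu B \is a fin_num by exact: fin_num_measure.
have mfB : measurable_fun B (EFin \o f) by apply: measurable_funTS; exact/measurable_EFinP.
have up : fine (mu B) <= (f x + ep) * L.
  rewrite -lee_fin fineK// muB EFinM -lB -integral_cst//; apply: ge0_le_integral => //.
  - by move=> y _; rewrite lee_fin.
  - move=> y By; rewrite lee_fin; have := near_x _ By; rewrite ltr_norml => /andP[_ hy]; lra.
have lo : f x * L <= fine (mu B) + ep * L.
  rewrite -lee_fin EFinD fineK// muB (EFinM (f x)) (EFinM ep) -lB -!integral_cst// -ge0_integralD//.
    apply: ge0_le_integral => //.
    - by move=> y _; rewrite lee_fin ltW.
    - by apply: emeasurable_funD => //.
    - move=> y By; rewrite -EFinD lee_fin; have := near_x _ By; rewrite ltr_norml => /andP[hy _]; lra.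
  - by move=> y _; rewrite lee_fin.
  - by move=> y _; rewrite lee_fin ltW.
have nL : n%:R * f x * L = h ^+ d.
  by rewrite /L exprMn sX mulrCA divff ?mulr1// gt_eqF// mulr_gt0// ltr0n.
have nepL : n%:R * (ep * L) = e.
  have -> : n%:R * (ep * L) = (n%:R * f x * L) * (e / h ^+ d) by rewrite /ep; field; rewrite gt_eqF.
  by rewrite nL; field; rewrite gt_eqF.
have nn : 0 <= n%:R :> R by [].
have := ler_wpM2l nn up; have := ler_wpM2l nn lo.
rewrite ler_norml !mulrDr mulrDl mulrDr nepL !mulrA nL => h1 h2.
by apply/andP; split; lra.
Unshelve. all: by end_near. Qed.

Lemma cvg_degree_at l :
  (fun n => fine (tprod mu n [set y : n.-tuple pt | knn_deg_is k [set z | z \in x :: y] x l]))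
    @ \oo --> @pstar R d k l.
Proof.
apply: cvg_pstar => // M h M0 h0.
pose D n c := @cell R d k M x (h * scale n) c.
have mD n c : measurable (D n c) by exact: measurable_cell.
have dD n : (0 < n)%N -> forall c c' y, D n c y -> D n c' y -> c = c'.
  by move=> n0 c c' y; apply: cell_inj; rewrite mulr_gt0// scale_gt0.
pose B n (A : {set cells k M}) : set (n.-tuple pt) := @occI _ pt _ (D n) n A.
have mB n A : measurable (B n A) by exact: measurable_occI.
have dB n (A A' : {set cells k M}) y : B n A y -> B n A' y -> A = A'.
  by move=> h1 h2; apply/setP => c; have := h1 c; rewrite (h2 c); do 2 case: (_ \in _).
pose E n l' := [set y : n.-tuple pt | knn_deg_is k [set z | z \in x :: y] x l'].
have mE n l' : measurable (E n l').
  have := @measurable_knn_deg R d k n.+1 ord0 l' => mm.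
  have := @measurable_tcons2 _ _ n x measurableT _ mm; rewrite setTI; congr (measurable _).
have BE n A : (0 < n)%N -> @good R d k M A -> B n A `<=` E n (@degA R d k M A).
  move=> n0 gA y By; rewrite /E /=.
  have -> : [set z | z \in x :: y] = [set z | z \in tval y] `|` [set x].
    apply/seteqP; split=> z /=; first by rewrite inE => /predU1P[->|]; [right|left].
    by rewrite inE => -[->|->]; rewrite ?eqxx ?orbT.
  apply: (occ_deg (h := h * scale n)) => //; first by rewrite mulr_gt0// scale_gt0.
  move=> c; have := By c; rewrite -size_filter; set s := seq.filter _ _ => hs.
  have sE z : z \in s <-> D n c z /\ z \in tval y.
    by rewrite mem_filter; split=> [/andP[/asboolP]|[/asboolP -> ->]].
  case: ifP hs => cA hs.
    case: s hs sE => [|z [|z' s]]// _ sE; exists z.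
    have [Dz zy] := (sE z).1 (mem_head _ _); split => // z' Dz' z'y.
    by apply/eqP; rewrite -mem_seq1; apply/sE.
  move=> z Dz zy; have : z \in s by apply/sE.
  by case: s hs {sE}.
have DM n (n0 : (0 < n)%N) := @degree_mass _ _ _ _ (tprod mu n) _ _ (B n) (E n) l (mB n) (mE n) (@dB n)
  (fun _ _ _ => @knn_deg_is_inj _ _ _ _ _ _ _) (fun A => @BE n A n0).
exists (fun n A => fine (tprod mu n (B n A))); split.
- move=> A; have c1 := @cvg_occ_weight R _ (fun n c => fine (mu (D n c))) (h ^+ d) A
    (fun n c => fine_ge0 (measure_ge0 mu _)) (fun c => cvg_cell_mass c h0).
  apply: cvg_trans c1; apply: near_eq_cvg; near=> n.
  have n0 : (0 < n)%N by near: n; exact: nbhs_infty_gt.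
  by rewrite /B tprod_occI//; exact: dD.
- near=> n; have n0 : (0 < n)%N by near: n; exact: nbhs_infty_gt.
  by have /andP[] := DM n n0.
- near=> n; have n0 : (0 < n)%N by near: n; exact: nbhs_infty_gt.
  by have /andP[] := DM n n0.
Unshelve. all: by end_near. Qed.

End at_point.

(** One typical vertex, the coordinate 0, among [n] others; hence tuples of length [n.+1]. *)
Definition Dev n l : set (n.+1.-tuple pt) :=
  [set u | knn_deg_is k [set z | z \in tval u] (tnth u ord0) l].

Lemma measurable_Dev n l : measurable (@Dev n l).
Proof. exact: measurable_knn_deg. Qed.

Lemma cvg_Dev l : (fun n => tprod mu n.+1 (Dev l)) @ \oo --> (@pstar R d k l)%:E.
Proof.
pose g n x := tprod mu n [set y | Dev l (tcons (x, y))].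
have mm n x : measurable [set y : n.-tuple pt | Dev l (tcons (x, y))].
  by have := @measurable_tcons2 _ _ n x measurableT _ (measurable_Dev l); rewrite setTI.
have gE n x : g n x = (fine (tprod mu n [set y : n.-tuple pt | knn_deg_is k [set z | z \in x :: y] x l]))%:E.
  by rewrite fineK//; apply: fin_num_measure; exact: mm.
have mg n : measurable_fun setT (g n).
  have mA : measurable (@tcons _ pt n @^-1` Dev l).
    by rewrite -[X in measurable X]setTI; apply: measurable_tcons => //; exact: measurable_Dev.
  have := measurable_fun_xsection (tprod mu n) mA; congr (measurable_fun _ _).
  apply/funext => x /=; congr (tprod mu n _).
  by apply/seteqP; split=> y /=; rewrite /xsection/= inE.
have := @dominated_convergence _ _ _ mu setT measurableT g (cst (@pstar R d k l)%:E) (cst 1%E) mg.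
case=> //.
- by apply: filterS ae_regular => x rx _; under eq_fun do rewrite gE; apply: cvg_EFin;
    [exact: nearW|exact: cvg_degree_at rx l].
- exact: (finite_measure_integrable_cst mu 1).
- by apply: aeW => x n _; rewrite gee0_abs// /g; apply: probability_le1; exact: mm.
move=> _ _; rewrite (integral_cst_probability mu).
apply: cvg_trans; apply: near_eq_cvg; apply: nearW => n.
by rewrite tprodS; [|exact: measurable_Dev].
Qed.

(** For [n >= k] general position puts the degree of a sample point between [k] and [K] almost
    surely, so the probabilities sum to 1 already before the limit, and the sum is finite. *)
Lemma sum_pstar : \sum_(k <= l < (k + k * @ncones d).+1) @pstar R d k l = 1.
Proof.
set K := (k + _)%N.
have h : (fun n => \sum_(k <= l < K.+1) fine (tprod mu n.+1 (Dev l))) @ \oo -->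
    \sum_(k <= l < K.+1) @pstar R d k l.
  apply: (cvg_sumr (f := fun n l => fine (tprod mu n.+1 (Dev l)))) => l.
  by have /fine_cvgP[_] := @cvg_Dev l.
have c1 : (fun=> 1 : R) @ \oo --> (1 : R) by exact: cvg_cst.
suff c2 : (fun n => \sum_(k <= l < K.+1) fine (tprod mu n.+1 (Dev l))) @ \oo --> (1 : R).
  by apply: (cvg_unique _ h c2); exact: norm_hausdorff.
apply: cvg_trans c1; apply: near_eq_cvg; near=> n.
have kn : (k <= n)%N by near: n; exact: nbhs_infty_ge.
apply/esym/eqP; rewrite -eqe -sumEFin big_geq_mkord.
rewrite (eq_bigr (fun l : 'I_K.+1 => tprod mu n.+1 (Dev l))); last first.
  by move=> l _; rewrite fineK//; apply: fin_num_measure; exact: measurable_Dev.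
rewrite eq_le; apply/andP; split.
  rewrite -(probability_setT (tprod mu n.+1)); apply: sum_measure_le => //.
  - by move=> l; exact: measurable_Dev.
  - by move=> i j u h1 h2; apply: val_inj; exact: knn_deg_is_inj h1 h2.
have <- : tprod mu n.+1 [set u : n.+1.-tuple pt | gp u] = 1%E.
  rewrite -(setCK [set u | _]) probability_setC; last by apply: measurableC; exact: measurable_gp.
  by rewrite tprod_not_gp// sube0.
apply: sum_measure_ge; [by move=> l; exact: measurable_Dev|exact: measurable_gp|].
move=> u gu; have /andP[d1 d2] : (k <= deg k u (tnth u ord0) <= K)%N.
  by apply: deg_bounds; rewrite ?mem_tnth// size_tuple ltnS.
exists (Ordinal (d2 : (deg k u (tnth u ord0) < K.+1)%N)) => //.
by apply/knn_deg_isE; rewrite ?mem_tnth//; case: gu.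
Unshelve. all: by end_near. Qed.

End iid_limit.

(** * Exchangeability and second moments *)

Section exchangeability.
Local Open Scope ereal_scope.
Context {dT} {T : measurableType dT} {R : realType} (mu : probability T R).

Definition tuperm n (s : {perm 'I_n}) (u : n.-tuple T) : n.-tuple T := [tuple tnth u (s i) | i < n].

Lemma measurable_tuperm n (s : {perm 'I_n}) : measurable_fun setT (tuperm s).
Proof.
apply/measurable_fun_tnthP => i.
rewrite (_ : _ \o _ = fun u => tnth u (s i)); first exact: measurable_tnth.
by apply/funext => u /=; rewrite tnth_mktuple.
Qed.

Lemma tprod_perm n (s : {perm 'I_n}) (B : set (n.-tuple T)) : measurable B ->
  tprod mu n (tuperm s @^-1` B) = tprod mu n B.
Proof.
move=> mB; have -> : tprod mu n (tuperm s @^-1` B) = mpush (tprod mu n) (measurable_tuperm s) B by [].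
rewrite -[RHS]mul1e; apply: tprod_unique => // A mA; rewrite mul1e.
transitivity (tprod mu n (tbox (fun i => A (s^-1%g i)))).
  rewrite /= /mpush /pushforward; congr (tprod mu n _); apply/seteqP; split=> u h i.
    by have := h (s^-1%g i); rewrite tnth_mktuple permKV.
  by have := h (s i); rewrite tnth_mktuple permK.
by rewrite tprod_tbox// (reindex_inj (@perm_inj _ s))/=; apply: eq_bigr => i _; rewrite permK.
Qed.

End exchangeability.

Section second_moments.
Local Open Scope ereal_scope.
Context {dT} {T : measurableType dT} {R : realType} (mu : probability T R).
Variables (g : T -> R) (b : R).
Hypotheses (mg : measurable_fun setT g) (g0 : forall x, (0 <= g x)%R) (gb : forall x, (g x <= b)%R).

Lemma mean_bounds : 0 <= \int[mu]_x (g x)%:E <= b%:E.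
Proof.
apply/andP; split; first by apply: integral_ge0 => x _; rewrite lee_fin.
rewrite -(integral_cst_probability mu b).
by apply: ge0_le_integral => //; [move=> x _; rewrite lee_fin|exact/measurable_EFinP|move=> x _; rewrite lee_fin].
Qed.

Definition mean : R := fine (\int[mu]_x (g x)%:E).

Lemma meanE : \int[mu]_x (g x)%:E = mean%:E.
Proof.
have /andP[h0 h1] := mean_bounds; rewrite fineK// ge0_fin_numE//.
exact: le_lt_trans h1 (ltry _).
Qed.

Lemma mean_ge0 : (0 <= mean)%R.
Proof. by rewrite -lee_fin -meanE; have /andP[] := mean_bounds. Qed.

Lemma mean_le : (mean <= b)%R.
Proof. by rewrite -lee_fin -meanE; have /andP[] := mean_bounds. Qed.

Let mg2 m : measurable_fun setT (fun x => ((g x - m) ^+ 2)%:E).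
Proof. by apply/measurable_EFinP; apply: measurable_funX; apply: measurable_funB. Qed.

(** Bias and variance. The identity [h] adds [2 * r * mean] instead of expanding the square, so that
    only nonnegative functions are integrated. *)
Lemma sqr_integral_shift m : (0 <= m)%R ->
  \int[mu]_x ((g x - m) ^+ 2)%:E = \int[mu]_x ((g x - mean) ^+ 2)%:E + ((mean - m) ^+ 2)%:E.
Proof.
move=> m0.
have cstE := integral_cst_probability mu.
have h r : (0 <= r)%R -> \int[mu]_x ((g x - r) ^+ 2)%:E + (2 * r * mean)%:E =
    \int[mu]_x ((g x) ^+ 2)%:E + (r ^+ 2)%:E.
  move=> r0; rewrite EFinM -meanE -[X in _ = _ + X]cstE.
  rewrite -ge0_integralZl_EFin//; last 3 first.
  - by move=> x _; rewrite lee_fin.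
  - exact/measurable_EFinP.
  - by rewrite mulr_ge0.
  rewrite -!ge0_integralD//.
  - by apply: eq_integral => x _; rewrite -EFinM -!EFinD; congr (_ %:E); ring.
  - by move=> x _; rewrite lee_fin sqr_ge0.
  - by apply/measurable_EFinP; exact: measurable_funX.
  - by move=> x _; rewrite lee_fin sqr_ge0.
  - by move=> x _; rewrite lee_fin sqr_ge0.
  - by move=> x _; rewrite -EFinM lee_fin !mulr_ge0.
  - by apply/measurable_EFinP; apply: measurable_funM => //.
have fin r : \int[mu]_x ((g x - r) ^+ 2)%:E \is a fin_num.
  rewrite ge0_fin_numE; last by apply: integral_ge0 => x _; rewrite lee_fin sqr_ge0.
  apply: (@le_lt_trans _ _ (\int[mu]_x ((b + `|r|) ^+ 2)%:E)); last by rewrite cstE ltry.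
  apply: ge0_le_integral => //; first by move=> x _; rewrite lee_fin sqr_ge0.
  move=> x _; rewrite lee_fin -[leLHS]real_normK ?num_real// ler_sqr ?nnegrE//; last first.
    by rewrite addr_ge0// (le_trans (g0 x) (gb x)).
  by apply: le_trans (ler_normB _ _) _; rewrite lerD2r ger0_norm.
have := h _ m0; have := h _ mean_ge0.
rewrite -(fineK (fin m)) -(fineK (fin mean)).
have -> : \int[mu]_x ((g x) ^+ 2)%:E = \int[mu]_x ((g x - 0) ^+ 2)%:E.
  by apply: eq_integral => x _; rewrite subr0.
rewrite -(fineK (fin 0%R)) -!EFinD => -[e1] [e2]; congr (_ %:E).
move: (fine _) (fine _) (fine _) e1 e2 => A B C e1 e2; lra.
Qed.

End second_moments.

(** * Mean and variance of the vertex counts *)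

Section vertex_counts.
Context {R : realType} {d : nat} (d0 : (0 < d)%N).
Local Notation pt := (d.-tuple R).
Variables (lam : {measure set pt -> \bar R}) (hlam : is_lebesgue_d lam)
  (f : pt -> R) (hf : good_density lam f).
Let mu : probability pt R := [the probability _ _ of dens hf].

(** Required in general position only, which is where [Vdeg_cons] applies. *)
Definition bounded_difference n (F : n.-tuple pt -> R) (c : R) :=
  forall (u u' : n.-tuple pt) a, gp u -> gp u' ->
    (forall i, i != a -> tnth u i = tnth u' i) -> `|F u - F u'| <= c.

Let cstE := integral_cst_probability mu.

Let ae_gp n : {ae tprod mu n, forall u : n.-tuple pt, gp u}.
Proof.
exists (~` [set u : n.-tuple pt | gp u]); split => //; last exact: tprod_not_gp.
by apply: measurableC; exact: measurable_gp.
Qed.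

(** Averaging out the first coordinate gives [G], which inherits the bounded difference [c]. The
    fluctuation of [F] around [G] costs at most [c ^ 2], and the bias term is the induction bound
    for [G]. The centre [m] is left free; the mean can only improve it. *)
Lemma efron_stein n (F : n.-tuple pt -> R) (b c : R) : measurable_fun setT F ->
  (forall u, 0 <= F u) -> (forall u, F u <= b) -> 0 <= c -> bounded_difference F c ->
  exists2 m : R, 0 <= m & (\int[tprod mu n]_u ((F u - m) ^+ 2)%:E <= (n%:R * c ^+ 2)%:E)%E.
Proof.
elim: n F => [|n IH] F mF F0 Fb c0 BD.
  exists (F [tuple]) => //; rewrite (eq_integral (cst 0%E)) ?integral0 ?mul0r// => u _.
  by rewrite (tuple0 u) subrr expr0n.
have mFy y : measurable_fun setT (fun x => F (tcons (x, y))).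
  exact: measurableT_comp mF (measurable_tcons1 y).
pose G y := mean mu (fun x => F (tcons (x, y))).
have GE y : (\int[mu]_x (F (tcons (x, y)))%:E = (G y)%:E)%E by apply: (@meanE _ _ _ _ _ b).
have mG : measurable_fun setT G.
  apply/measurable_EFinP; rewrite (_ : EFin \o G = fubini_G mu (fun z => (F (tcons z))%:E)).
    apply: measurable_fun_fubini_tonelli_G; last by move=> z; rewrite lee_fin.
    by apply/measurable_EFinP; exact: measurableT_comp mF (@measurable_tcons _ _ n).
  by apply/funext => y /=; rewrite -GE.
have G0 y : 0 <= G y by apply: (@mean_ge0 _ _ _ _ _ b).
have Gb y : G y <= b by apply: (@mean_le _ _ _ _ _ b).
have intle (g h : pt -> R) : measurable_fun setT g -> measurable_fun setT h ->
    (forall x, 0 <= g x) -> (forall x, 0 <= h x) -> {ae mu, forall x, g x <= h x + c} ->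
    (\int[mu]_x (g x)%:E <= \int[mu]_x (h x)%:E + c%:E)%E.
  move=> mg mh g0 h0 gh; rewrite -[X in (_ + X)%E]cstE -ge0_integralD//; last 2 first.
  - by move=> x _; rewrite lee_fin.
  - exact/measurable_EFinP.
  apply: ae_ge0_le_integral => //.
  - by move=> x _; rewrite lee_fin.
  - exact/measurable_EFinP.
  - by move=> x _; rewrite -EFinD lee_fin addr_ge0.
  - by apply: emeasurable_funD => //; exact/measurable_EFinP.
  - by apply: filterS gh => x hx _; rewrite -EFinD lee_fin.
have Gle y y' : {ae mu, forall x, F (tcons (x, y)) <= F (tcons (x, y')) + c} -> G y <= G y' + c.
  by move=> h; rewrite -lee_fin EFinD -!GE; exact: intle.
have BG : bounded_difference G c.
  move=> y y' a gy gy' yy'.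
  have h : {ae mu, forall x, `|F (tcons (x, y)) - F (tcons (x, y'))| <= c}.
    (* Almost every head [x] extends both tails to general position. *)
    apply: filterS2 (ae_gp_cons d0 hlam hf gy) (ae_gp_cons d0 hlam hf gy') => x g1 g2.
    apply: (BD _ _ (lift ord0 a)) => // i.
    case: (unliftP ord0 i) => [j ->|->] ij; last by [].
    by rewrite !tnthS; apply: yy'; apply: contraNneq ij => ->.
  rewrite ler_distl lerBlDr; apply/andP; split.
    by apply: Gle; apply: filterS h => x; rewrite ler_norml => /andP[h1 h2]; lra.
  by apply: Gle; apply: filterS h => x; rewrite ler_norml => /andP[h1 h2]; lra.
have [m m0 hm] := IH G mG G0 Gb c0 BG.
exists m => //.
have mFm : measurable_fun setT (fun u => ((F u - m) ^+ 2)%:E).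
  by apply/measurable_EFinP; apply: measurable_funX; apply: measurable_funB.
rewrite ge0_integral_tprodS_swap//; last by move=> u; rewrite lee_fin sqr_ge0.
have -> : (n.+1%:R * c ^+ 2)%:E = ((c ^+ 2)%:E + (n%:R * c ^+ 2)%:E)%E.
  by rewrite -EFinD -natr1 mulrDl mul1r addrC.
apply: (@le_trans _ _ (\int[tprod mu n]_y ((c ^+ 2)%:E + ((G y - m) ^+ 2)%:E)%E)%E); last first.
  rewrite ge0_integralD//; last 3 first.
  - by move=> y _; rewrite lee_fin sqr_ge0.
  - by move=> y _; rewrite lee_fin sqr_ge0.
  - by apply/measurable_EFinP; apply: measurable_funX; apply: measurable_funB.
  by rewrite integral_cst_probability leeD2l.
apply: ae_ge0_le_integral => //.
- by move=> y _; apply: integral_ge0 => x _; rewrite lee_fin sqr_ge0.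
- have := @measurable_fun_fubini_tonelli_G _ _ pt (n.-tuple pt) R mu (fun z => ((F (tcons z) - m) ^+ 2)%:E).
  apply.
    exact: measurableT_comp mFm (@measurable_tcons _ _ n).
  by move=> z; rewrite lee_fin sqr_ge0.
- by move=> y _; rewrite -EFinD lee_fin addr_ge0 ?sqr_ge0.
- by apply/measurable_EFinP; apply: measurable_funD => //; apply: measurable_funX; apply: measurable_funB.
apply: filterS (ae_gp n) => y gy _.
rewrite (@sqr_integral_shift _ _ _ mu (fun x => F (tcons (x, y))) b)// leeD2r//.
rewrite -[leRHS]cstE; apply: ae_ge0_le_integral => //.
- by move=> x _; rewrite lee_fin sqr_ge0.
- by apply/measurable_EFinP; apply: measurable_funX; apply: measurable_funB.
- by move=> x _; rewrite lee_fin sqr_ge0.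
have gx := ae_gp_cons d0 hlam hf gy.
apply: filterS (gx) => x g1 _; rewrite lee_fin -/(G y) -[leLHS]real_normK ?num_real// ler_sqr ?nnegrE//.
(* With the tail fixed, [F] varies by at most [c] with the head, so it stays within [c] of its
   average [G y]. *)
have h : {ae mu, forall x', `|F (tcons (x, y)) - F (tcons (x', y))| <= c}.
  apply: filterS gx => x' g2; apply: (BD _ _ ord0) => // i.
  by case: (unliftP ord0 i) => [j ->|->]; rewrite ?eqxx// !tnthS.
have e1 : F (tcons (x, y)) <= G y + c.
  rewrite -lee_fin EFinD -GE -[leLHS]cstE; apply: intle => //.
  by apply: filterS h => z; rewrite ler_norml => /andP[h1 h2]; lra.
have e2 : G y <= F (tcons (x, y)) + c.
  rewrite -lee_fin EFinD -GE -[X in (X + _)%E]cstE; apply: intle => //.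
  by apply: filterS h => z; rewrite ler_norml => /andP[h1 h2]; lra.
by rewrite ler_norml; apply/andP; split; lra.
Qed.

Variable k : nat.

Lemma V_count_gp l (t : seq pt) : gp t -> V_count k l t = Vdeg k l t.
Proof. by move=> [ut _]; rewrite V_countE undup_id. Qed.

Lemma V_count_le l (t : seq pt) : (V_count k l t <= size t)%N.
Proof. exact: leq_trans (count_size _ _) (size_undup _). Qed.

(** Replacing a point is a deletion followed by an insertion, each changing the count by at most
    [bdiff]. *)
Lemma V_count_bounded_difference n l :
  bounded_difference (fun u : n.-tuple pt => (V_count k l u)%:R : R) (2 * bdiff (d := d) k)%:R.
Proof.
move=> u u' a gu gu' uu'.
have pu (w : n.-tuple pt) : perm_eq w (tnth w a :: [seq tnth w i | i <- rem a (enum 'I_n)]).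
  have h : perm_eq (enum 'I_n) (a :: rem a (enum 'I_n)) by apply: perm_to_rem; rewrite mem_enum.
  by have := perm_map (tnth w) h; rewrite map_tnth_enum.
pose r := [seq tnth u i | i <- rem a (enum 'I_n)].
have rE : r = [seq tnth u' i | i <- rem a (enum 'I_n)].
  apply/eq_in_map => i; rewrite mem_rem_uniq ?enum_uniq// inE => /andP[ia _]; exact: uu'.
have p1 := pu u; have p2 := pu u'; rewrite -/r in p1; rewrite -rE in p2.
rewrite !V_count_gp// (perm_Vdeg _ _ p1) (perm_Vdeg _ _ p2).
have [h1 h2] := Vdeg_cons k l (perm_gp p1 gu); have [h3 h4] := Vdeg_cons k l (perm_gp p2 gu').
rewrite ler_distl; apply/andP; split; rewrite ?lerBlDr -natrD ler_nat; lia.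
Qed.

(** Sum over the vertices; a transposition of coordinates gives each the law of the first one. The
    integrands are compared in general position, because [V_count] discards repetitions. *)
Lemma integral_V_count n l :
  (\int[tprod mu n.+1]_u (V_count k l u)%:R%:E = n.+1%:R%:E * tprod mu n.+1 (Dev k l))%E.
Proof.
pose E (a : 'I_n.+1) := [set u : n.+1.-tuple pt | knn_deg_is k [set z | z \in tval u] (tnth u a) l].
have mE a : measurable (E a) by exact: measurable_knn_deg.
have EE a : tprod mu n.+1 (E a) = tprod mu n.+1 (Dev k l).
  rewrite -(tprod_perm mu (tperm ord0 a) (@measurable_Dev R d k n l)).
  have set_perm (u : n.+1.-tuple pt) :
      [set z | z \in tval (tuperm (tperm ord0 a) u)] = [set z | z \in tval u].
    apply/seteqP; split=> z h.
      have /tnthP[i ->] : z \in tuperm (tperm ord0 a) u by exact: h.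
      by rewrite tnth_mktuple; exact: mem_tnth.
    have /tnthP[i ->] : z \in u by exact: h.
    by apply/tnthP; exists (tperm ord0 a i); rewrite tnth_mktuple tpermK.
  congr (tprod mu n.+1 _); apply/funext => u.
  transitivity (knn_deg_is k [set z | z \in tval (tuperm (tperm ord0 a) u)]
    (tnth (tuperm (tperm ord0 a) u) ord0) l); last by [].
  by rewrite set_perm tnth_mktuple tpermL.
have -> : (n.+1%:R%:E * tprod mu n.+1 (Dev k l) = \sum_(a < n.+1) tprod mu n.+1 (E a))%E.
  under eq_bigr do rewrite EE.
  by rewrite sumr_const card_ord -[RHS]mule_natl.
transitivity (\int[tprod mu n.+1]_u (\sum_(a < n.+1) (\1_(E a) u)%:E))%E; last first.
  rewrite ge0_integral_sum//; last first.
    by move=> a; apply/measurable_EFinP; exact: measurable_indic.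
  by apply: eq_bigr => a _; rewrite integral_indic// setIT.
apply: ge0_ae_eq_integral => //.
- by apply/measurable_EFinP; exact: measurable_V_count.
- by apply: emeasurable_sum => a; apply/measurable_EFinP; exact: measurable_indic.
- by move=> u _; rewrite sume_ge0// => a _; rewrite lee_fin.
exists (~` [set u : n.+1.-tuple pt | gp u]); split.
- by apply: measurableC; exact: measurable_gp.
- exact: tprod_not_gp.
move=> u /= /not_implyP[_] h gu; apply: h.
rewrite sumEFin; congr (_ %:E); rewrite V_count_gp// /Vdeg -sum1_count big_tuple natr_sum big_mkcond/=.
apply: eq_bigr => a _; rewrite indicE.
have [h|h] := pselect (E a u).
  by rewrite mem_set//; move/knn_deg_isE : h => -> //; rewrite ?eqxx ?mem_tnth//; case: gu.
rewrite memNset//; case: eqP => // e; exfalso; apply: h; apply/knn_deg_isE => //; last exact: mem_tnth.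
by case: gu.
Qed.

Lemma mean_V_count n l : (\int[tprod mu n]_u (V_count k l u)%:R%:E =
  (mean (tprod mu n) (fun u => (V_count k l u)%:R))%:E)%E.
Proof.
apply: (@meanE _ _ _ _ _ n%:R) => //; first exact: measurable_V_count.
by move=> u; rewrite ler_nat -{2}(size_tuple u) V_count_le.
Qed.

Lemma variance_V_count n l : (\int[tprod mu n]_u
  (((V_count k l u)%:R - mean (tprod mu n) (fun u => (V_count k l u)%:R)) ^+ 2)%:E
  <= (n%:R * (2 * bdiff (d := d) k)%:R ^+ 2)%:E)%E.
Proof.
have mV := @measurable_V_count R d k n l.
have V0 (u : n.-tuple pt) : 0 <= (V_count k l u)%:R :> R by [].
have Vn (u : n.-tuple pt) : (V_count k l u)%:R <= n%:R :> R.
  by rewrite ler_nat -{2}(size_tuple u) V_count_le.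
have [m m0 hm] := @efron_stein n _ n%:R (2 * bdiff (d := d) k)%:R mV V0 Vn
  (ler0n _ _) (@V_count_bounded_difference n l).
apply: le_trans hm; rewrite (sqr_integral_shift (tprod mu n) mV V0 Vn m0).
by rewrite leeDl// lee_fin sqr_ge0.
Qed.

End vertex_counts.

(** * From random variables to product measures *)

Section samples.
Context {dO : measure_display} {Omega : measurableType dO} {R : realType}
  (P : probability Omega R) {dT : measure_display} {T : measurableType dT}
  (mu : probability T R) (X : nat -> Omega -> T).
Hypothesis mX : forall i, measurable_fun setT (X i).

Definition sample n w : n.-tuple T := [tuple X i w | i < n].

Lemma sampleE n w : [seq X i w | i <- iota 0 n] = sample n w.
Proof. by rewrite /sample/= -val_enum_ord -map_comp. Qed.

Lemma measurable_sample n : measurable_fun setT (@sample n).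
Proof.
apply/measurable_fun_tnthP => i; rewrite (_ : _ \o _ = X i) //.
by apply/funext => w /=; rewrite tnth_mktuple.
Qed.

Variables (E : set Omega) (mE : measurable E).
Hypothesis indep : forall n (A : 'I_n -> set T), (forall i, measurable (A i)) ->
  P (E `&` [set w | forall i : 'I_n, A i (X i w)]) = (P E * \prod_(i < n) mu (A i))%E.

(** [E] is the whole space for samples of fixed size, and the event that the number of points takes
    a given value for the Poisson process. *)
Lemma sample_law n B : measurable B ->
  P (@sample n @^-1` B `&` E) = (P E * tprod mu n B)%E.
Proof.
move=> mB; have fE : P E \is a fin_num by apply: fin_num_measure.
rewrite -(fineK fE).
pose m := mpush (mrestr P mE) (@measurable_sample n).
apply: (@tprod_unique _ _ _ mu n m) => //; first exact: fine_ge0.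
move=> A mA; rewrite fineK// -indep// setIC.
rewrite /m /= /mpush /pushforward /mrestr /=; congr (P (_ `&` _)).
by apply/seteqP; split=> w h i; have := h i; rewrite tnth_mktuple.
Qed.

Lemma integral_sample n (g : n.-tuple T -> \bar R) : measurable_fun setT g ->
  (forall u, 0 <= g u)%E ->
  (\int[P]_(w in E) g (sample n w) = P E * \int[tprod mu n]_u g u)%E.
Proof.
move=> mg g0; have fE : P E \is a fin_num by apply: fin_num_measure.
have mgs : measurable_fun setT (fun w => g (sample n w)).
  exact: measurableT_comp mg (@measurable_sample n).
transitivity (\int[mrestr P mE]_w g (sample n w))%E.
  rewrite [RHS](@ge0_negligible_integral _ _ _ _ _ (~` E))//; last first.
  - by transitivity (P (~` E `&` E)); [by []|rewrite setICl measure0].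
  - exact: measurableC.
  rewrite setDE setCK setTI; apply: eq_measure_integral => A mA AE.
  by rewrite /mrestr/=; congr (P _); rewrite setIidl.
rewrite -(ge0_integral_mpush (mrestr P mE) (@measurable_sample n))//.
have e0 : (0 <= fine (P E))%R by exact: fine_ge0.
rewrite (@eq_measure_integral _ _ _ setT (mscale (NngNum e0) (tprod mu n))); last first.
  move=> A mA _; rewrite /= /mscale /= fineK//; exact: sample_law.
by rewrite ge0_integral_mscale//= fineK.
Qed.

End samples.

(** * From squares to all integers, and summability *)

Section interpolation.
Context {R : realType}.

Lemma ex_sqrt_bracket J n : ((J.+1 ^ 2) <= n)%N ->
  exists j, [/\ (J <= j)%N, (j.+1 ^ 2 <= n)%N & (n < j.+2 ^ 2)%N].
Proof.
elim: n => [|n IH]; first by rewrite leqn0 expn_eq0.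
rewrite leq_eqVlt => /orP[/eqP <-|]; first by exists J; rewrite leqnn ltn_exp2r.
rewrite ltnS => /IH [j [Jj jn nj]].
have [h|h] := ltnP n.+1 (j.+2 ^ 2); first by exists j; split=> //; apply: leq_trans jn _.
by exists j.+1; split=> //; [exact: leqW|apply: leq_ltn_trans nj _; rewrite ltn_exp2r].
Qed.

(** Between consecutive squares the index grows by O(sqrt n) and [v] by at most [c] at each step,
    which is negligible against [n]. *)
Lemma cvg_interpolate_squares (v : nat -> R) (c p : R) :
  (forall n, `|v n.+1 - v n| <= c) ->
  (fun j => v (j.+1 ^ 2)%N / (j.+1 ^ 2)%:R) @ \oo --> p ->
  (fun n => v n / n%:R) @ \oo --> p.
Proof.
move=> vc cv.
have vcm n m : `|v (n + m)%N - v n| <= m%:R * c.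
  elim: m => [|m IH]; first by rewrite addn0 subrr normr0 mul0r.
  rewrite addnS -natr1 mulrDl mul1r (_ : _ - _ = (v (n + m).+1 - v (n + m)%N) + (v (n + m)%N - v n)); last by ring.
  by apply: le_trans (ler_normD _ _) _; rewrite addrC lerD.
have c0 : 0 <= c by apply: le_trans (vc 0%N).
apply/cvgrPdist_le => e e0.
have e2 : 0 < e / 2 by rewrite divr_gt0.
move/cvgrPdist_le : cv => /(_ _ e2) [J1 _ hJ1].
(* Gathers the error from changing the denominator, proportional to [p], and the one from the growth
   of [v], proportional to [c]. *)
pose C := 3 * (c + `|p|); have C0 : 0 <= C by rewrite mulr_ge0// addr_ge0.
pose J := maxn J1 (Num.truncn (C / (e / 2))).
near=> n.
have [j [Jj jn nj]] : exists j, [/\ (J <= j)%N, (j.+1 ^ 2 <= n)%N & (n < j.+2 ^ 2)%N].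
  by apply: ex_sqrt_bracket; near: n; exact: nbhs_infty_ge.
set q := (j.+1 ^ 2)%N in jn.
have q0 : 0 < q%:R :> R by rewrite ltr0n expn_gt0.
have n0 : 0 < n%:R :> R by rewrite ltr0n (leq_trans _ jn)// expn_gt0.
have qn : q%:R <= n%:R :> R by rewrite ler_nat.
have mE : (n - q <= 3 * j.+1)%N by rewrite /q in jn *; nia.
have mb : (n - q)%:R / n%:R <= 3 / j.+1%:R :> R.
  apply: (@le_trans _ _ ((3 * j.+1)%:R / q%:R)).
    by apply: ler_pM => //; [rewrite ler_nat|rewrite lef_pV2 ?posrE].
  by rewrite /q natrM natrX expr2 invfM mulrA mulfK// pnatr_eq0.
have Cj : C / j.+1%:R <= e / 2.
  rewrite ler_pdivrMr// mulrC -ler_pdivrMr//; apply: ltW; apply: lt_le_trans (truncnS_gt _) _.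
  by rewrite ler_nat ltnS (leq_trans _ Jj)// leq_maxr.
have h1 := hJ1 j (leq_trans (leq_maxl _ _) Jj).
have h2 : `|p - v q / q%:R| <= e / 2 by exact: h1.
have h3 : `|v n - v q| <= (n - q)%:R * c by rewrite -{1}(subnKC jn); exact: vcm.
have -> : p - v n / n%:R = (n - q)%:R / n%:R * p + q%:R / n%:R * (p - v q / q%:R) - (v n - v q) / n%:R.
  rewrite natrB//; field; by rewrite !gt_eqF.
apply: le_trans (ler_normB _ _) _.
apply: (@le_trans _ _ (3 / j.+1%:R * `|p| + e / 2 + 3 / j.+1%:R * c)); last first.
  have -> : 3 / j.+1%:R * `|p| + e / 2 + 3 / j.+1%:R * c = C / j.+1%:R + e / 2 by rewrite /C; ring.
  by rewrite [leRHS]splitr lerD2r.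
apply: lerD.
  apply: le_trans (ler_normD _ _) _; apply: lerD; rewrite normrM.
    by rewrite ger0_norm ?divr_ge0//; apply: ler_wpM2r.
  rewrite ger0_norm ?divr_ge0//; apply: le_trans h2; apply: ler_piMl => //.
  by rewrite ler_pdivrMr// mul1r.
rewrite normrM (ger0_norm (_ : 0 <= n%:R^-1)) ?invr_ge0//.
apply: (@le_trans _ _ ((n - q)%:R * c / n%:R)); first by rewrite ler_pM2r ?invr_gt0.
by rewrite mulrAC; apply: ler_wpM2r.
Unshelve. all: by end_near. Qed.

(** Induction on the sharper bound [2 - 1 / n], which telescopes. *)
Lemma sum_inv_sqr_le n : \sum_(0 <= j < n) ((j.+1 ^ 2)%:R^-1 : R) <= 2.
Proof.
case: n => [|n]; first by rewrite big_geq.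
suff : \sum_(0 <= j < n.+1) ((j.+1 ^ 2)%:R^-1 : R) <= 2 - n.+1%:R^-1.
  by move/le_trans; apply; rewrite gerBl invr_ge0.
elim: n => [|n IH]; first by rewrite big_nat1 exp1n invr1; lra.
rewrite big_nat_recr//=; apply: le_trans (lerD IH (lexx _)) _.
have a0 : 0 < n.+1%:R :> R by [].
rewrite natrX -[n.+2%:R]natr1.
move: (n.+1%:R : R) a0 => a a0; have a1 : 0 < a + 1 by lra.
rewrite -subr_ge0 (_ : _ - _ = (a * (a + 1) ^+ 2)^-1); last first.
  by field; rewrite !gt_eqF.
by rewrite invr_ge0 mulr_ge0 ?sqr_ge0 ?ltW.
Qed.

End interpolation.

Section summable.
Context {dO : measure_display} {Omega : measurableType dO} {R : realType}
  (P : probability Omega R).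

(** The series of the [Y j] has finite expectation, hence is almost surely finite, and the terms of
    a convergent series tend to 0. *)
Lemma ae_cvg0_summable (Y : nat -> Omega -> R) (C : R) : 0 <= C ->
  (forall j, measurable_fun setT (Y j)) -> (forall j w, 0 <= Y j w) ->
  (forall j, (\int[P]_w (Y j w)%:E <= (C / (j.+1 ^ 2)%:R)%:E)%E) ->
  {ae P, forall w, Y ^~ w @ \oo --> 0}.
Proof.
move=> C0 mY Y0 hY.
pose S w := (\sum_(j <oo) (Y j w)%:E)%E.
have mYE j : measurable_fun setT (fun w => (Y j w)%:E) by exact/measurable_EFinP.
have S0 w : (0 <= S w)%E by apply: nneseries_ge0 => j _ _; rewrite lee_fin.
have mS : measurable_fun setT S.
  by apply: ge0_emeasurable_sum => // j w _ _; rewrite lee_fin.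
have iS : P.-integrable setT S.
  apply/integrableP; split => //.
  under eq_integral do rewrite gee0_abs//.
  rewrite integral_nneseries//; last by move=> j w _; rewrite lee_fin.
  apply: (@le_lt_trans _ _ (C * 2)%:E); last by rewrite ltry.
  apply: lime_le.
    by apply: is_cvg_nneseries => j _ _; apply: integral_ge0 => w _; rewrite lee_fin.
  apply: nearW => n; apply: (@le_trans _ _ (\sum_(0 <= j < n) (C / (j.+1 ^ 2)%:R)%:E)%E).
    by apply: lee_sum => j _.
  by rewrite sumEFin lee_fin -mulr_sumr ler_wpM2l// sum_inv_sqr_le.
apply: filterS (integrable_ae measurableT iS) => w /(_ I) fw.
apply: cvg_series_cvg_0; apply: nondecreasing_is_cvgn.
  by apply: nondecreasing_series => j _ _.
exists (fine (S w)) => _ [n _ <-]; rewrite -lee_fin fineK// /series/= -sumEFin.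
by apply: nneseries_lim_ge => j _ _; rewrite lee_fin.
Qed.

End summable.

(** * Limit theorems for binomial and Poisson samples *)

Section iid.
Context {R : realType} {d : nat} (k : nat) (d0 : (0 < d)%N).
Local Notation pt := (d.-tuple R).
Variables (lam : {measure set pt -> \bar R}) (hlam : is_lebesgue_d lam)
  (f : pt -> R) (hf : good_density lam f).
Let mu : probability pt R := [the probability _ _ of dens hf].
Context {dO : measure_display} {Omega : measurableType dO} (P : probability Omega R)
  (X : nat -> Omega -> pt).

(** Makes a family over ['I_n] total on integers, the form in which independence is stated. *)
Definition extend n (A : 'I_n -> set pt) (j : nat) : set pt :=
  if insub j is Some i then A i else setT.

Lemma extendE n (A : 'I_n -> set pt) (i : 'I_n) : extend A i = A i.
Proof. by rewrite /extend valK. Qed.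

Lemma measurable_extend n (A : 'I_n -> set pt) j : (forall i, measurable (A i)) ->
  measurable (extend A j).
Proof. by rewrite /extend; case: insub. Qed.

Section binomial.
Hypothesis hX : iid_density P lam f X.

Let mX i : measurable_fun setT (X i). Proof. by have [/(_ i)[]] := hX. Qed.

Let indep n (A : 'I_n -> set pt) : (forall i, measurable (A i)) ->
  P (setT `&` [set w | forall i : 'I_n, A i (X i w)]) = (P setT * \prod_(i < n) mu (A i))%E.
Proof.
move=> mA; have [hd ind] := hX.
have -> : P setT = 1%E by exact: probability_setT.
rewrite mul1e setTI.
have := ind (index_iota 0 n) (fun j => X j @^-1` extend A j) (iota_uniq _ _).
rewrite big_mkord => e; rewrite (_ : [set w | _] =
    \bigcap_(j in [set j | j \in index_iota 0 n]) (X j @^-1` extend A j)); last first.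
  apply/seteqP; split=> w h; last first.
    by move=> i; have := h i; rewrite /= extendE; apply; rewrite mem_index_iota ltn_ord.
  by move=> j /=; rewrite mem_index_iota => jn; have := h (Ordinal jn); rewrite -extendE.
rewrite e; last by move=> j _; exists (extend A j) => //; exact: measurable_extend.
by apply: eq_bigr => i _; rewrite extendE; have [_ ->] := hd i.
Qed.

Lemma iid_integral n (g : n.-tuple pt -> \bar R) : measurable_fun setT g ->
  (forall u, 0 <= g u)%E -> (\int[P]_w g (sample X n w) = \int[tprod mu n]_u g u)%E.
Proof.
move=> mg g0; rewrite (integral_sample mX measurableT indep mg g0).
by rewrite -[RHS]mul1e; congr (_ * _)%E; exact: probability_setT.
Qed.

Lemma cvg_mean_iid l : (fun n : nat => ((n%:R^-1)%:E *
    \int[P]_w ((V_count k l [seq X i w | i <- iota 0 n])%:R)%:E)%E) @ \oo --> (@pstar R d k l)%:E.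
Proof.
set u := (fun n : nat => _).
(* A typical vertex exists only among [n.+1] points, so the term at 0 is dropped. *)
suff h : (fun n => u n.+1) @ \oo --> (@pstar R d k l)%:E by rewrite (cvg_shiftS u) in h.
rewrite (_ : (fun n => _) = (fun n => tprod mu n.+1 (Dev k l))); first exact: cvg_Dev.
apply/funext => n; rewrite /u.
under eq_integral do rewrite sampleE.
rewrite (@iid_integral _ (fun u => ((V_count k l u)%:R)%:E))//; last first.
  by apply/measurable_EFinP; exact: measurable_V_count.
by rewrite integral_V_count// muleA -EFinM mulVf ?mul1e ?pnatr_eq0.
Qed.

Lemma ae_gp_sample : {ae P, forall w, forall n, gp (sample X n w)}.
Proof.
apply: ae_foralln => n.
have mg : measurable (~` [set u : n.-tuple pt | gp u]) by apply: measurableC; exact: measurable_gp.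
exists (sample X n @^-1` (~` [set u : n.-tuple pt | gp u])); split => //.
  by rewrite -[X in measurable X]setTI; exact: measurable_sample.
rewrite -(setIT (_ @^-1` _)); etransitivity; first exact: (sample_law mX measurableT indep mg).
by rewrite tprod_not_gp// mule0.
Qed.

Lemma V_count_step l w n : gp (sample X n.+1 w) ->
  `|(V_count k l (sample X n.+1 w))%:R - (V_count k l (sample X n w))%:R| <= (bdiff (d := d) k)%:R :> R.
Proof.
have p : perm_eq (sample X n.+1 w) (X n w :: sample X n w).
  by rewrite -!sampleE -addn1 iotaD map_cat /= cats1 perm_rcons.
move=> g; have g1 := perm_gp p g; have g2 := gp_cons g1.
rewrite !V_count_gp// (perm_Vdeg _ _ p); have [h1 h2] := Vdeg_cons k l g1.
by rewrite ler_distl lerBlDr -!natrD !ler_nat h1 h2.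
Qed.

Lemma ae_cvg_iid : {ae P, forall w, forall l : nat,
  (fun n : nat => (V_count k l [seq X i w | i <- iota 0 n])%:R / n%:R) @ \oo --> @pstar R d k l}.
Proof.
apply: ae_foralln => l.
pose m n := mean (tprod mu n) (fun u => (V_count k l u)%:R : R).
pose c : R := (2 * bdiff (d := d) k)%:R.
(* Normalized squared deviation at sample size [(j + 1) ^ 2], with integral at most
   [c ^ 2 / (j + 1) ^ 2]. *)
pose G j (u : (j.+1 ^ 2).-tuple pt) : R := (((V_count k l u)%:R - m (j.+1 ^ 2)%N) / (j.+1 ^ 2)%:R) ^+ 2.
have mG j : measurable_fun setT (G j).
  apply: measurable_funX; apply: measurable_funM => //; apply: measurable_funB => //.
  exact: measurable_V_count.
have hG j : (\int[P]_w (G j (sample X (j.+1 ^ 2) w))%:E <= (c ^+ 2 / (j.+1 ^ 2)%:R)%:E)%E.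
  have -> := @iid_integral _ (fun u => (G j u)%:E); last 2 first.
  - by apply/measurable_EFinP; exact: mG.
  - by move=> u; rewrite lee_fin sqr_ge0.
  set q := (j.+1 ^ 2)%N; have q0 : 0 < q%:R :> R by rewrite ltr0n expn_gt0.
  under eq_integral do rewrite /G -/q exprMn mulrC EFinM.
  rewrite ge0_integralZl_EFin ?sqr_ge0//; last 2 first.
  - by move=> u _; rewrite lee_fin sqr_ge0.
  - apply/measurable_EFinP; apply: measurable_funX; apply: measurable_funB => //.
    exact: measurable_V_count.
  have q2 : (0 <= (q%:R^-1 ^+ 2 : R)%:E)%E by rewrite lee_fin sqr_ge0.
  apply: le_trans (lee_wpmul2l q2 (variance_V_count d0 hlam hf k q l)) _.
  rewrite -EFinM lee_fin (_ : _ * _ = c ^+ 2 / q%:R)// -/c.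
  by field; rewrite gt_eqF.
have mGs j : measurable_fun setT (fun w => G j (sample X (j.+1 ^ 2)%N w)).
  by apply: measurableT_comp (mG j) _; exact: measurable_sample.
have aeG := ae_cvg0_summable (sqr_ge0 c) mGs (fun j w => sqr_ge0 _) hG.
apply: filterS2 aeG ae_gp_sample => w hw gw.
apply: (@cvg_interpolate_squares _ _ (bdiff (d := d) k)%:R) => [n|].
  by rewrite !sampleE; exact: V_count_step.
have h0 : (fun j => (V_count k l (sample X (j.+1 ^ 2) w))%:R / (j.+1 ^ 2)%:R - m (j.+1 ^ 2)%N / (j.+1 ^ 2)%:R) @ \oo --> (0 : R).
  apply/cvgr0Pnorm_le => e e0; move/cvgr0Pnorm_le : hw => /(_ _ (exprn_gt0 2 e0)).
  apply: filterS => j; by rewrite /G -mulrBl normrX ler_sqr ?nnegrE// ltW.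
have h1 : (fun j => m (j.+1 ^ 2)%N / (j.+1 ^ 2)%:R) @ \oo --> @pstar R d k l.
  have hc : (fun n => fine (tprod mu n.+1 (Dev k l))) @ \oo --> @pstar R d k l.
    by have /fine_cvg := @cvg_Dev R d k d0 lam hlam f hf l.
  have hs : (fun j => (j.+1 ^ 2).-1) @ \oo --> \oo.
    apply/cvgnyPge => A; near=> j; have Aj : (A <= j)%N by near: j; exact: nbhs_infty_ge.
    by apply: leq_trans Aj _; rewrite -ltnS prednK ?expn_gt0// -mulnn leq_pmulr.
  apply: cvg_trans (cvg_comp _ _ hs hc); apply: near_eq_cvg; apply: nearW => j /=.
  have q0 : (0 < j.+1 ^ 2)%N by rewrite expn_gt0.
  rewrite -(prednK q0); set n := _.-1.
  have := mean_V_count hf k n.+1 l; rewrite integral_V_count// -/mu -/(m n.+1) => e.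
  have -> : m n.+1 = n.+1%:R * fine (tprod mu n.+1 (Dev k l)).
    by apply: EFin_inj; rewrite -e EFinM fineK//; apply: fin_num_measure; exact: measurable_Dev.
  by rewrite mulrC mulKf// pnatr_eq0.
have -> : @pstar R d k l = 0 + @pstar R d k l by rewrite add0r.
apply: cvg_trans (cvgD h0 h1); apply: near_eq_cvg; apply: nearW => j.
by rewrite sampleE /= subrK.
Unshelve. all: by end_near. Qed.

End binomial.

Section poisson.
Variables (nu : R) (N : Omega -> nat).
Hypotheses (nu0 : 0 < nu) (hN : poisson_process_model P lam f nu N X).

Let mX i : measurable_fun setT (X i). Proof. by have [_ _ /(_ i)[]] := hN. Qed.
Let mE m : measurable (N @^-1` [set m]).
Proof. by have [mN _ _ _] := hN; rewrite -[X in measurable X]setTI; exact: mN. Qed.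
Let PE m : P (N @^-1` [set m]) = (pois_pmf nu m)%:E. Proof. by case: hN. Qed.

Lemma pois_pmf_ge0 m : 0 <= pois_pmf nu m.
Proof. by rewrite /pois_pmf !mulr_ge0 ?expR_ge0// ?exprn_ge0 ?ltW. Qed.

(** Size biasing: it turns the factor [m] of a mean count into a shift of the Poisson variable. *)
Lemma pois_pmfS m : pois_pmf nu m.+1 * m.+1%:R = nu * pois_pmf nu m.
Proof.
rewrite /pois_pmf factS natrM exprS; field.
by rewrite nat1r !pnatr_eq0 -lt0n fact_gt0.
Qed.

(** By size biasing [nu * pois_pmf nu m] is [m.+1] times a probability. So any fixed range of values
    has mass O(1/nu). *)
Lemma pois_pmf_le m : pois_pmf nu m <= m.+1%:R / nu.
Proof.
rewrite ler_pdivlMr// mulrC -pois_pmfS ger_pMl// /pois_pmf expRN ler_pdivrMr ?expR_gt0// mul1r.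
by apply: le_trans (expR_ge1Dxn m (ltW nu0)); rewrite lerDr.
Qed.

Let indep m n (A : 'I_n -> set pt) : (forall i, measurable (A i)) ->
  P (N @^-1` [set m] `&` [set w | forall i : 'I_n, A i (X i w)]) =
    (P (N @^-1` [set m]) * \prod_(i < n) mu (A i))%E.
Proof.
move=> mA; have [_ _ hd ind] := hN.
pose J := None :: [seq Some j | j <- index_iota 0 n].
have uJ : uniq J.
  rewrite /J /= map_inj_uniq ?iota_uniq ?andbT; last by move=> ? ? [].
  by apply/negP => /mapP[].
have := ind J (fun o => if o is Some j then X j @^-1` extend A j else N @^-1` [set m]) uJ.
rewrite big_cons big_map big_mkord => e; rewrite (_ : _ `&` _ =
    \bigcap_(j in [set j | j \in J]) (if j is Some j then X j @^-1` extend A j else N @^-1` [set m])); last first.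
  apply/seteqP; split=> w; last first.
    move=> h; split; first by have := h None; apply; rewrite /= mem_head.
    move=> i; have := h (Some (i : nat)); rewrite /= extendE; apply.
    by rewrite in_cons /= map_f// mem_index_iota ltn_ord.
  move=> [wm h] [j|] //=; rewrite in_cons /= mem_map; last by move=> ? ? [].
  by rewrite mem_index_iota => jn; have := h (Ordinal jn); rewrite -extendE.
rewrite e; last first.
  move=> [j|] _; last by exists [set m].
  by exists (extend A j) => //; exact: measurable_extend.
by congr (_ * _)%E; apply: eq_bigr => i _; rewrite extendE; have [_ ->] := hd i.
Qed.

Lemma integral_poisson_count (g : nat -> Omega -> \bar R) :
  (forall m, measurable_fun setT (g m)) -> (forall m w, 0 <= g m w)%E ->
  (\int[P]_w g (N w) w = \sum_(m <oo) \int[P]_(w in N @^-1` [set m]) g m w)%E.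
Proof.
move=> mg g0.
have UE : \bigcup_m (N @^-1` [set m]) = setT by apply/seteqP; split=> // w _; exists (N w).
have e m : {in N @^-1` [set m], (fun w => g (N w) w) =1 g m}.
  by move=> w; rewrite inE /= => ->.
rewrite -UE ge0_integral_bigcup//; last 2 first.
- apply/measurable_fun_bigcup => // m.
  apply: (eq_measurable_fun (g m)); first by move=> w wm; rewrite (e m).
  exact: measurable_funS (mg m).
- by apply/trivIsetP => i j _ _ ij; apply/seteqP; split=> // w [/= -> /eqP]; rewrite (negbTE ij).
by apply: eq_eseriesr => m _; apply: eq_integral => w; exact: e.
Qed.

Lemma integral_poisson_cst (a : nat -> R) : (forall m, 0 <= a m) ->
  (\int[P]_w (a (N w))%:E = \sum_(m <oo) (pois_pmf nu m * a m)%:E)%E.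
Proof.
move=> a0; rewrite (integral_poisson_count (g := fun m _ => (a m)%:E))//; last first.
  by move=> m w; rewrite lee_fin.
apply: eq_eseriesr => m _; rewrite integral_cst// EFinM muleC; congr (_ * _)%E; exact: PE.
Qed.

(** Given [N = m.+1], the mean count is [m.+1] times the probability for a typical vertex among [m]
    others, and the weight [m.+1 / nu] turns the law of [N] at [m.+1] into its law at [m]. The
    identity is exact: a typical vertex again sees a Poisson number of others. *)
Lemma poisson_mean l : ((nu^-1)%:E *
    \int[P]_w ((V_count k l [seq X i w | i <- iota 0 (N w)])%:R)%:E =
  \int[P]_w (fine (tprod mu (N w).+1 (Dev k l)))%:E)%E.
Proof.
have mV m : measurable_fun setT (fun u : m.-tuple pt => ((V_count k l u)%:R)%:E : \bar R).
  by apply/measurable_EFinP; exact: measurable_V_count.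
under eq_integral do rewrite sampleE.
rewrite (integral_poisson_count (g := fun m w => ((V_count k l (sample X m w))%:R)%:E))//; last first.
  by move=> m; apply: (measurableT_comp (mV m)); exact: measurable_sample.
have e m : (\int[P]_(w in N @^-1` [set m]) ((V_count k l (sample X m w))%:R)%:E =
    (pois_pmf nu m)%:E * \int[tprod mu m]_u ((V_count k l u)%:R)%:E)%E.
  rewrite (integral_sample mX (mE m) (@indep m) (mV m))//; congr (_ * _)%E; exact: PE.
have t0 m : (0 <= (pois_pmf nu m)%:E * \int[tprod mu m]_u ((V_count k l u)%:R)%:E)%E.
  by rewrite mule_ge0 ?lee_fin ?pois_pmf_ge0//; apply: integral_ge0 => u _; rewrite lee_fin.
rewrite (eq_eseriesr (fun m _ => e m)) nneseries_recl//.
rewrite [X in (_ * (X + _))%E](_ : _ = 0)%E; last first.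
  by rewrite (eq_integral (cst 0%E)) ?integral0 ?mule0// => u _; rewrite (tuple0 u).
rewrite add0e -nneseries_addn// -nneseriesZl//.
rewrite (integral_poisson_cst (a := fun m => fine (tprod mu m.+1 (Dev k l)))); last by move=> m; exact: fine_ge0.
apply: eq_eseriesr => m _; rewrite addn1 integral_V_count// -/mu.
have fD : tprod mu m.+1 (Dev k l) \is a fin_num by apply: fin_num_measure; exact: measurable_Dev.
rewrite -{1}(fineK fD) -!EFinM; congr (_ %:E); rewrite mulrA mulrA -(mulrA nu^-1) pois_pmfS mulKf//.
by rewrite gt_eqF.
Qed.

(** [N] is below [M] with probability at most [M * M / nu]; there [a] is only known to lie in
    [0, 1], elsewhere it is within [e] of [p]. *)
Lemma poisson_average (a : nat -> R) (p e : R) M : (forall m, 0 <= a m <= 1) ->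
  (forall m, (M <= m)%N -> `|a m - p| <= e) ->
  ((\int[P]_w (a (N w))%:E)%E \is a fin_num) /\
  `|fine (\int[P]_w (a (N w))%:E)%E - p| <= e + (M * M)%:R / nu.
Proof.
move=> a01 ap.
have a0 m : 0 <= a m by case/andP: (a01 m).
have a1 m : a m <= 1 by case/andP: (a01 m).
have mN (b : nat -> R) : measurable_fun setT (fun w => (b (N w))%:E).
  by have [mN _ _ _] := hN; apply/measurable_EFinP; exact: measurableT_comp mN.
have cstE := integral_cst_probability P.
have fa : (\int[P]_w (a (N w))%:E)%E \is a fin_num.
  rewrite ge0_fin_numE; last by apply: integral_ge0 => w _; rewrite lee_fin.
  apply: (@le_lt_trans _ _ (\int[P]_w 1%:E)%E); last by rewrite cstE ltry.
  by apply: ge0_le_integral => // w _; rewrite lee_fin.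
split=> //.
pose b m : R := (m < M)%:R.
have Ib : (\int[P]_w (b (N w))%:E <= ((M * M)%:R / nu)%:E)%E.
  rewrite integral_poisson_cst// (nneseries_split 0 M); last first.
    by move=> m _; rewrite lee_fin mulr_ge0// pois_pmf_ge0.
  rewrite add0n [X in (_ + X)%E]eseries0 ?adde0; last first.
    by move=> m Mm _; rewrite /b ltnNge Mm mulr0.
  rewrite sumEFin lee_fin natrM -mulrA.
  apply: (@le_trans _ _ (\sum_(0 <= m < M) (M%:R / nu))); last first.
    by rewrite sumr_const_nat subn0 [leRHS]mulr_natl.
  rewrite !big_mkord; apply: ler_sum => m _; rewrite /b ltn_ord mulr1.
  by apply: le_trans (pois_pmf_le m) _; rewrite ler_pM2r ?invr_gt0// ler_nat.
have aM := ap M (leqnn M); move: (aM); rewrite ler_norml => /andP[aM1 aM2].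
have b0 m : 0 <= b m by [].
have pe0 : 0 <= p + e by have := a0 M; lra.
have up : (\int[P]_w (a (N w))%:E <= (p + e)%:E + \int[P]_w (b (N w))%:E)%E.
  rewrite -[X in (X + _)%E]cstE -ge0_integralD//; try by move=> w _; rewrite lee_fin.
  apply: ge0_le_integral => //.
  - by move=> w _; rewrite lee_fin.
  - by apply: emeasurable_funD.
  - move=> w _; rewrite -EFinD lee_fin /b; have [h|h] := ltnP (N w) M.
      by apply: le_trans (a1 _) _; rewrite lerDr.
    by have := ap _ h; rewrite ler_norml => /andP[h1 h2]; rewrite addr0; lra.
have lo : ((p - e)%:E <= \int[P]_w (a (N w))%:E + \int[P]_w (b (N w))%:E)%E.
  (* Additivity is applied to nonnegative integrands, while [p - e] may be negative. *)
  apply: (@le_trans _ _ (Num.max 0 (p - e))%:E); first by rewrite lee_fin le_max lexx orbT.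
  rewrite -[leLHS]cstE -ge0_integralD//; try by move=> w _; rewrite lee_fin.
  apply: ge0_le_integral => //.
  - by move=> w _; rewrite lee_fin le_max lexx.
  - by apply: emeasurable_funD.
  - move=> w _; rewrite -EFinD lee_fin ge_max addr_ge0//= /b; have [h|h] := ltnP (N w) M.
      by have := a0 (N w); have := a1 M; rewrite mulr1n; lra.
    by have := ap _ h; rewrite ler_norml => /andP[h1 h2]; rewrite addr0; lra.
have up' := le_trans up (leeD2l _ Ib); have lo' := le_trans lo (leeD2l _ Ib).
move: up' lo'; rewrite -(fineK fa) -!EFinD !lee_fin => h1 h2.
rewrite ler_distl; apply/andP; split; lra.
Qed.

End poisson.

End iid.

(** After [poisson_mean] the integrand is a fixed sequence evaluated at [N nu], so the constants of
    [poisson_average] are uniform in [nu]. *)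
Lemma cvg_mean_poisson {R : realType} {d : nat} (k : nat) (d0 : (0 < d)%N)
    (lam : {measure set (d.-tuple R) -> \bar R}) (hlam : is_lebesgue_d lam)
    (f : d.-tuple R -> R) (hf : good_density lam f)
    {dO : measure_display} {Omega : measurableType dO}
    (P : R -> probability Omega R) (N : R -> Omega -> nat) (X : R -> nat -> Omega -> d.-tuple R) :
  (forall nu : R, 0 < nu -> poisson_process_model (P nu) lam f nu (N nu) (X nu)) ->
  forall l, (fun nu : R => ((nu^-1)%:E *
    \int[P nu]_w ((V_count k l [seq X nu i w | i <- iota 0 (N nu w)])%:R)%:E)%E)
    @ +oo --> (@pstar R d k l)%:E.
Proof.
move=> hN l; pose mu : probability (d.-tuple R) R := [the probability _ _ of dens hf].
pose a m := fine (tprod mu m.+1 (Dev k l)).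
have a01 m : 0 <= a m <= 1.
  rewrite fine_ge0//= -lee_fin fineK ?probability_le1//; first exact: measurable_Dev.
  by apply: fin_num_measure; exact: measurable_Dev.
have ca : a @ \oo --> @pstar R d k l by have /fine_cvg := @cvg_Dev R d k d0 lam hlam f hf l.
have key e : 0 < e -> exists M, forall nu, 0 < nu ->
    ((\int[P nu]_w (a (N nu w))%:E)%E \is a fin_num) /\
    `|fine (\int[P nu]_w (a (N nu w))%:E)%E - @pstar R d k l| <= e + M / nu.
  move=> e0; move/cvgrPdist_le : ca => /(_ _ e0) [M _ hM].
  exists (M * M)%:R => nu nu0; apply: (poisson_average nu0 (hN _ nu0)) => // m Mm.
  by rewrite distrC; exact: hM.
apply: cvg_EFin.
  near=> nu; have nu0 : 0 < nu by near: nu; exact: nbhs_pinfty_gt.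
  rewrite (poisson_mean k d0 hlam hf nu0 (hN _ nu0)).
  by have [M /(_ _ nu0)[]] := key 1 ltr01.
apply/cvgrPdist_le => e e0; have e2 : 0 < e / 2 by rewrite divr_gt0.
have [M hM] := key _ e2.
near=> nu; have nu0 : 0 < nu by near: nu; exact: nbhs_pinfty_gt.
rewrite /= (poisson_mean k d0 hlam hf nu0 (hN _ nu0)) distrC; have [_ h] := hM _ nu0.
apply: le_trans h _; rewrite [leRHS]splitr lerD2l ler_pdivrMr// mulrC -ler_pdivrMr// ltW//.
Unshelve. all: by end_near. Qed.

(** * The degree of the origin in a homogeneous Poisson process *)

Section poisson_degree.
Context {R : realType} {d : nat} (k : nat) (d0 : (0 < d)%N).
Local Notation pt := (d.-tuple R).
Variables (lam : {measure set pt -> \bar R}) (hlam : is_lebesgue_d lam).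
Context {dO : measure_display} {Omega : measurableType dO} (Q : probability Omega R)
  (H : Omega -> set pt).
Hypothesis hH : homogeneous_PPP Q lam H.
Local Notation o := (@origin R d).

Definition atleast m (B : set pt) : set Omega :=
  [set w | exists s : seq pt, [/\ uniq s, size s = m & forall z, z \in s -> H w z /\ B z]].

Lemma atleast_sub m (B B' : set pt) : B `<=` B' -> atleast m B `<=` atleast m B'.
Proof.
move=> BB' w [s [us ss sB]]; exists s; split=> // z /sB[Hz Bz]; split=> //; exact: BB'.
Qed.

(** Only exact counts are measurable by hypothesis; they are finite here and take countably many
    values. *)
Lemma measurable_atleast m B : measurable B -> bounded_pt B -> measurable (atleast m B).
Proof.
move=> mB bB; have [fin cnt _] := hH.
rewrite (_ : atleast m B = \bigcup_m' (if (m <= m')%N then [set w | count_is (H w) B m'] else set0)).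
  by apply: bigcup_measurable => m' _; case: ifP => // _; have [] := cnt B m' mB bB.
apply/seteqP; split=> w.
  move=> [s [us ss sB]]; have [m' [t [ut st tB]]] := fin w B mB bB.
  exists m' => //; rewrite -ss -st uniq_leq_size//; first by exists t.
  by move=> z /sB /tB.
move=> [m' _]; case: ifP => // mm' [t [ut st tB]].
exists (take m t); split; [exact: take_uniq|by rewrite size_takel// st|].
by move=> z /mem_take /tB.
Qed.

Lemma bounded_ball (a : pt) (r : R) (B : set pt) : B `<=` [set z | edist a z < r] -> bounded_pt B.
Proof.
move=> Br; exists (edist a o + r) => z /Br /= zr i.
have := coord_le_nrm (fun i => tnth z i - tnth o i) i; rewrite /= tnth_mktuple subr0 => h.
apply: le_trans h _; rewrite -edistE; apply: le_trans (edist_tri a _ _) _.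
by rewrite addrC lerD2l edistC ltW.
Qed.

Lemma bounded_gcell j z : bounded_pt (gcell (R := R) (d := d) j z).
Proof.
exists ((\sum_i `|(z i)%:~R / j.+1%:R|) + 1 : R) => x zx i; have /andP[h1 h2] := zx i.
have h3 : `|(z i)%:~R / j.+1%:R| <= \sum_i `|(z i)%:~R / j.+1%:R| :> R.
  by rewrite (bigD1 i)//= lerDl sumr_ge0.
have h4 : j.+1%:R^-1 <= 1 :> R by rewrite invf_le1// ler1n.
have key (a b c t : R) : a <= t -> t < a + c -> c <= 1 -> `|a| <= b -> `|t| <= b + 1.
  move=> ? ? ?; rewrite !ler_norml => /andP[? ?]; apply/andP; split; lra.
exact: key h1 h2 h4 h3.
Qed.

Lemma gcell_inj j z z' (x : pt) : gcell j z x -> gcell j z' x -> z = z'.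
Proof.
move=> zx z'x; apply/ffunP => i; have /andP[h1 h2] := zx i; have /andP[h3 h4] := z'x i.
have j0 : 0 < j.+1%:R^-1 :> R by rewrite invr_gt0.
have key (a b : int) : a%:~R / j.+1%:R <= tnth x i -> tnth x i < b%:~R / j.+1%:R + j.+1%:R^-1 -> a <= b.
  move=> g1 g2; have := le_lt_trans g1 g2; rewrite -[X in _ + X]mul1r -mulrDl ltr_pM2r//.
  by rewrite -[1]/(1%:~R) -intrD ltr_int ltzD1.
by apply/eqP; rewrite eq_le (key _ _ h1 h4) (key _ _ h3 h2).
Qed.

(** One scale for finitely many positive gaps. The factor 4 pays for moving two distances by a cell
    diameter and for the margin of two diameters in [measurable_linked]. *)
Lemma small_scale (T : eqType) (s : seq T) (g : T -> R) : (forall z, z \in s -> 0 < g z) ->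
  exists J, forall j, (J <= j)%N -> forall z, z \in s -> 4 * (d%:R / j.+1%:R) < g z.
Proof.
elim: s => [|z s IH] hs; first by exists 0%N.
have [J1 h1] := IH (fun y ys => hs y (mem_behead (s := z :: s) ys)).
have z0 : 0 < g z / 4 by rewrite divr_gt0// hs// mem_head.
have [J2 h2] := @gcell_diam_small R d _ z0.
exists (maxn J1 J2) => j; rewrite geq_max => /andP[j1 j2] y; rewrite in_cons => /predU1P[->|ys].
  by rewrite mulrC -ltr_pdivlMr//; exact: h2.
exact: h1.
Qed.

(* A finite set of points is resolved by fine enough grid cells, so that an existential
   quantifier over points of the process can be replaced by countable set operations. *)
Lemma measurable_ex_point (b : set pt) (G : pt -> Omega -> Prop)
    (D : nat -> {ffun 'I_d -> int} -> set Omega) : measurable b -> bounded_pt b ->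
  (forall j z, measurable (D j z)) ->
  (forall j z y w, gcell j z y -> G y w -> D j z w) ->
  (forall y w, ~ G y w -> exists J, forall j, (J <= j)%N -> forall z, gcell j z y -> ~ D j z w) ->
  measurable [set w | exists y, [/\ H w y, b y & G y w]].
Proof.
move=> mb bb mD GD NGD.
have mbz j z : measurable (b `&` gcell j z) by apply: measurableI => //; exact: measurable_gcell.
have bbz j z : bounded_pt (b `&` gcell (R := R) j z) by have [M hM] := bb; exists M => x [/hM].
rewrite (_ : mkset _ = \bigcap_j \bigcup_z (atleast 1 (b `&` gcell j z) `&` D j z)).
  apply: bigcapT_measurable => j; apply: measurable_count_bigcup => z.
  by apply: measurableI => //; exact: measurable_atleast.
apply/seteqP; split=> w.
  move=> [y [Hy by_ Gy]] j _; have [z zy] := gcell_cover j y.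
  exists z => //; split; last exact: GD zy Gy.
  by exists [:: y]; split=> // y'; rewrite inE => /eqP ->.
move=> h; apply: contrapT => nex.
have [fin _ _] := hH; have [m [t [ut st tb]]] := fin w b mb bb.
have [J hJ] : exists J, forall y, y \in t -> forall z, gcell J z y -> ~ D J z w.
  have nG y : y \in t -> ~ G y w by move=> /tb[Hy by_] Gy; apply: nex; exists y.
  have : exists J, forall j, (J <= j)%N -> forall y, y \in t -> forall z, gcell j z y -> ~ D j z w.
    elim: t nG {ut st tb} => [|y t IH] nG; first by exists 0%N.
    have [J1 h1] := IH (fun y' yt => nG y' (mem_behead (s := y :: t) yt)).
    have [J2 h2] := NGD _ _ (nG y (mem_head _ _)).
    exists (maxn J1 J2) => j; rewrite geq_max => /andP[j1 j2] y'; rewrite in_cons => /predU1P[->|yt].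
      exact: h2.
    exact: h1.
  by move=> [J hJ]; exists J; apply: hJ.
have [z _ [[s [us ss sb]] Dz]] := h J I.
case: s us ss sb => [|y [|? ?]]// _ _ /(_ y (mem_head _ _))[Hy [by_ zy]].
by apply: (hJ y _ z zy Dz); apply/tb.
Qed.

Definition gcorner j (z : {ffun 'I_d -> int}) : pt := [tuple (z i)%:~R / j.+1%:R | i < d].

Lemma gcell_gcorner j z : gcell j z (gcorner j z).
Proof. by move=> i; rewrite tnth_mktuple lexx/= ltrDl invr_gt0. Qed.

Let near_origin (y : pt) : set pt := [set z | z <> o /\ edist o z < edist o y].
Let near_point (y : pt) : set pt := [set z | [/\ z <> o, z <> y & edist y z < edist y o]].

(** An edge between the origin and [y], written so that both searches for [k] closer points are
    [atleast] events. *)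
Definition linked w y := y <> o /\ (~ atleast k (near_origin y) w \/ ~ atleast k (near_point y) w).

Let measurable_lt (a : pt) r : measurable [set z | edist a z < r].
Proof.
have := measurable_edist (Om := pt) (measurable_cst a) (@measurable_id _ _ _).
move=> /(_ measurableT _ (measurable_itv `]-oo, r[)); rewrite setTI; congr (measurable _).
Qed.

Let measurable_neq (a : pt) : measurable [set z : pt | z <> a].
Proof.
rewrite (_ : mkset _ = ~` [set z | edist z a = 0]).
  by apply: measurableC; exact: measurable_sphere.
by apply/seteqP; split=> z h e; apply: h; [exact: edist_eq0|by rewrite /= e edistxx].
Qed.

(** [D1] and [D2] replace [y] by the corner of its cell and shrink the regions by the possible
    error: they lie inside [near_origin y] and [near_point y] for all [y] of the cell and depend on
    the cell only. As the inequalities are strict, [k] given witnesses survive once the cell is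
    small. *)
Lemma measurable_linked (b : set pt) : measurable b -> bounded_pt b ->
  measurable [set w | exists y, [/\ H w y, b y & linked w y]].
Proof.
move=> mb bb.
have k1 (a b1 c e x : R) : a <= b1 + c -> c <= e -> 0 <= c -> 4 * e < a - x -> x < b1 - e by lra.
have k2 (yx gx yo go c e : R) : yx <= c + gx -> go <= c + yo -> c <= e -> gx < go - 2 * e -> yx < yo.
  by lra.
have k3 (yx gx yo go c e : R) : gx <= c + yx -> yo <= c + go -> 0 <= c -> c <= e ->
  4 * e < yo - yx -> gx < go - 2 * e by lra.
have k4 (e r c : R) : 0 <= c -> c <= e -> 4 * e < r -> r <= e -> False by lra.
pose b' := b `&` [set z | z <> o].
have mb' : measurable b' by exact: measurableI.
have bb' : bounded_pt b' by have [M hM] := bb; exists M => x [/hM].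
pose D1 j z : set pt := [set x | x <> o /\ edist o x < edist o (gcorner j z) - d%:R / j.+1%:R].
(* Lying outside the cell of [y] replaces [z <> y]; a point distinct from [y] eventually does. *)
pose D2 j z : set pt := [set x | [/\ x <> o, ~ gcell j z x &
  edist (gcorner j z) x < edist (gcorner j z) o - 2 * (d%:R / j.+1%:R)]].
rewrite (_ : mkset _ = [set w | exists y, [/\ H w y, b' y & ~ atleast k (near_origin y) w]] `|`
    [set w | exists y, [/\ H w y, b' y & ~ atleast k (near_point y) w]]); last first.
  apply/seteqP; split=> w.
    by move=> [y [Hy by_ [yo [h|h]]]]; [left|right]; exists y.
  by move=> [] [y [Hy [by_ yo] h]]; exists y; split=> //; split=> //; [left|right].
apply: measurableU.
- apply: (@measurable_ex_point _ _ (fun j z => ~` atleast k (D1 j z))) => //.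
  + move=> j z; apply: measurableC; apply: measurable_atleast.
      have -> : D1 j z = [set x | x <> o] `&`
        [set x | edist o x < edist o (gcorner j z) - d%:R / j.+1%:R] by [].
      exact: measurableI.
    by apply: (@bounded_ball o (edist o (gcorner j z) - d%:R / j.+1%:R)) => x [].
  + move=> j z y w zy; apply: contra_not; apply: atleast_sub => x [xo xl]; split=> //.
    apply: lt_le_trans xl _; rewrite lerBlDr; apply: le_trans (edist_tri y _ _) _.
    by rewrite lerD2l; apply: gcell_diam zy (gcell_gcorner j z).
  + move=> y w /contrapT[s [us ss sn]].
    have [J hJ] : exists J, forall j, (J <= j)%N -> forall z, z \in s ->
        4 * (d%:R / j.+1%:R) < edist o y - edist o z.
      by apply: small_scale => z /sn[_ [_ h]]; rewrite subr_gt0.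
    exists J => j Jj z zy; apply; exists s; split=> // x xs; have [Hx [xo _]] := sn _ xs.
    split=> //; split=> //.
    have e1 := gcell_diam (gcell_gcorner j z) zy.
    exact: k1 (edist_tri (gcorner j z) o y) e1 (edist_ge0 _ _) (hJ _ Jj _ xs).
- apply: (@measurable_ex_point _ _ (fun j z => ~` atleast k (D2 j z))) => //.
  + move=> j z; apply: measurableC; apply: measurable_atleast; last first.
      by apply: (@bounded_ball (gcorner j z) (edist (gcorner j z) o - 2 * (d%:R / j.+1%:R))) => x [].
    rewrite (_ : D2 j z = [set z | z <> o] `&` (~` gcell j z `&` [set x | edist (gcorner j z) x <
      edist (gcorner j z) o - 2 * (d%:R / j.+1%:R)])); last first.
      by apply/seteqP; split=> x; [move=> []|move=> [? []]].
    apply: measurableI => //; apply: measurableI => //.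
    by apply: measurableC; exact: measurable_gcell.
  + move=> j z y w zy; apply: contra_not; apply: atleast_sub => x [xo xz xl]; split=> //.
      by move=> xy; apply: xz; rewrite xy.
    have e1 := gcell_diam zy (gcell_gcorner j z); have e2 := edist_tri y (gcorner j z) o.
    rewrite (edistC (gcorner j z) y) in e2.
    exact: k2 (edist_tri (gcorner j z) y x) e2 e1 xl.
  + move=> y w /contrapT[s [us ss sn]].
    have [J1 hJ1] : exists J, forall j, (J <= j)%N -> forall z, z \in s ->
        4 * (d%:R / j.+1%:R) < edist y o - edist y z.
      by apply: small_scale => z /sn[_ [_ _ h]]; rewrite subr_gt0.
    have [J2 hJ2] : exists J, forall j, (J <= j)%N -> forall z, z \in s ->
        4 * (d%:R / j.+1%:R) < edist y z.
      by apply: small_scale => z /sn[_ [_ h _]]; apply: edist_gt0 => e; apply: h.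
    exists (maxn J1 J2) => j; rewrite geq_max => /andP[j1 j2] z zy; apply; exists s; split=> // x xs.
    have [Hx [xo xy _]] := sn _ xs; split=> //.
    have h1 := hJ1 _ j1 _ xs; have h2 := hJ2 _ j2 _ xs.
    have h3 := gcell_diam zy (gcell_gcorner j z); have h4 := edist_ge0 y (gcorner j z).
    split=> //; first by move=> /(gcell_diam zy); exact: k4 h4 h3 h2.
    have e1 := edist_tri y (gcorner j z) x; rewrite (edistC (gcorner j z) y) in e1.
    exact: k3 e1 (edist_tri (gcorner j z) y o) h4 h3 h1.
Qed.

Lemma knn_edge_linked w y :
  knn_edge k (H w `|` [set o]) o y <-> H w y /\ linked w y.
Proof.
split.
  move=> [[_ Sy yo h]|[Sy _ oy h]].
    have Hy : H w y by case: Sy.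
    split=> //; split=> //; left => -[s [us ss sn]]; apply: h; exists s; split=> // z /sn[Hz [zo zl]].
    by split=> //; left.
  have yo : y <> o by move=> e; apply: oy.
  have Hy : H w y by case: Sy.
  split=> //; split=> //; right => -[s [us ss sn]]; apply: h; exists s; split=> // z /sn[Hz [zo zy zl]].
  by split=> //; left.
move=> [Hy [yo [h|h]]]; [left|right]; split; [by right|by left|by []| |by left|by right|by move=> e; apply: yo|];
  move=> [s [us ss sn]]; apply: h; exists s; split=> // z /sn[Sz zo zl].
  by have Hz : H w z by case: Sz.
have zo' : z <> o by move=> e; rewrite e ltxx in zl.
by have Hz : H w z by case: Sz.
Qed.

Definition deg_ge m : set Omega := [set w | exists s : seq pt,
  [/\ uniq s, size s = m & forall y, y \in s -> H w y /\ linked w y]].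

(** Finitely many distinct points lie in distinct cells of a fine grid, so [m] linked points amount
    to [m] distinct cells each containing one. *)
Lemma measurable_deg_ge m : measurable (deg_ge m).
Proof.
pose E j (z : {ffun 'I_d -> int}) := [set w | exists y, [/\ H w y, gcell j z y & linked w y]].
have mE j z : measurable (E j z).
  by apply: measurable_linked; [exact: measurable_gcell|exact: bounded_gcell].
rewrite (_ : deg_ge m = \bigcup_j \bigcup_(Z : m.-tuple {ffun 'I_d -> int})
    (if uniq Z then \bigcap_(z in [set z | z \in tval Z]) E j z else set0)).
  apply: bigcup_measurable => j _; apply: measurable_count_bigcup => Z; case: ifP => // _.
  rewrite bigcap_seq; exact: bigsetI_measurable.
apply/seteqP; split=> w.
  move=> [s [us ss sL]].
  have [J hJ] : exists J, forall j, (J <= j)%N -> forall xy : pt * pt,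
      xy \in [seq xy <- [seq (x, y) | x <- s, y <- s] | xy.1 != xy.2] ->
      4 * (d%:R / j.+1%:R) < edist xy.1 xy.2.
    apply: (small_scale (g := fun xy : pt * pt => edist xy.1 xy.2)) => -[x y] /=.
    by rewrite mem_filter /= => /andP[/eqP xy _]; exact: edist_gt0.
  have /choice[c cP] := @gcell_cover R d J.
  have sz : size (map c s) == m by rewrite size_map ss.
  exists J => //; exists (Tuple sz) => //=.
  rewrite map_inj_in_uniq ?us.
    by move=> _ /= /mapP[x xs ->]; exists x; have [Hx Lx] := sL _ xs.
  move=> x y xs ys cxy; apply/eqP; rewrite -[_ == _]negbK; apply/negP => xy.
  have h1 := gcell_diam (cP x); have := h1 y; rewrite cxy => /(_ (cP y)).
  have := hJ J (leqnn J) (x, y); rewrite mem_filter /= xy allpairs_f// => /(_ isT).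
  have : 0 <= d%:R / J.+1%:R :> R by [].
  by move=> e0 e1 e2; have := lt_le_trans e1 e2; apply/negP; rewrite -leNgt ler_peMl// ler1n.
move=> [j _ [Z _]]; case: ifP => // uZ hZ.
have /choice[y yP] : forall z, exists y, z \in tval Z -> [/\ H w y, gcell j z y & linked w y].
  move=> z; have [zZ|] := boolP (z \in tval Z); last by exists o.
  by have [y hy] := hZ z zZ; exists y.
exists (map y Z); split; last by move=> _ /mapP[z zZ ->]; have [] := yP z zZ.
- rewrite map_inj_in_uniq// => z z' zZ z'Z e.
  have [_ h1 _] := yP _ zZ; have [_ h2 _] := yP _ z'Z; rewrite -e in h2; exact: gcell_inj h1 h2.
- by rewrite size_map size_tuple.
Qed.

Definition origin_deg l : set Omega := [set w | knn_deg_is k (H w `|` [set o]) o l].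

Lemma origin_degE l : origin_deg l = deg_ge l `\` deg_ge l.+1.
Proof.
apply/seteqP; split=> w.
  move=> [s [us ss sE]]; split.
    by exists s; split=> // y /sE /knn_edge_linked.
  move=> [t [ut st tL]]; have : (size t <= size s)%N.
    by apply: uniq_leq_size => // y /tL /knn_edge_linked /sE.
  by rewrite st ss ltnn.
move=> [[s [us ss sL]] ns]; exists s; split=> // y; split; first by move=> /sL /knn_edge_linked.
move=> /knn_edge_linked yL; apply: contrapT => /negP ys; apply: ns; exists (y :: s); split.
- by rewrite /= ys.
- by rewrite /= ss.
- by move=> z; rewrite in_cons => /predU1P[->|/sL].
Qed.

Lemma measurable_origin_deg l : measurable (origin_deg l).
Proof. by rewrite origin_degE; apply: measurableD; exact: measurable_deg_ge. Qed.

Section occupancy.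
Variables (M : nat) (h : R).
Hypothesis (h0 : 0 < h).
Local Notation C := (cells (d := d) k M).

Definition occupancy (A : {set C}) : set Omega :=
  [set w | forall c : C, count_is (H w) (cell o h c) (c \in A)].

Let cellE (c : C) : measurable (cell o h c : set pt) /\ bounded_pt (cell o h c : set pt).
Proof.
split; first exact: measurable_cell.
exists (\sum_i `|h * corner c i| + h) => x cx i; have /andP[] := cx i; rewrite tnth_mktuple.
have h3 : `|h * corner c i| <= \sum_i `|h * corner c i| :> R.
  by rewrite (bigD1 i)//= lerDl sumr_ge0.
have key (a b t : R) : `|h * a| <= b -> 0 + h * a <= t -> t < 0 + h * (a + 1) -> `|t| <= b + h.
  rewrite !ler_norml => /andP[? ?] ? ?; apply/andP; split; lra.
exact: key h3.
Qed.

Lemma measurable_occupancy A : measurable (occupancy A).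
Proof.
have [_ cnt _] := hH.
rewrite (_ : occupancy A = \big[setI/setT]_(c : C) [set w | count_is (H w) (cell o h c) (c \in A)]).
  apply: bigsetI_measurable => c _; have [mc bc] := cellE c.
  by have [] := cnt _ (c \in A : nat) mc bc.
rewrite -bigcap_seq; apply/seteqP; split=> w hw c; first by move=> _; exact: hw.
by apply: hw; rewrite /= mem_index_enum.
Qed.

(** Disjoint cells have independent Poisson counts of mean [h ^ d]; the cells are enumerated because
    independence is stated for sequences of sets. *)
Lemma Q_occupancy A : Q (occupancy A) = (weight (h ^+ d) A)%:E.
Proof.
have [_ cnt ind] := hH.
pose B i : set pt := if insub i is Some i' then cell o h (enum_val (i' : 'I_#|C|)) else set0.
pose m i : nat := if insub i is Some i' then (enum_val (i' : 'I_#|C|) \in A) else 0%N.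
have BE (i : 'I_#|C|) : B i = cell o h (enum_val i) by rewrite /B valK.
have mE (i : 'I_#|C|) : m i = (enum_val i \in A) by rewrite /m valK.
have := ind #|C| B m.
rewrite (_ : \bigcap_(i in _) _ = occupancy A); last first.
  apply/seteqP; split=> w hw.
    move=> c; have := hw (enum_rank c) (ltn_ord _); rewrite /= BE mE enum_rankK; exact.
  by move=> i /= iC; have := hw (enum_val (Ordinal iC)); rewrite -BE -mE.
move=> ->; last 2 first.
- by move=> i iC; rewrite (BE (Ordinal iC)); exact: cellE.
- move=> i j iC jC ij; rewrite (BE (Ordinal iC)) (BE (Ordinal jC)).
  apply/seteqP; split=> // x [xi xj]; apply: ij.
  by have := cell_inj h0 xi xj => /enum_val_inj /(congr1 val).
rewrite weightE (reindex_onto (enum_rank : C -> 'I__) enum_val)/=; last by move=> i _; exact: enum_valK.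
rewrite -prodEFin; apply: eq_big => [c|c _]; first by rewrite enum_rankK eqxx.
rewrite BE mE enum_rankK; have [mc bc] := cellE c; have [_ ->] := cnt _ (c \in A : nat) mc bc.
rewrite cell_cube lam_cube//= /pois_pmf; case: (c \in A) => /=.
  by rewrite expr1 -[1`!]/(1%N) divr1.
by rewrite expr0 fact0 divr1 mul1r.
Qed.

Lemma occupancy_deg A : (0 < M)%N -> @good R d k M A -> occupancy A `<=` origin_deg (@degA R d k M A).
Proof.
move=> M0 gA w hw; apply: (occ_deg (h := h)) => // c; have [s [us ss sE]] := hw c.
case: ifP => cA; rewrite cA in ss.
  case: s us ss sE => [|z [|? ?]]// _ _ sE; exists z; have [Hz cz] := (sE z).1 (mem_head _ _).
  by split=> // z' cz' Hz'; apply/eqP; rewrite -mem_seq1; apply/sE.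
move=> z cz Hz; have : z \in s by apply/sE.
by case: s ss {us sE}.
Qed.

Lemma occupancy_inj (A A' : {set C}) w : occupancy A w -> occupancy A' w -> A = A'.
Proof.
move=> hA hA'; apply/setP => c; have [s [us ss sE]] := hA c; have [t [ut st tE]] := hA' c.
have : size s = size t.
  by apply/perm_size/uniq_perm => // y; apply/idP/idP => [/sE/tE|/tE/sE].
by rewrite ss st; do 2 case: (_ \in _).
Qed.

End occupancy.

(** A fixed probability is a constant sequence, here with constant weights; [cvg_pstar] makes it
    tend to [pstar l], hence equal it. *)
Lemma Q_origin_deg l : Q (origin_deg l) = (@pstar R d k l)%:E.
Proof.
have mE := measurable_origin_deg l.
have fE : Q (origin_deg l) \is a fin_num by exact: fin_num_measure.
suff h : (fun _ : nat => fine (Q (origin_deg l))) @ \oo --> @pstar R d k l.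
  rewrite -(fineK fE); congr (_ %:E).
  exact: cvg_unique (cvg_cst _) h.
apply: cvg_pstar => // M h M0 h0.
have DM : _ <= fine (Q (origin_deg l)) <= _ := @degree_mass _ _ _ _ Q _ _ (occupancy h) origin_deg l
  (fun A => measurable_occupancy h A) measurable_origin_deg (@occupancy_inj M h)
  (fun _ _ _ => @knn_deg_is_inj _ _ _ _ _ _ _) (fun A => @occupancy_deg M h h0 A M0).
exists (fun _ A => fine (Q (occupancy h A))); split.
- by move=> A; rewrite Q_occupancy//; exact: cvg_cst.
- by apply: nearW => _; have /andP[] := DM.
- by apply: nearW => _; have /andP[] := DM.
Qed.

End poisson_degree.

Theorem theorem8p1 (R : realType) (d k : nat) (hd : (0 < d)%N) (hk : (1 <= k)%N)
  (lam : {measure set (d.-tuple R) -> \bar R}) (hlam : is_lebesgue_d lam)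
  (f : d.-tuple R -> R) (hf : good_density lam f) :
  exists K : nat, (k < K)%N /\
  exists p : nat -> R,
    [/\ (* p_l^* = P(deg(0; H_1 u {0}) = l) for every homogeneous rate-1 PPP H_1 *)
        forall (dH : measure_display) (OmegaH : measurableType dH)
          (Q : probability OmegaH R) (H : OmegaH -> set (d.-tuple R)),
          homogeneous_PPP Q lam H ->
          forall l : nat, (k <= l <= K)%N ->
            Q [set w | knn_deg_is k (H w `|` [set origin d]) (origin d) l]
              = (p l)%:E,
        \sum_(k <= l < K.+1) p l = 1,
        (* Poisson process P_nu: lim (1/nu) E[V_{l,nu}] = p_l^* *)
        forall (dO : measure_display) (Omega : measurableType dO)
          (P : R -> probability Omega R) (N : R -> Omega -> nat)
          (X : R -> nat -> Omega -> d.-tuple R),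
          (forall nu : R, 0 < nu -> poisson_process_model (P nu) lam f nu (N nu) (X nu)) ->
          forall l : nat, (k <= l <= K)%N ->
            (fun nu : R => ((nu^-1)%:E *
               \int[P nu]_w ((V_count k l [seq X nu i w | i <- iota 0 (N nu w)])%:R)%:E)%E)
              @ +oo --> (p l)%:E &
        (* binomial process X_n: a.s. and in mean *)
        forall (dO : measure_display) (Omega : measurableType dO)
          (P : probability Omega R) (X : nat -> Omega -> d.-tuple R),
          iid_density P lam f X ->
          (forall l : nat, (k <= l <= K)%N ->
            (fun n : nat => ((n%:R^-1)%:E *
               \int[P]_w ((V_count k l [seq X i w | i <- iota 0 n])%:R)%:E)%E)
              @ \oo --> (p l)%:E) /\
          {ae P, forall w, forall l : nat, (k <= l <= K)%N ->
            (fun n : nat => (V_count k l [seq X i w | i <- iota 0 n])%:R / n%:R)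
              @ \oo --> p l}].
Proof.
(* The degree bound of general position; it exceeds [k] because [k] and [ncones] are positive. *)
exists (k + k * @ncones d)%N; split.
  by rewrite -[ltnLHS]addn0 ltn_add2l muln_gt0 hk /ncones card_ffun !card_ord expn_gt0.
exists (@pstar R d k); split.
- by move=> dH OmegaH Q H hH l _; exact: (Q_origin_deg k hd hlam hH).
- exact: (sum_pstar k hd hlam hf).
- by move=> dO Omega P N X hN l _; exact: (cvg_mean_poisson hd hlam hf hN).
- move=> dO Omega P X hX; split; first by move=> l _; exact: (cvg_mean_iid hd hlam hf hX).
  by apply: filterS (ae_cvg_iid k hd hlam hf hX) => w h l _; exact: h.
Qed.
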